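(* Consider the stochastic gradient tracking iteration described in the context, under the function, network and gradient-noise assumptions of the context (convex case $\mu=0$), and let $\alpha_{\rm cvx}=\frac{\delta}{\sqrt{480}\,L\sqrt Q}$. Then for every $K\ge1$ there exists a stepsize $\alpha\in(0,\alpha_{\rm cvx}]$, depending on $K$, such that $$\frac1K\sum_{k=0}^{K-1}\left(\mathbb{E}[f(\bar x^k)-f(x^\star)]+\frac{L}{N}\mathbb{E}\|\widehat{\mathbf x}^k\|^2\right)=\mathcal O\left(\frac{\sigma}{\sqrt{NK}}+\frac{\tau}{1-\lambda}\left(\frac{\sigma}{K}\right)^{2/3}+\frac{\tau^2\widetilde X_0}{(1-\lambda)^2K}+\frac{\tau\bar E_0}{(1-\lambda)K}\right),$$ where $$\bar E_0=\frac1N\left(\|\widehat{\mathbf x}^0\|_{\mathbf R_0}^2+\frac{2\alpha_{\rm cvx}^2}{\eta^2}\|\nabla\mathbf f(\mathbf x^\star)\|_{\mathbf R_0}^2\right).$$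
   Context: **Problem and algorithm.** $N,d\ge1$ are integers; agent $i\in\{1,\dots,N\}$ has a differentiable objective $f_i:\mathbb{R}^d\to\mathbb{R}$, $f_i(x)=\mathbb{E}[F_i(x;\xi_i)]$, and $f=\frac1N\sum_{i=1}^N f_i$. $\nabla F_i(x;\xi)$ is the stochastic gradient in $x$. Given mixing matrices $W_k=(w_{ij}^k)\in\mathbb{R}^{N\times N}$, stepsize $\alpha>0$, initial points $x_i^0\in\mathbb{R}^d$ and $g_i^0=\nabla F_i(x_i^0;\xi_i^0)$, stochastic gradient tracking is, for $k\ge0$, $$x_i^{k+1}=\sum_{j=1}^N w_{ij}^k(x_j^k-\alpha g_j^k),\qquad g_i^{k+1}=\sum_{j=1}^N w_{ij}^k g_j^k+\nabla F_i(x_i^{k+1};\xi_i^{k+1})-\nabla F_i(x_i^k;\xi_i^k).$$ **Function assumption (convex case).** Each $f_i$ is convex and $L$-smooth (gradient $L$-Lipschitz), $L>0$. $f$ admits a minimizer; $x^\star$ is any (fixed) minimizer of $f$. **Network assumption.** $\{W_k\}_{k\ge0}$ is deterministic and each $W_k$ is nonnegative and doubly stochastic ($W_k\mathbf 1=\mathbf 1$, $\mathbf 1^{\mathsf T}W_k=\mathbf 1^{\mathsf T}$). With $\Pi=\frac1N\mathbf 1\mathbf 1^{\mathsf T}$ and $\widetilde W_k=W_k-\Pi$, there are an integer $\tau\ge1$ and $\lambda\in[0,1)$ with $\|\widetilde W_{k+\tau-1}\cdots\widetilde W_k\|_2\le\lambda$ for all $k\ge0$. Let $\Delta_\lambda=1-\lambda$.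 **Gradient-noise assumption.** $\mathcal F^k$ is the information ($\sigma$-algebra) available immediately before the samples $\xi_1^k,\dots,\xi_N^k$ are drawn; it contains the initialization and all iterates and samples generated up to iteration $k-1$ (so $x_i^k$ is $\mathcal F^k$-measurable). Conditioned on $\mathcal F^k$, the samples $\xi_1^k,\dots,\xi_N^k$ are mutually independent and, for every $i$, $\mathbb{E}[\nabla F_i(x_i^k;\xi_i^k)-\nabla f_i(x_i^k)\mid\mathcal F^k]=0$ and $\mathbb{E}[\|\nabla F_i(x_i^k;\xi_i^k)-\nabla f_i(x_i^k)\|^2\mid\mathcal F^k]\le\sigma^2$ (with $\sigma\ge0$). The initial iterates $x_i^0$ are deterministic. **Notation.** $\mathbf x^k=\mathrm{col}\{x_1^k,\dots,x_N^k\}\in\mathbb{R}^{Nd}$; $\nabla\mathbf f(\mathbf x)=\mathrm{col}\{\nabla f_i(x_i)\}_{i=1}^N$; $\mathbf x^\star=\mathbf 1\otimes x^\star$; $\widetilde{\mathbf W}_k=\widetilde W_k\otimes I_d$; $\bar x^k=\frac1N\sum_i x_i^k$; $\widehat{\mathbf x}^k=(\mathbf I-\Pi\otimes I_d)\mathbf x^k$; $\widetilde X_0=\|\bar x^0-x^\star\|^2$; $\eta=\frac{\Delta_\lambda}{2\tau}$; $\delta=\frac{1-\lambda^2}{\tau}$; $Q=1+\frac{8}{\eta^2}=1+\frac{32\tau^2}{\Delta_\lambda^2}$. $\mathbf R_0=\delta\sum_{r=0}^\infty\mathbf\Psi(r,0)^{\mathsf T}\mathbf\Psi(r,0)$ with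 $\mathbf\Psi(r,0)=\widetilde{\mathbf W}_{r-1}\cdots\widetilde{\mathbf W}_0$ for $r\ge1$, $\mathbf\Psi(0,0)=\mathbf I$ (the series converges under the network assumption), and $\|\mathbf q\|_{\mathbf R}^2=\mathbf q^{\mathsf T}\mathbf R\mathbf q$. **Meaning of $\mathcal O$.** $a=\mathcal O(b)$ means $a\le C\,b$ with a constant $C$ depending only on $L$ and $\widetilde X_0$ (in particular not on $K,N,\tau,\lambda,\sigma$). *)

(* Defs.v *)
From HB Require Import structures.
From mathcomp Require Import all_boot all_order all_algebra.
From mathcomp Require Import all_classical all_reals all_analysis.
From mathcomp Require Export mxtens.

Set Implicit Arguments.
Unset Strict Implicit.
Unset Printing Implicit Defensive.

Import Order.TTheory GRing.Theory Num.Theory.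
Import numFieldNormedType.Exports.

Local Open Scope classical_set_scope.
Local Open Scope ring_scope.

(* The norm `|_| that the library puts on matrices is the sup norm; these are
   the Euclidean norm and its square, for row and column vectors alike. *)
Definition sqnorm (R : realType) (m n : nat) (A : 'M[R]_(m, n)) : R :=
  \sum_i \sum_j A i j ^+ 2.

Definition enorm (R : realType) (m n : nat) (A : 'M[R]_(m, n)) : R :=
  Num.sqrt (sqnorm A).

Definition wsqnorm (R : realType) (n : nat) (M : 'M[R]_n) (q : 'cV[R]_n) : R :=
  (q^T *m M *m q) 0 0.

Definition spectral_norm (R : realType) (n : nat) (A : 'M[R]_n) : R :=
  sup [set enorm (A *m v) | v in [set v : 'cV[R]_n | enorm v <= 1]].

(* Points of R^d are rows. The gradient is the row of partial derivatives; the
   library's derivative operator is total, so differentiability is always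
   required separately. *)
Definition grad (R : realType) (d : nat) (f : 'rV[R]_d -> R) (x : 'rV[R]_d) :
    'rV[R]_d :=
  \row_j 'D_(delta_mx 0 j) f x.

Definition avg (R : realType) (N d : nat) (x : 'I_N -> 'rV[R]_d) : 'rV[R]_d :=
  N%:R^-1 *: \sum_i x i.

Definition avg_fun (R : realType) (N d : nat) (f : 'I_N -> 'rV[R]_d -> R)
    (x : 'rV[R]_d) : R :=
  N%:R^-1 * \sum_i f i x.

(* col{x_1, ..., x_N}: coordinate i * d + j is (x_i)_j, the index convention of
   [*t]. *)
Definition stack (R : realType) (N d : nat) (x : 'I_N -> 'rV[R]_d) :
    'cV[R]_(N * d) :=
  \col_p x (mxtens_unindex p).1 0 (mxtens_unindex p).2.

Definition Pi_mx (R : realType) (N : nat) : 'M[R]_N :=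
  N%:R^-1 *: ((const_mx 1 : 'cV[R]_N) *m (const_mx 1 : 'rV[R]_N)).

Definition xhat (R : realType) (N d : nat) (x : 'I_N -> 'rV[R]_d) :
    'cV[R]_(N * d) :=
  (1%:M - Pi_mx R N *t (1%:M : 'M[R]_d)) *m stack x.

(* [chain M s r] is M_{s+r-1} ... M_{s+1} M_s, later factors on the left. *)
Fixpoint chain (R : realType) (n : nat) (M : nat -> 'M[R]_n) (s r : nat) :
    'M[R]_n :=
  if r is r'.+1 then M (s + r')%N *m chain M s r' else 1%:M.

Definition Wtilde (R : realType) (N : nat) (W : nat -> 'M[R]_N) (k : nat) :
    'M[R]_N :=
  W k - Pi_mx R N.

Definition network_assumption (R : realType) (N : nat) (W : nat -> 'M[R]_N)
    (tau : nat) (lambda : R) : Prop :=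
  [/\ forall k i j, 0 <= W k i j,
      forall k, W k *m (const_mx 1 : 'cV[R]_N) = const_mx 1,
      forall k, (const_mx 1 : 'rV[R]_N) *m W k = const_mx 1,
      (1 <= tau)%N /\ 0 <= lambda < 1 &
      forall k, spectral_norm (chain (Wtilde W) k tau) <= lambda].

Definition function_assumption (R : realType) (N d : nat)
    (f : 'I_N -> 'rV[R]_d -> R) (L : R) (xstar : 'rV[R]_d) : Prop :=
  [/\ forall i x, differentiable (f i) x,
      forall i, @convex_function R 'rV[R]_d setT (f i),
      forall i x y, enorm (grad (f i) x - grad (f i) y) <= L * enorm (x - y) &
      forall y, avg_fun f xstar <= avg_fun f y].

(* [D i] is the law of the generic sample in f_i(x) = E[F_i(x; xi_i)]. *)
Definition stochastic_objective (R : realType) (N d : nat)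
    (dX : measure_display) (Xi : 'I_N -> measurableType dX)
    (D : forall i, probability (Xi i) R)
    (F : forall i, 'rV[R]_d -> Xi i -> R) (f : 'I_N -> 'rV[R]_d -> R) : Prop :=
  forall i,
    [/\ forall s x, differentiable (F i ^~ s) x,
        forall x, (D i).-integrable setT (EFin \o F i x) &
        forall x, ('E_(D i)[F i x] = (f i x)%:E)%E].

(* State (x^k, g^k) of gradient tracking, where [G k i x] is the gradient that
   agent i samples at x with its k-th sample. *)
Fixpoint gt_state (R : realType) (N d : nat) (W : nat -> 'M[R]_N) (alpha : R)
    (x0 : 'I_N -> 'rV[R]_d) (G : nat -> 'I_N -> 'rV[R]_d -> 'rV[R]_d)
    (k : nat) : ('I_N -> 'rV[R]_d) * ('I_N -> 'rV[R]_d) :=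
  if k is k'.+1 then
    let: (x, g) := gt_state W alpha x0 G k' in
    let x' := fun i => \sum_j W k' i j *: (x j - alpha *: g j) in
    (x', fun i => \sum_j W k' i j *: g j + G k'.+1 i (x' i) - G k' i (x i))
  else (x0, fun i => G 0%N i (x0 i)).

Definition sgt_x (R : realType) (N d : nat) (dX : measure_display)
    (Xi : 'I_N -> measurableType dX) (F : forall i, 'rV[R]_d -> Xi i -> R)
    (T : Type) (xi : nat -> forall i, T -> Xi i)
    (W : nat -> 'M[R]_N) (x0 : 'I_N -> 'rV[R]_d) (alpha : R)
    (k : nat) (w : T) : 'I_N -> 'rV[R]_d :=
  (gt_state W alpha x0
     (fun k i x => grad (fun y => F i y (xi k i w)) x) k).1.

Definition sgt_g (R : realType) (N d : nat) (dX : measure_display)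
    (Xi : 'I_N -> measurableType dX) (F : forall i, 'rV[R]_d -> Xi i -> R)
    (T : Type) (xi : nat -> forall i, T -> Xi i)
    (W : nat -> 'M[R]_N) (x0 : 'I_N -> 'rV[R]_d) (alpha : R)
    (k : nat) (w : T) : 'I_N -> 'rV[R]_d :=
  (gt_state W alpha x0
     (fun k i x => grad (fun y => F i y (xi k i w)) x) k).2.

Definition measurable_wrt (T : Type) (G : set (set T)) (dX : measure_display)
    (X : measurableType dX) (Y : T -> X) : Prop :=
  preimage_set_system setT Y measurable `<=` G.

(* [Y] is a version of the conditional expectation E[X | G]. *)
Definition is_cond_exp (dT : measure_display) (T : measurableType dT)
    (R : realType) (P : probability T R) (G : set (set T)) (X Y : T -> R) :
    Prop :=
  [/\ P.-integrable setT (EFin \o X),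
      P.-integrable setT (EFin \o Y),
      measurable_wrt G Y &
      forall A, G A ->
        (\int[P]_(w in A) (Y w)%:E = \int[P]_(w in A) (X w)%:E)%E].

(* Mutual independence given G: for all measurable B_i,
   P(Y_i \in B_i for all i | G) = \prod_i P(Y_i \in B_i | G) almost surely.
   Taking some B_i = setT gives the product rule over subfamilies; conditional
   expectations are a.s. unique, so the choice of versions is immaterial. *)
Definition cond_mutual_indep (dT : measure_display) (T : measurableType dT)
    (R : realType) (P : probability T R) (G : set (set T)) (N : nat)
    (dX : measure_display) (Xi : 'I_N -> measurableType dX)
    (Y : forall i, T -> Xi i) : Prop :=
  forall B : forall i, set (Xi i), (forall i, measurable (B i)) ->
    exists p : 'I_N -> T -> R,
      (forall i, is_cond_exp P G \1_(Y i @^-1` B i) (p i)) /\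
      is_cond_exp P G \1_(\bigcap_(i in [set: 'I_N]) (Y i @^-1` B i))
        (fun w => \prod_i p i w).

(* [Fk k] is the information available just before the k-th samples are drawn:
   x_i^0, ..., x_i^k, g_i^0, ..., g_i^{k-1} and xi_i^0, ..., xi_i^{k-1} are
   measurable with respect to it (x_i^k is produced by iteration k-1, whereas
   g_i^k uses the k-th sample). Vectors are measurable coordinatewise. *)
Definition information (dT : measure_display) (T : measurableType dT)
    (R : realType) (N d : nat) (dX : measure_display)
    (Xi : 'I_N -> measurableType dX) (xi : nat -> forall i, T -> Xi i)
    (x g : nat -> T -> 'I_N -> 'rV[R]_d) (Fk : nat -> set (set T)) : Prop :=
  forall k,
    [/\ sigma_algebra setT (Fk k),
        Fk k `<=` measurable,
        forall l i j, (l <= k)%N -> measurable_wrt (Fk k) (fun w => x l w i 0 j),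
        forall l i j, (l < k)%N -> measurable_wrt (Fk k) (fun w => g l w i 0 j) &
        forall l i, (l < k)%N -> measurable_wrt (Fk k) (xi l i)].

Definition gradient_noise_assumption (dT : measure_display)
    (T : measurableType dT) (R : realType) (P : probability T R) (N d : nat)
    (dX : measure_display) (Xi : 'I_N -> measurableType dX)
    (F : forall i, 'rV[R]_d -> Xi i -> R) (f : 'I_N -> 'rV[R]_d -> R)
    (sigma : R) (xi : nat -> forall i, T -> Xi i)
    (W : nat -> 'M[R]_N) (x0 : 'I_N -> 'rV[R]_d) (alpha : R)
    (Fk : nat -> set (set T)) : Prop :=
  let x := sgt_x F xi W x0 alpha in
  let g := sgt_g F xi W x0 alpha in
  let s k i w := grad (fun y => F i y (xi k i w)) (x k w i)
                 - grad (f i) (x k w i) in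
  information xi x g Fk /\
  forall k,
    [/\ cond_mutual_indep P (Fk k) (xi k),
        forall i j, is_cond_exp P (Fk k) (fun w => s k i w 0 j) (cst 0) &
        forall i, exists V : T -> R,
          is_cond_exp P (Fk k) (fun w => sqnorm (s k i w)) V /\
          {ae P, forall w, V w <= sigma ^+ 2}].

Definition Delta (R : realType) (lambda : R) : R := 1 - lambda.

Definition eta (R : realType) (tau : nat) (lambda : R) : R :=
  Delta lambda / (2 * tau%:R).

Definition delta (R : realType) (tau : nat) (lambda : R) : R :=
  (1 - lambda ^+ 2) / tau%:R.

Definition Qcst (R : realType) (tau : nat) (lambda : R) : R :=
  1 + 8 / eta tau lambda ^+ 2.

Definition alpha_cvx (R : realType) (L : R) (tau : nat) (lambda : R) : R :=
  delta tau lambda / (Num.sqrt 480 * L * Num.sqrt (Qcst tau lambda)).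

Definition Psi0 (R : realType) (N d : nat) (W : nat -> 'M[R]_N) (r : nat) :
    'M[R]_(N * d) :=
  chain (fun k => Wtilde W k *t (1%:M : 'M[R]_d)) 0 r.

(* The matrix series is summed entrywise. *)
Definition R0 (R : realType) (N d : nat) (W : nat -> 'M[R]_N) (tau : nat)
    (lambda : R) : 'M[R]_(N * d) :=
  delta tau lambda *: \matrix_(p, q)
    limn (series (fun r => ((Psi0 d W r)^T *m Psi0 d W r) p q)).

Definition Ebar0 (R : realType) (N d : nat) (f : 'I_N -> 'rV[R]_d -> R)
    (L : R) (xstar : 'rV[R]_d) (W : nat -> 'M[R]_N) (tau : nat) (lambda : R)
    (x0 : 'I_N -> 'rV[R]_d) : R :=
  N%:R^-1 *
    (wsqnorm (R0 d W tau lambda) (xhat x0)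
     + 2 * alpha_cvx L tau lambda ^+ 2 / eta tau lambda ^+ 2
       * wsqnorm (R0 d W tau lambda) (stack (fun i => grad (f i) xstar))).

(* Main.v *)
Require Import Defs.
From HB Require Import structures.
From mathcomp Require Import all_boot all_order all_algebra.
From mathcomp Require Import all_classical all_reals all_analysis.
From mathcomp Require Import measurable_realfun.
From mathcomp Require Import ring lra.

Set Implicit Arguments.
Unset Strict Implicit.
Unset Printing Implicit Defensive.

Import Order.TTheory GRing.Theory Num.Theory.
Import numFieldNormedType.Exports.

Local Open Scope classical_set_scope.
Local Open Scope ring_scope.

(**
Notation: [rho = tau / (1 - lambda)]; [X^k] is the [N x d] matrix whose rows
are the iterates, [H^k] the one of the sampled gradients, [Psi(k, l)] the
product of the matrices [Wtilde_m], [l <= m < k], and [Pi] the averaging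
matrix. Two estimates are proved and then combined.

Disagreement. Gradient tracking is linear in the sampled gradients, so the
disagreement can be solved for explicitly: for every constant matrix [c],
[(1 - Pi) X^k = Psi(k,0) ((1 - Pi) X^0 - alpha k c)
                - alpha sum_(l < k) A(k,l) (H^l - c)],
with [A(k,l) = (k - l) Psi(k,l) - (k - l - 1) Psi(k,l+1)]
([consensus_shifted]). Take for [c] the gradients at the minimizer. The first
term, summed over [k], is what the norm weighted by [R0] measures
([R0_ge], [sum_initial_le]). The difference [H^l - c] splits into the noise and
a drift. The noise is orthogonal across time, so its contribution is governed
by the sum of the squares of the norms of [A(k,l)], of order [rho^3]: this is
where the factor [tau / (1 - lambda)] in front of [(sigma / K)^(2/3)] comes
from, the crude bound by the square of the sum being of order [rho^4]. For the
drift the crude bound is enough, because it is controlled by the gap and the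
disagreement themselves with a factor [alpha^2 rho^4 L^2] that a small step
size makes negligible ([consensus_bound]).

Descent. The mean of the iterates follows a gradient descent whose bias is
controlled by the disagreement and whose noise has variance
[sigma^2 / N] by conditional independence of the samples ([descent_sum]).

The two linear inequalities between the accumulated gap and the accumulated
disagreement are solved in [combine_bounds]; the inverse step size is then the
sum of the three quantities that each have to be dominated, which balances all
the terms ([stepsize_bounds]).

The probabilistic part needs orthogonality of noises from conditional
hypotheses. Across time it is the pull-out property of conditional expectation
([integral_mul_eq0]). Across agents, independence is given for events only; it
is transferred to the noises by Dynkin systems ([cond_indep_orthogonal]), once
the noise of an agent is known to be measurable with respect to the past and
its own sample. This last fact rests on the measurability of Caratheodory
functions ([caratheodory_measurable]) applied to difference quotients
([measurable_grad]), as the gradient of [F_i(., s)] need not be continuous.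
*)

(** * Inner products and norms of matrices *)

Section norms.
Context (R : realType).

Lemma cauchy_schwarz (I : finType) (a b : I -> R) :
  (\sum_i a i * b i) ^+ 2 <= (\sum_i a i ^+ 2) * (\sum_i b i ^+ 2).
Proof.
set C := \sum_i _; set A := \sum_i a i ^+ 2; set B := \sum_i b i ^+ 2.
have B0 : 0 <= B by apply: sumr_ge0 => i _; exact: sqr_ge0.
have : 0 <= \sum_i (B * a i - C * b i) ^+ 2.
  by apply: sumr_ge0 => i _; exact: sqr_ge0.
have -> : \sum_i (B * a i - C * b i) ^+ 2 = B * (A * B - C ^+ 2).
  have e1 : B ^+ 2 * A = \sum_i B ^+ 2 * a i ^+ 2 by rewrite mulr_sumr.
  have e2 : 2 * B * C * C = \sum_i 2 * B * C * (a i * b i) by rewrite mulr_sumr.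
  have e3 : C ^+ 2 * B = \sum_i C ^+ 2 * b i ^+ 2 by rewrite mulr_sumr.
  transitivity (B ^+ 2 * A - 2 * B * C * C + C ^+ 2 * B); last by ring.
  rewrite e1 e2 e3 -sumrB -big_split /=.
  by apply: eq_bigr => i _; ring.
have [B0' _|B1] := eqVneq B 0; last first.
  by rewrite pmulr_rge0 ?subr_ge0// lt_neqAle eq_sym B1.
suff -> : C = 0 by rewrite B0' mulr0 expr0n.
rewrite /C big1// => i _.
move/eqP: B0'; rewrite psumr_eq0; last by move=> j _; exact: sqr_ge0.
by move=> /allP /(_ i); rewrite mem_index_enum sqrf_eq0 => /(_ isT) /eqP ->; rewrite mulr0.
Qed.

Lemma weighted_cauchy_schwarz (I : finType) (a z : I -> R) :
  (forall i, 0 <= a i) ->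
  (\sum_i a i * z i) ^+ 2 <= (\sum_i a i) * (\sum_i a i * z i ^+ 2).
Proof.
move=> a0.
have := cauchy_schwarz (fun i => Num.sqrt (a i)) (fun i => Num.sqrt (a i) * z i).
under eq_bigr do rewrite mulrA -expr2 sqr_sqrtr//.
under [X in _ <= X * _ -> _]eq_bigr do rewrite sqr_sqrtr//.
by under [X in _ <= _ * X -> _]eq_bigr do rewrite exprMn sqr_sqrtr//.
Qed.

Definition mxdot m n (A B : 'M[R]_(m, n)) : R := \sum_i \sum_j A i j * B i j.

Section mxdot.
Context (m n : nat).
Implicit Types A B C : 'M[R]_(m, n).

Lemma sqnormE A : sqnorm A = mxdot A A.
Proof. by apply: eq_bigr => i _; apply: eq_bigr => j _; rewrite expr2. Qed.

Lemma mxdotC A B : mxdot A B = mxdot B A.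
Proof. by apply: eq_bigr => i _; apply: eq_bigr => j _; rewrite mulrC. Qed.

Lemma mxdotDl A B C : mxdot (A + B) C = mxdot A C + mxdot B C.
Proof.
rewrite -big_split; apply: eq_bigr => i _; rewrite -big_split.
by apply: eq_bigr => j _; rewrite mxE mulrDl.
Qed.

Lemma mxdotZl a A B : mxdot (a *: A) B = a * mxdot A B.
Proof.
rewrite /mxdot mulr_sumr; apply: eq_bigr => i _; rewrite mulr_sumr.
by apply: eq_bigr => j _; rewrite mxE mulrA.
Qed.

Lemma mxdot0l A : mxdot 0 A = 0.
Proof. by rewrite -(scale0r A) mxdotZl mul0r. Qed.

Lemma mxdotNl A B : mxdot (- A) B = - mxdot A B.
Proof. by rewrite -scaleN1r mxdotZl mulN1r. Qed.

Lemma mxdotBl A B C : mxdot (A - B) C = mxdot A C - mxdot B C.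
Proof. by rewrite mxdotDl mxdotNl. Qed.

Lemma mxdotDr A B C : mxdot A (B + C) = mxdot A B + mxdot A C.
Proof. by rewrite mxdotC mxdotDl !(mxdotC A). Qed.

Lemma mxdotZr a A B : mxdot A (a *: B) = a * mxdot A B.
Proof. by rewrite mxdotC mxdotZl mxdotC. Qed.

Lemma mxdotBr A B C : mxdot A (B - C) = mxdot A B - mxdot A C.
Proof. by rewrite mxdotC mxdotBl !(mxdotC A). Qed.

Lemma mxdot_suml I (r : seq I) (P : pred I) (F : I -> 'M[R]_(m, n)) B :
  mxdot (\sum_(i <- r | P i) F i) B = \sum_(i <- r | P i) mxdot (F i) B.
Proof.
apply: (@big_morph _ _ (fun x => mxdot x B) 0 +%R 0 +%R).
  by move=> x y; rewrite mxdotDl.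
exact: mxdot0l.
Qed.

Lemma sqnorm_ge0 A : 0 <= sqnorm A.
Proof. by apply: sumr_ge0 => i _; apply: sumr_ge0 => j _; exact: sqr_ge0. Qed.

Lemma sqnormD A B : sqnorm (A + B) = sqnorm A + 2 * mxdot A B + sqnorm B.
Proof. by rewrite !sqnormE mxdotDl !mxdotDr (mxdotC B A); ring. Qed.

Lemma sqnormZ a A : sqnorm (a *: A) = a ^+ 2 * sqnorm A.
Proof. by rewrite !sqnormE mxdotZl mxdotZr; ring. Qed.

Lemma sqnormN A : sqnorm (- A) = sqnorm A.
Proof. by rewrite -scaleN1r sqnormZ sqrrN expr1n mul1r. Qed.

Lemma sqnormB A B : sqnorm (A - B) = sqnorm A - 2 * mxdot A B + sqnorm B.
Proof. by rewrite sqnormD sqnormN mxdotC mxdotNl mxdotC; ring. Qed.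

Lemma sqnorm0 : sqnorm (0 : 'M[R]_(m, n)) = 0.
Proof. by rewrite -(scale0r 0) sqnormZ expr0n mul0r. Qed.

Lemma sqnormD_le A B : sqnorm (A + B) <= 2 * sqnorm A + 2 * sqnorm B.
Proof. have := sqnorm_ge0 (A - B); rewrite sqnormB sqnormD; lra. Qed.

Lemma sqnorm_eq0 A : sqnorm A = 0 -> A = 0.
Proof.
move/eqP; rewrite psumr_eq0 => [/allP H|i _]; last by apply: sumr_ge0 => j _; exact: sqr_ge0.
apply/matrixP => i j; have := H i; rewrite mem_index_enum => /(_ isT).
rewrite psumr_eq0 => [/allP/(_ j)|? _]; last exact: sqr_ge0.
by rewrite mem_index_enum sqrf_eq0 mxE => /(_ isT)/eqP.
Qed.

Lemma mxdot_cs A B : mxdot A B ^+ 2 <= sqnorm A * sqnorm B.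
Proof.
rewrite /mxdot /sqnorm !pair_bigA /=.
exact: (cauchy_schwarz (fun p => A p.1 p.2) (fun p => B p.1 p.2)).
Qed.

Lemma enorm_ge0 A : 0 <= enorm A. Proof. exact: sqrtr_ge0. Qed.

Lemma sqr_enorm A : enorm A ^+ 2 = sqnorm A.
Proof. by rewrite sqr_sqrtr ?sqnorm_ge0. Qed.

Lemma mxdot_le A B : mxdot A B <= enorm A * enorm B.
Proof.
rewrite /enorm -sqrtrM ?sqnorm_ge0//.
apply: (@le_trans _ _ `|mxdot A B|); first exact: ler_norm.
by rewrite -sqrtr_sqr ler_wsqrtr// mxdot_cs.
Qed.

Lemma enormD A B : enorm (A + B) <= enorm A + enorm B.
Proof.
rewrite -(@ler_pXn2r _ 2)// ?nnegrE ?addr_ge0 ?enorm_ge0//.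
rewrite sqr_enorm sqnormD -!sqr_enorm.
have := mxdot_le A B; nra.
Qed.

Lemma enorm_le A (c : R) B : 0 <= c -> (enorm A <= c * enorm B) = (sqnorm A <= c ^+ 2 * sqnorm B).
Proof.
move=> c0; rewrite -(@ler_pXn2r _ 2)// ?nnegrE ?mulr_ge0 ?enorm_ge0//.
by rewrite exprMn !sqr_enorm.
Qed.

Lemma enorm_sum I (r : seq I) (P : pred I) (F : I -> 'M[R]_(m, n)) :
  enorm (\sum_(i <- r | P i) F i) <= \sum_(i <- r | P i) enorm (F i).
Proof.
elim/big_rec2: _ => [|i y x _ IH]; first by rewrite /enorm sqnorm0 sqrtr0.
by rewrite (le_trans (enormD _ _))// lerD2l.
Qed.

Lemma enormZ a A : enorm (a *: A) = `|a| * enorm A.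
Proof. by rewrite /enorm sqnormZ sqrtrM ?sqr_ge0// sqrtr_sqr. Qed.

End mxdot.

(** Weighted so that it can be summed over the time index of a convolution:
together with [sum_conv] it is the [l^1 * l^2] case of the Young inequality. *)
Lemma sqnorm_weighted_sum m n m' n' k (Y : 'I_k -> 'M[R]_(m, n))
    (Z : 'I_k -> 'M[R]_(m', n')) (a : 'I_k -> R) :
  (forall l, 0 <= a l) -> (forall l, enorm (Y l) <= a l * enorm (Z l)) ->
  sqnorm (\sum_l Y l) <= (\sum_l a l) * \sum_l a l * sqnorm (Z l).
Proof.
move=> a0 YZ; rewrite -sqr_enorm.
apply: (@le_trans _ _ ((\sum_l a l * enorm (Z l)) ^+ 2)).
  rewrite ler_pXn2r ?nnegrE ?enorm_ge0//; last first.
    by apply: sumr_ge0 => l _; rewrite mulr_ge0// enorm_ge0.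
  by rewrite (le_trans (enorm_sum _ _ _))// ler_sum.
have := weighted_cauchy_schwarz (fun l => enorm (Z l)) a0.
by under [X in _ <= _ * X -> _]eq_bigr do rewrite sqr_enorm.
Qed.

Lemma sqnorm_col m n (A : 'M[R]_(m, n)) : sqnorm A = \sum_j sqnorm (col j A).
Proof.
rewrite /sqnorm exchange_big; apply: eq_bigr => j _; apply: eq_bigr => i _.
by rewrite big_ord1 mxE.
Qed.

Lemma sqnorm_row m n (A : 'M[R]_(m, n)) : sqnorm A = \sum_i sqnorm (row i A).
Proof.
apply: eq_bigr => i _; rewrite /sqnorm big_ord1.
by apply: eq_bigr => j _; rewrite mxE.
Qed.

Lemma sqnorm_mulmx_col m n p (M : 'M[R]_(m, n)) (X : 'M[R]_(n, p)) c :
  (forall v : 'cV[R]_n, sqnorm (M *m v) <= c * sqnorm v) ->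
  sqnorm (M *m X) <= c * sqnorm X.
Proof.
move=> H; rewrite (sqnorm_col X) sqnorm_col mulr_sumr; apply: ler_sum => j _.
by rewrite colE -mulmxA -colE.
Qed.

Lemma sqnorm_mulmx m n (A : 'M[R]_(m, n)) (v : 'cV[R]_n) :
  sqnorm (A *m v) <= sqnorm A * sqnorm v.
Proof.
rewrite /sqnorm mulr_suml; apply: ler_sum => i _; rewrite big_ord1 mxE.
rewrite (le_trans (cauchy_schwarz _ _))//.
by under [X in _ <= _ * X]eq_bigr do rewrite big_ord1.
Qed.

(** [spectral_norm] is a supremum of reals, so the set of values has to be bounded;
the Frobenius norm is a bound. *)
Lemma spectral_norm_le n (A : 'M[R]_n) (v : 'cV[R]_n) c :
  spectral_norm A <= c -> enorm (A *m v) <= c * enorm v.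
Proof.
move=> Ac; have [v0|v0] := eqVneq (enorm v) 0.
  have -> : v = 0 by apply: sqnorm_eq0; rewrite -sqr_enorm v0 expr0n.
  by rewrite mulmx0 /enorm sqnorm0 sqrtr0 mulr0.
have vp : 0 < enorm v by rewrite lt_neqAle eq_sym v0 enorm_ge0.
rewrite -ler_pdivrMr//; apply: le_trans Ac.
rewrite -[_ / _]mulrC.
have -> : (enorm v)^-1 * enorm (A *m v) = enorm (A *m ((enorm v)^-1 *: v)).
  by rewrite -scalemxAr enormZ gtr0_norm// invr_gt0.
apply: ub_le_sup; last first.
  exists ((enorm v)^-1 *: v) => //=.
  by rewrite enormZ gtr0_norm ?invr_gt0// mulVf.
exists (enorm A) => _ [u /= u1 <-].
rewrite /enorm ler_wsqrtr// (le_trans (sqnorm_mulmx _ _))//.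
rewrite ler_piMr ?sqnorm_ge0// -sqr_enorm expr_le1// enorm_ge0//.
Qed.

End norms.

(** * Sums of geometrically decaying weights *)

Section decay_sums.
Context (R : realType).
Implicit Types (b u c v : nat -> R).

(** The terms of index at least [tau] are compared with terms [tau] steps
earlier. Applied to [u r = r ^ p * b r] with [b (r + tau) <= mu * b r] it gives
an inequality in which the same sum appears on both sides with a factor [mu] on
the right, which is how the next lemmas avoid block decompositions. *)
Lemma sum_shift_le u c v (tau n : nat) :
  (forall r, 0 <= c r) -> (forall r, 0 <= v r) ->
  (forall r, (r < tau)%N -> u r <= c r) -> (forall r, u (r + tau)%N <= v r) ->
  \sum_(r < n) u r <= \sum_(r < n) c r + \sum_(r < n) v r.
Proof.
move=> c0 v0 uc uv.
suff : \sum_(r < n) u r <= \sum_(r < n) c r + \sum_(r < n - tau) v r.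
  move=> /le_trans; apply; rewrite lerD2l.
  rewrite (big_ord_widen n v) ?leq_subr// [leRHS](bigID (fun i : 'I_n => (i < n - tau)%N))/=.
  by rewrite lerDl; apply: sumr_ge0.
elim: n => [|n IH]; first by rewrite sub0n !big_ord0 addr0.
rewrite [leLHS]big_ord_recr [X in _ <= X + _]big_ord_recr /=.
have [nt|tn] := ltnP n tau.
  have -> : (n.+1 - tau = 0)%N by apply/eqP; rewrite subn_eq0.
  have := IH; have -> : (n - tau = 0)%N by apply/eqP; rewrite subn_eq0 ltnW.
  by rewrite !big_ord0 !addr0 => IH'; rewrite lerD// uc.
rewrite subSn// big_ord_recr /=.
have := uv (n - tau)%N; rewrite subnK// => h; have := c0 n; lra.
Qed.

Context (mu : R) (tau : nat).
Context (mu01 : 0 <= mu < 1) (tau1 : (1 <= tau)%N).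
Local Notation rho := (tau%:R / (1 - mu)).

Section fixed_b.
Context b (n : nat).
Context (b0 : forall r, 0 <= b r) (bmu : forall r, b (r + tau)%N <= mu * b r).

Let mu0 : 0 <= mu. Proof. by case/andP: mu01. Qed.
Let mu1 : 0 < 1 - mu. Proof. by rewrite subr_gt0; case/andP: mu01. Qed.
Let T0_ge0 : 0 <= \sum_(r < n) b r. Proof. exact: sumr_ge0. Qed.
Let t0 : (0 : R) <= tau%:R. Proof. by []. Qed.
Let rhot : tau%:R <= rho.
Proof. by rewrite ler_pdivlMr// ler_piMr// lerBlDr lerDl. Qed.
Let rhoE : (1 - mu) * rho = tau%:R.
Proof. by rewrite mulrC divfK// lt0r_neq0. Qed.

Lemma decay_sum0 : (forall r, (r < tau)%N -> b r <= 1) -> \sum_(r < n) b r <= rho.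
Proof.
move=> b1; rewrite ler_pdivlMr//.
have H : \sum_(r < n) b r <=
    \sum_(r < n) (if (r < tau)%N then 1 else 0) + \sum_(r < n) mu * b r.
  apply: (@sum_shift_le b (fun r => if (r < tau)%N then 1 else 0) (fun r => mu * b r) tau).
  - by move=> r; case: ifP.
  - by move=> r; exact: mulr_ge0.
  - by move=> r rt; rewrite rt b1.
  - exact: bmu.
have H2 : \sum_(r < n) (if (r < tau)%N then 1 else 0) <= tau%:R :> R.
  rewrite -big_mkcond /= sumr_const ler_nat.
  have [nt|tn] := leqP n tau.
    by rewrite (leq_trans (max_card _))// card_ord.
  rewrite -sum1_card -(big_ord_widen n (fun=> 1%N)) ?sum1_card ?card_ord//.
  exact: ltnW.
rewrite -mulr_sumr in H; nra.
Qed.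

Lemma decay_sum1 : \sum_(r < n) r%:R * b r <= 2 * rho * \sum_(r < n) b r.
Proof.
set T0 := \sum_(r < n) b r; set T1 := \sum_(r < n) _.
have H : T1 <= \sum_(r < n) tau%:R * b r + \sum_(r < n) mu * ((r + tau)%:R * b r).
  apply: (@sum_shift_le (fun r => r%:R * b r) (fun r => tau%:R * b r)
     (fun r => mu * ((r + tau)%:R * b r)) tau).
  - by move=> r; exact: mulr_ge0.
  - by move=> r; rewrite !mulr_ge0.
  - by move=> r rt; rewrite ler_wpM2r// ler_nat ltnW.
  - by move=> r; rewrite [leRHS]mulrCA ler_wpM2l.
have e1 : \sum_(r < n) tau%:R * b r = tau%:R * T0 by rewrite mulr_sumr.
have e2 : \sum_(r < n) mu * ((r + tau)%:R * b r) = mu * (T1 + tau%:R * T0).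
  rewrite -mulr_sumr; congr (_ * _); rewrite [in RHS]mulr_sumr -big_split/=.
  by apply: eq_bigr => r _; rewrite natrD mulrDl.
rewrite e1 e2 in H.
have H1 : (1 - mu) * T1 <= 2 * tau%:R * T0.
  have : mu * (tau%:R * T0) <= tau%:R * T0.
    by rewrite ler_piMl ?mulr_ge0//; case/andP: mu01 => _ /ltW.
  lra.
rewrite -(ler_pM2l mu1) (le_trans H1)//.
by rewrite [leRHS](_ : _ = 2 * ((1 - mu) * rho) * T0); [rewrite rhoE|ring].
Qed.

(** This bound is relative to the mass of [b], not to its size at the origin:
it applies to the squared norms [b k] of [Psi(k,0) c] as well as to [decay]. *)
Lemma decay_sum2 : \sum_(r < n) r%:R ^+ 2 * b r <= 6 * rho ^+ 2 * \sum_(r < n) b r.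
Proof.
have := decay_sum1.
set T0 := \sum_(r < n) b r; set T1 := \sum_(r < n) r%:R * b r; set T2 := \sum_(r < n) _.
move=> HT1.
have H : T2 <= \sum_(r < n) tau%:R ^+ 2 * b r + \sum_(r < n) mu * ((r + tau)%:R ^+ 2 * b r).
  apply: (@sum_shift_le (fun r => r%:R ^+ 2 * b r) (fun r => tau%:R ^+ 2 * b r)
     (fun r => mu * ((r + tau)%:R ^+ 2 * b r)) tau).
  - by move=> r; rewrite mulr_ge0 ?sqr_ge0.
  - by move=> r; rewrite !mulr_ge0 ?sqr_ge0.
  - by move=> r rt; rewrite ler_wpM2r// ler_pXn2r ?nnegrE// ler_nat ltnW.
  - by move=> r; rewrite [leRHS]mulrCA ler_wpM2l ?sqr_ge0.
have e1 : \sum_(r < n) tau%:R ^+ 2 * b r = tau%:R ^+ 2 * T0 by rewrite mulr_sumr.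
have e2 : \sum_(r < n) mu * ((r + tau)%:R ^+ 2 * b r) =
    mu * (T2 + 2 * tau%:R * T1 + tau%:R ^+ 2 * T0).
  rewrite -mulr_sumr; congr (_ * _); rewrite ![in RHS]mulr_sumr -!big_split/=.
  by apply: eq_bigr => r _; rewrite natrD; ring.
rewrite e1 e2 in H.
have T1_ge0 : 0 <= T1 by apply: sumr_ge0 => r _; exact: mulr_ge0.
have mule1 x : 0 <= x -> mu * x <= x.
  by move=> x0; rewrite ler_piMl//; case/andP: mu01 => _ /ltW.
have m1 : mu * (tau%:R ^+ 2 * T0) <= tau%:R ^+ 2 * T0 by apply: mule1; rewrite mulr_ge0 ?sqr_ge0.
have m2 : mu * (2 * tau%:R * T1) <= 2 * tau%:R * T1 by apply: mule1; rewrite !mulr_ge0.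
have m3 : tau%:R * T1 <= tau%:R * (2 * rho * T0) by apply: ler_wpM2l.
have m4 : tau%:R ^+ 2 * T0 <= tau%:R * rho * T0.
  by rewrite ler_wpM2r// expr2 ler_wpM2l.
have H1 : (1 - mu) * T2 <= 6 * tau%:R * rho * T0.
  rewrite !mulrDr in H; lra.
rewrite -(ler_pM2l mu1) (le_trans H1)//.
by rewrite [leRHS](_ : _ = 6 * ((1 - mu) * rho) * rho * T0); [rewrite rhoE|ring].
Qed.
End fixed_b.

(** The bound on the norm of a product of [r] consecutive [Wtilde] matrices that
the network assumption gives, by grouping them in blocks of length [tau]. *)
Definition decay (r : nat) : R := mu ^+ (r %/ tau).

Lemma decay_ge0 r : 0 <= decay r.
Proof. by rewrite exprn_ge0//; case/andP: mu01. Qed.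

Lemma decay_le1 r : decay r <= 1.
Proof. by case/andP: mu01 => a b; rewrite exprn_ile1// ltW. Qed.

Lemma decayD r : decay (r + tau) = mu * decay r.
Proof. by rewrite /decay divnDr// divnn tau1 addn1 exprS. Qed.

Lemma decayS r : decay r.+1 <= decay r.
Proof.
case/andP: mu01 => a b; rewrite /decay ler_wiXn2l// ?(ltW b)//.
by apply: leq_div2r; exact: leqnSn.
Qed.

Lemma rho_ge1 : 1 <= rho.
Proof.
case/andP: mu01 => a b; rewrite ler_pdivlMr ?subr_gt0// mul1r.
by apply: (@le_trans _ _ 1); [rewrite lerBlDr lerDl|rewrite ler1n].
Qed.

Lemma sum_decay_lin n : \sum_(r < n) (2 * r%:R + 1) * decay r <= 5 * rho ^+ 2.
Proof.
have b0 := decay_ge0.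
have bm r : decay (r + tau)%N <= mu * decay r by rewrite decayD.
have S0 : \sum_(r < n) decay r <= rho by apply: decay_sum0 => // r _; exact: decay_le1.
have S1 := decay_sum1 n b0 bm.
have -> : \sum_(r < n) (2 * r%:R + 1) * decay r =
    2 * (\sum_(r < n) r%:R * decay r) + \sum_(r < n) decay r.
  by rewrite mulr_sumr -big_split/=; apply: eq_bigr => r _; ring.
have := rho_ge1; set T0 := \sum_(r < n) decay r in S0 S1 *; nra.
Qed.

Lemma sum_decay_quad n : \sum_(r < n) ((2 * r%:R + 1) * decay r) ^+ 2 <= 33 * rho ^+ 3.
Proof.
pose b r := decay r ^+ 2.
have b0 r : 0 <= b r by exact: sqr_ge0.
have bm r : b (r + tau)%N <= mu * b r.
  rewrite /b decayD exprMn ler_wpM2r ?sqr_ge0// expr2 ler_piMl//.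
    by case/andP: mu01.
  by case/andP: mu01 => _ /ltW.
have S0 : \sum_(r < n) b r <= rho.
  apply: decay_sum0 => // r _; rewrite /b expr_le1 ?decay_le1 ?decay_ge0//.
have S1 := decay_sum1 n b0 bm.
have S2 := decay_sum2 n b0 bm.
have -> : \sum_(r < n) ((2 * r%:R + 1) * decay r) ^+ 2 =
    4 * (\sum_(r < n) r%:R ^+ 2 * b r) + 4 * (\sum_(r < n) r%:R * b r) + \sum_(r < n) b r.
  rewrite !mulr_sumr -!big_split/=; apply: eq_bigr => r _; rewrite /b; ring.
have := rho_ge1; set T0 := \sum_(r < n) b r in S0 S1 S2 *; move=> r1.
have h1 : rho ^+ 2 * T0 <= rho ^+ 3.
  by rewrite [leRHS]exprSr ler_wpM2l ?sqr_ge0.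
have h2 : rho * T0 <= rho ^+ 3.
  apply: (@le_trans _ _ (rho * rho)); first by rewrite ler_wpM2l//; lra.
  by rewrite -expr2 ler_weXn2l.
have h3 : rho <= rho ^+ 3 by rewrite -[leLHS]expr1 ler_weXn2l.
lra.
Qed.

End decay_sums.

(** * Mixing matrices and the tracking recursion *)

Section mixing.
Context (R : realType) (N : nat) (hN : (1 <= N)%N).
Local Notation Pi := (Pi_mx R N).

Let N0 : (N%:R : R) != 0. Proof. by rewrite pnatr_eq0 -lt0n. Qed.

Lemma Pi_mxE i j : Pi i j = N%:R^-1.
Proof. by rewrite !mxE big_ord1 !mxE mulr1 mulr1. Qed.

Lemma Pi_mulE d (X : 'M[R]_(N, d)) i j :
  (Pi *m X) i j = N%:R^-1 * \sum_k X k j.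
Proof. by rewrite mxE mulr_sumr; apply: eq_bigr => k _; rewrite Pi_mxE. Qed.

Lemma Pi_idem : Pi *m Pi = Pi.
Proof.
apply/matrixP => i j; rewrite Pi_mulE Pi_mxE.
under eq_bigr do rewrite Pi_mxE.
by rewrite sumr_const card_ord -[X in _ * X]mulr_natr mulVf// mulr1.
Qed.

Lemma mulmx_Pi (W : 'M[R]_N) :
  W *m (const_mx 1 : 'cV[R]_N) = const_mx 1 -> W *m Pi = Pi.
Proof. by move=> W1; rewrite /Pi_mx -scalemxAr mulmxA W1. Qed.

Lemma Pi_mulmx (W : 'M[R]_N) :
  (const_mx 1 : 'rV[R]_N) *m W = const_mx 1 -> Pi *m W = Pi.
Proof. by move=> W1; rewrite /Pi_mx -scalemxAl -mulmxA W1. Qed.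

Lemma mxdot_Pi d (A B : 'M[R]_(N, d)) : mxdot (Pi *m A) B = mxdot A (Pi *m B).
Proof.
rewrite /mxdot exchange_big [RHS]exchange_big; apply: eq_bigr => j _.
under eq_bigr do rewrite Pi_mulE.
under [RHS]eq_bigr do rewrite Pi_mulE.
by rewrite -mulr_suml -mulr_sumr mulrAC mulrC mulrA.
Qed.

Lemma mxdot_proj d (A B : 'M[R]_(N, d)) :
  mxdot ((1%:M - Pi) *m A) (Pi *m B) = 0.
Proof.
by rewrite mulmxBl mul1mx mxdotBl -!mxdot_Pi mulmxA Pi_idem subrr.
Qed.

Lemma sqnorm_proj_le d (X : 'M[R]_(N, d)) : sqnorm ((1%:M - Pi) *m X) <= sqnorm X.
Proof.
have e : X = (1%:M - Pi) *m X + Pi *m X by rewrite mulmxBl mul1mx subrK.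
by rewrite [X in _ <= sqnorm X]e sqnormD mxdot_proj mulr0 addr0 lerDl sqnorm_ge0.
Qed.

(** Jensen inequality along each row, then summation along the columns. *)
Lemma sqnorm_stochastic (W : 'M[R]_N) d (X : 'M[R]_(N, d)) :
  (forall i j, 0 <= W i j) -> W *m (const_mx 1 : 'cV[R]_N) = const_mx 1 ->
  (const_mx 1 : 'rV[R]_N) *m W = const_mx 1 ->
  sqnorm (W *m X) <= sqnorm X.
Proof.
move=> W0 W1 W1'; rewrite -[leRHS]mul1r; apply: sqnorm_mulmx_col => v.
rewrite mul1r.
have r1 i : \sum_j W i j = 1.
  have /matrixP/(_ i 0) := W1; rewrite !mxE => <-.
  by apply: eq_bigr => j _; rewrite mxE mulr1.
have c1 j : \sum_i W i j = 1.
  have /matrixP/(_ 0 j) := W1'; rewrite !mxE => <-.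
  by apply: eq_bigr => i _; rewrite mxE mul1r.
apply: (@le_trans _ _ (\sum_i \sum_j W i j * v j 0 ^+ 2)).
  apply: ler_sum => i _; rewrite big_ord1 mxE.
  rewrite (le_trans (weighted_cauchy_schwarz _ (W0 i)))//.
  by rewrite r1 mul1r.
rewrite exchange_big; apply: ler_sum => j _.
by rewrite -mulr_suml c1 mul1r big_ord1.
Qed.

Context (W : nat -> 'M[R]_N) (tau : nat) (lambda : R).
Context (hW : network_assumption W tau lambda).
Local Notation Wt := (Wtilde W).

Lemma W_Pi k : W k *m Pi = Pi.
Proof. by case: hW => _ h _ _ _; exact: mulmx_Pi. Qed.
Lemma Pi_W k : Pi *m W k = Pi.
Proof. by case: hW => _ _ h _ _; exact: Pi_mulmx. Qed.
Lemma WtE k : Wt k = W k *m (1%:M - Pi).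
Proof. by rewrite mulmxBr mulmx1 W_Pi. Qed.
Lemma WtE' k : (1%:M - Pi) *m W k = Wt k.
Proof. by rewrite mulmxBl mul1mx Pi_W. Qed.
Lemma Wt_Pi k : Wt k *m Pi = 0.
Proof. by rewrite mulmxBl W_Pi Pi_idem subrr. Qed.
Lemma Wt_proj k : Wt k *m (1%:M - Pi) = Wt k.
Proof. by rewrite mulmxBr mulmx1 Wt_Pi subr0. Qed.
Lemma Wt_W k l : Wt l *m W k = Wt l *m Wt k.
Proof. by rewrite mulmxBr Wt_Pi subr0. Qed.

Lemma sqnorm_Wt k d (X : 'M[R]_(N, d)) : sqnorm (Wt k *m X) <= sqnorm X.
Proof.
case: hW => h1 h2 h3 _ _; rewrite WtE -mulmxA.
exact: le_trans (sqnorm_stochastic _ (h1 k) (h2 k) (h3 k)) (sqnorm_proj_le _).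
Qed.

Lemma chainD (M : nat -> 'M[R]_N) s r t :
  chain M s (r + t) = chain M (s + r) t *m chain M s r.
Proof.
elim: t => [|t IH]; first by rewrite addn0 /= mul1mx.
by rewrite addnS /= IH mulmxA addnA.
Qed.

Let lam01 : 0 <= lambda < 1. Proof. by case: hW => _ _ _ []. Qed.
Let tau1 : (1 <= tau)%N. Proof. by case: hW => _ _ _ []. Qed.

(** Full blocks of length [tau] contract by [lambda]; the remaining factors are
doubly stochastic matrices times a projection, hence do not expand. *)
Lemma enorm_chain s r d (X : 'M[R]_(N, d)) :
  enorm (chain Wt s r *m X) <= decay lambda tau r * enorm X.
Proof.
rewrite enorm_le ?decay_ge0//.
rewrite [in chain _ _ r](divn_eq r tau) /decay.
set q := (r %/ tau)%N; set m := (r %% tau)%N; move: q m => q m; clear r.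
have H0 t u (Y : 'M[R]_(N, d)) : sqnorm (chain Wt t u *m Y) <= sqnorm Y.
  elim: u => [|u IH]; first by rewrite /= mul1mx.
  by rewrite /= -mulmxA (le_trans (sqnorm_Wt _ _)).
rewrite chainD -mulmxA (le_trans (H0 _ _ _))//.
elim: q => [|q IH]; first by rewrite mul0n /= mul1mx expr0 expr1n mul1r.
rewrite mulSnr chainD -mulmxA (exprS lambda) exprMn -mulrA.
apply: (le_trans (y := lambda ^+ 2 * sqnorm (chain Wt s (q * tau) *m X))).
  apply: sqnorm_mulmx_col => v.
  case: hW => _ _ _ _ /(_ (s + q * tau)%N) /spectral_norm_le => /(_ v).
  by rewrite enorm_le//; case/andP: lam01.
by rewrite ler_wpM2l// sqr_ge0.
Qed.

(** The response of the disagreement at time [k] to a unit step of the gradient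
at time [l], up to the factor [- alpha]: the step is tracked forever, hence is
injected once at each of the [k - l] later times, and each copy has travelled
through all the mixing steps between [l] and [k]. *)
Definition track_step (k l : nat) : 'M[R]_N := (k - l)%:R *: chain Wt l (k - l).
(** The response to an impulse at time [l] is a difference of responses to steps. *)
Definition track_impulse (k l : nat) : 'M[R]_N := track_step k l - track_step k l.+1.

Lemma enorm_track_impulse k l d (X : 'M[R]_(N, d)) : (l < k)%N ->
  enorm (track_impulse k l *m X) <=
    (2 * (k - l.+1)%:R + 1) * decay lambda tau (k - l.+1) * enorm X.
Proof.
move=> lk; rewrite /track_impulse /track_step mulmxBl -!scalemxAl.
rewrite (le_trans (enormD _ _))// -scaleN1r !enormZ !normr_nat normrN1 mul1r.
have -> : (k - l = (k - l.+1).+1)%N by rewrite -subSn.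
set r := (k - l.+1)%N.
have h1 := enorm_chain l r.+1 X; have h2 := enorm_chain l.+1 r X.
have h3 : decay lambda tau r.+1 * enorm X <= decay lambda tau r * enorm X.
  by rewrite ler_wpM2r ?enorm_ge0// decayS.
have h4 : r.+1%:R * enorm (chain Wt l r.+1 *m X) <= r.+1%:R * (decay lambda tau r * enorm X).
  by rewrite ler_wpM2l// (le_trans h1).
have h5 : r%:R * enorm (chain Wt l.+1 r *m X) <= r%:R * (decay lambda tau r * enorm X).
  by rewrite ler_wpM2l.
rewrite (le_trans (lerD h4 h5))// -natr1; lra.
Qed.

(** A constant gradient is a single step at time [0]. *)
Lemma sum_track_impulse k : \sum_(l < k) track_impulse k l = k%:R *: chain Wt 0 k.
Proof.
have H m : \sum_(l < m) track_impulse k l = track_step k 0 - track_step k m.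
  elim: m => [|m IH]; first by rewrite big_ord0 subrr.
  by rewrite big_ord_recr /= IH /track_impulse addrA subrK.
by rewrite H /track_step subnn scale0r subr0 subn0.
Qed.

Section tracking.
Context (d : nat) (X G H : nat -> 'M[R]_(N, d)) (alpha : R).
Context (G0 : G 0%N = H 0%N).
Context (XS : forall k, X k.+1 = W k *m (X k - alpha *: G k)).
Context (GS : forall k, G k.+1 = W k *m G k + H k.+1 - H k).

(** The invariant behind the method: averaging the update telescopes the gradient
differences. *)
Lemma Pi_tracking k : Pi *m G k = Pi *m H k.
Proof.
elim: k => [|k IH]; first by rewrite G0.
by rewrite GS mulmxBr mulmxDr mulmxA Pi_W IH addrAC subrr add0r.
Qed.

Lemma Pi_iterate k : Pi *m X k.+1 = Pi *m X k - alpha *: (Pi *m H k).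
Proof. by rewrite XS mulmxA Pi_W mulmxBr -scalemxAr Pi_tracking. Qed.

(** [W k] may be replaced by [Wtilde W k] behind another [Wtilde] factor, so the
tracking variable can be solved for as a combination of the [H l]. *)
Lemma Wt_tracking k : Wt k *m G k =
  \sum_(l < k) (chain Wt l (k.+1 - l) - chain Wt l.+1 (k - l)) *m H l + Wt k *m H k.
Proof.
elim: k => [|k IH]; first by rewrite big_ord0 add0r G0.
rewrite GS mulmxBr mulmxDr mulmxA Wt_W -mulmxA IH big_ord_recr /=.
rewrite mulmxDr mulmx_sumr -!addrA; congr (_ + _).
  apply: eq_bigr => l _; have lk := ltn_ord l.
  rewrite mulmxA mulmxBr; congr ((_ - _) *m _).
    rewrite (_ : k.+2 - l = (k.+1 - l).+1)%N; last by rewrite subSn// ltnW// ltnW.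
    by rewrite /= subnKC// ltnW// ltnW.
  rewrite (_ : k.+1 - l = (k - l).+1)%N; last by rewrite subSn// ltnW.
  by rewrite /= addSn subnKC// ltnW.
have -> : (k.+2 - k = 2)%N by rewrite -addn2 addKn.
have -> : (k.+1 - k = 1)%N by rewrite -addn1 addKn.
rewrite /= !addn0 addn1 !mulmx1 [(Wt k.+1 *m Wt k - _) *m _]mulmxBl mulmxA.
by rewrite -!addrA; congr (_ + _); rewrite addrC.
Qed.

Lemma consensus_expansion k : (1%:M - Pi) *m X k =
  chain Wt 0 k *m ((1%:M - Pi) *m X 0%N) - alpha *: \sum_(l < k) track_impulse k l *m H l.
Proof.
elim: k => [|k IH]; first by rewrite big_ord0 scaler0 subr0 /= mul1mx.
have -> : (1%:M - Pi) *m X k.+1 =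
    Wt k *m ((1%:M - Pi) *m X k) - alpha *: (Wt k *m G k).
  by rewrite XS mulmxA WtE' [LHS]mulmxBr -scalemxAr [in RHS]mulmxA Wt_proj.
rewrite IH [Wt k *m (_ - _)]mulmxBr -scalemxAr -addrA [LHS]addrC [RHS]addrC.
congr (_ + _); last by rewrite [LHS]mulmxA.
rewrite -opprD -scalerDr; congr (- (_ *: _)).
rewrite Wt_tracking [in RHS]big_ord_recr /= addrA mulmx_sumr -big_split /=; congr (_ + _).
  apply: eq_bigr => l _; have lk := ltn_ord l.
  rewrite mulmxA -mulmxDl /track_impulse /track_step; congr (_ *m _).
  have [r rE] : exists r, (k - l = r.+1)%N.
    by exists (k - l).-1; rewrite prednK// subn_gt0.
  have kE : (l.+1 + r = k)%N by rewrite addSnnS -rE subnKC// ltnW.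
  have e1 : Wt k *m chain Wt l (k - l) = chain Wt l (k.+1 - l).
    by rewrite subSn 1?ltnW//= subnKC// ltnW.
  have e2 : Wt k *m chain Wt l.+1 (k - l.+1) = chain Wt l.+1 (k - l).
    by rewrite subnS rE /= kE.
  rewrite subSS mulmxBr -!scalemxAr e1 e2 subSn 1?ltnW// !subnS rE /=.
  rewrite -!natr1 !scalerDl !scale1r; set u := Wt (l + r.+1) *m _.
  by rewrite opprD addrACA.
by rewrite /track_impulse /track_step subnn scale0r subr0 subSnn scale1r /= addn0 mulmx1.
Qed.

(** Subtracting a constant [c] from all gradients only changes the transient term,
where [c] is weighted by [k]. With [c] the gradients at the minimizer the
remaining differences vanish at the optimum. *)
Lemma consensus_shifted k (c : 'M[R]_(N, d)) : (1%:M - Pi) *m X k =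
  chain Wt 0 k *m ((1%:M - Pi) *m X 0%N - (alpha * k%:R) *: c)
  - alpha *: \sum_(l < k) track_impulse k l *m (H l - c).
Proof.
rewrite consensus_expansion; under [in RHS]eq_bigr do rewrite mulmxBr.
rewrite sumrB -mulmx_suml sum_track_impulse mulmxBr -addrA; congr (_ + _).
by rewrite scalerBr opprB -!scalemxAr -scalemxAl scalerA addrA addNr add0r.
Qed.
End tracking.
End mixing.

(** * Accumulated disagreement and the weighted norm *)

Section convolution.
Context (R : realType).

Lemma sum_conv (a z : nat -> R) K :
  \sum_(k < K) \sum_(l < k) a (k - l.+1)%N * z l =
  \sum_(l < K) z l * \sum_(r < K - l.+1) a r.
Proof.
elim: K => [|K IH]; first by rewrite !big_ord0.
rewrite big_ord_recr IH /= [RHS]big_ord_recr /= subSS subnn big_ord0 mulr0 addr0.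
rewrite -big_split; apply: eq_bigr => l _ /=.
by rewrite subSS -[in RHS](subnSK (ltn_ord l)) big_ord_recr /= mulrDr [a _ * _]mulrC.
Qed.

Lemma sum_rev (a : nat -> R) k : \sum_(l < k) a (k - l.+1)%N = \sum_(r < k) a r.
Proof. by rewrite [RHS](reindex_inj rev_ord_inj). Qed.

End convolution.

Section stacking.
Context (R : realType).

Definition rows_mx N d (x : 'I_N -> 'rV[R]_d) : 'M[R]_(N, d) := \matrix_(i, j) x i 0 j.
(** [stack] for the rows of a matrix; the Kronecker product with the identity
acts on it as left multiplication of the matrix ([tens_colstack]). *)
Definition colstack N d (X : 'M[R]_(N, d)) : 'cV[R]_(N * d) :=
  \col_p X (mxtens_unindex p).1 (mxtens_unindex p).2.

Lemma stackE N d (x : 'I_N -> 'rV[R]_d) : stack x = colstack (rows_mx x).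
Proof. by apply/matrixP => p q; rewrite !mxE. Qed.

Lemma sum_mxtens N d (g : 'I_(N * d) -> R) :
  \sum_p g p = \sum_i \sum_j g (mxtens_index (i, j)).
Proof.
rewrite pair_bigA /= (reindex (@mxtens_index N d)) /=.
  by apply: eq_bigr => -[].
by exists (@mxtens_unindex N d) => p _; [exact: mxtens_indexK|exact: mxtens_unindexK].
Qed.

Lemma sqnorm_colstack N d (X : 'M[R]_(N, d)) : sqnorm (colstack X) = sqnorm X.
Proof.
rewrite /sqnorm sum_mxtens; apply: eq_bigr => i _; apply: eq_bigr => j _.
by rewrite big_ord1 mxE mxtens_indexK.
Qed.

Lemma tens_colstack N d (A : 'M[R]_N) (X : 'M[R]_(N, d)) :
  (A *t (1%:M : 'M[R]_d)) *m colstack X = colstack (A *m X).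
Proof.
apply/matrixP => p q; rewrite !mxE sum_mxtens.
case: (mxtens_indexP p) => i j; rewrite mxtens_indexK /=.
apply: eq_bigr => k _.
rewrite (bigD1 j) //= tensmxE !mxE mxtens_indexK eqxx mulr1 /= big1 ?addr0//.
by move=> l lj; rewrite tensmxE !mxE eq_sym (negbTE lj) mulr0 mul0r.
Qed.

Lemma colstack_ex N d (v : 'cV[R]_(N * d)) : exists X, v = colstack X.
Proof.
exists (\matrix_(i, j) v (mxtens_index (i, j)) 0).
by apply/matrixP => p q; rewrite !mxE ord1 -[p in LHS]mxtens_unindexK; case: mxtens_unindex.
Qed.

Lemma colstackB N d (X Y : 'M[R]_(N, d)) : colstack X - colstack Y = colstack (X - Y).
Proof. by apply/matrixP => p q; rewrite !mxE. Qed.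

Lemma xhatE N d (x : 'I_N -> 'rV[R]_d) :
  xhat x = colstack ((1%:M - Pi_mx R N) *m rows_mx x).
Proof.
by rewrite /xhat stackE mulmxBl mul1mx tens_colstack colstackB mulmxBl mul1mx.
Qed.

Lemma Psi0_colstack N d (W : nat -> 'M[R]_N) r (X : 'M[R]_(N, d)) :
  Psi0 d W r *m colstack X = colstack (chain (Wtilde W) 0 r *m X).
Proof.
elim: r => [|r IH]; first by rewrite /Psi0 /= !mul1mx.
by rewrite /Psi0 /= -mulmxA -/(Psi0 d W r) IH tens_colstack mulmxA.
Qed.

End stacking.

Section consensus_bounds.
Context (R : realType) (N : nat) (hN : (1 <= N)%N).
Context (W : nat -> 'M[R]_N) (tau : nat) (lambda : R).
Context (hW : network_assumption W tau lambda).
Local Notation Wt := (Wtilde W).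
Local Notation rho := (tau%:R / (1 - lambda)).

Let lam01 : 0 <= lambda < 1. Proof. by case: hW => _ _ _ []. Qed.
Let tau1 : (1 <= tau)%N. Proof. by case: hW => _ _ _ []. Qed.
Let a r : R := (2 * r%:R + 1) * decay lambda tau r.
Let a0 r : 0 <= a r.
Proof. by rewrite mulr_ge0 ?decay_ge0// addr_ge0// mulr_ge0. Qed.
Let rho1 : 1 <= rho. Proof. exact: rho_ge1. Qed.

(** The norms of [track_impulse W k l] have sum at most [5 * rho ^ 2]; this is the bound
for inputs with arbitrary correlations. *)
Lemma sum_track_impulse_le K d (Z : nat -> 'M[R]_(N, d)) :
  \sum_(k < K) sqnorm (\sum_(l < k) track_impulse W k l *m Z l) <=
  25 * rho ^+ 4 * \sum_(l < K) sqnorm (Z l).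
Proof.
have S0 n : \sum_(r < n) a r <= 5 * rho ^+ 2 by exact: sum_decay_lin.
have Sg n : 0 <= \sum_(r < n) a r by exact: sumr_ge0.
have r0 : 0 <= 5 * rho ^+ 2 by rewrite mulr_ge0 ?sqr_ge0.
apply: (@le_trans _ _ (\sum_(k < K) 5 * rho ^+ 2 * \sum_(l < k) a (k - l.+1)%N * sqnorm (Z l))).
  apply: ler_sum => k _.
  apply: le_trans (sqnorm_weighted_sum (Z := fun l : 'I_k => Z l)
    (a := fun l : 'I_k => a (k - l.+1)%N) _ _) _ => //.
  - by move=> l; exact: enorm_track_impulse.
  rewrite (sum_rev a) ler_wpM2r//; apply: sumr_ge0 => l _.
  by rewrite mulr_ge0 ?sqnorm_ge0.
rewrite -mulr_sumr (sum_conv a (fun l => sqnorm (Z l))).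
have -> : 25 * rho ^+ 4 * \sum_(l < K) sqnorm (Z l) =
   5 * rho ^+ 2 * \sum_(l < K) sqnorm (Z l) * (5 * rho ^+ 2).
  by rewrite -!mulr_suml; ring.
by apply: ler_wpM2l => //; apply: ler_sum => l _; rewrite ler_wpM2l ?sqnorm_ge0.
Qed.

(** The bound for orthogonal inputs: only the sum of squares of the norms of
[track_impulse W k l] enters, and it is of order [rho ^ 3] instead of [rho ^ 4]. *)
Lemma sum_track_impulse_sqr_le k (z : nat -> R) (c : R) :
  (forall l, z l <= c) -> 0 <= c ->
  \sum_(l < k) a (k - l.+1)%N ^+ 2 * z l <= 33 * rho ^+ 3 * c.
Proof.
move=> zc c0; apply: (@le_trans _ _ (\sum_(l < k) a (k - l.+1)%N ^+ 2 * c)).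
  by apply: ler_sum => l _; rewrite ler_wpM2l ?sqr_ge0.
rewrite -mulr_suml ler_wpM2r// (sum_rev (fun r => a r ^+ 2)).
exact: sum_decay_quad.
Qed.

(** The weight [k ^ 2] of the squared norm of [Psi(k,0) c] costs only a factor
[rho ^ 2], by [decay_sum2]. *)
Lemma sum_initial_le K d (Y c : 'M[R]_(N, d)) (alpha : R) :
  \sum_(k < K) sqnorm (chain Wt 0 k *m (Y - (alpha * k%:R) *: c)) <=
  2 * (\sum_(k < K) sqnorm (chain Wt 0 k *m Y)) +
  12 * alpha ^+ 2 * rho ^+ 2 * (\sum_(k < K) sqnorm (chain Wt 0 k *m c)).
Proof.
pose b k := sqnorm (chain Wt 0 k *m c).
have b0 k : 0 <= b k by exact: sqnorm_ge0.
have bm k : b (k + tau)%N <= lambda * b k.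
  rewrite /b chainD -mulmxA.
  have := enorm_chain hN hW (0 + k) tau (chain Wt 0 k *m c).
  rewrite enorm_le ?decay_ge0// => /le_trans; apply.
  rewrite ler_wpM2r ?sqnorm_ge0// /decay divnn tau1 expr1 expr2 ler_piMl//.
    by case/andP: lam01.
  by case/andP: lam01 => _ /ltW.
have := decay_sum2 lam01 K b0 bm => H2.
apply: (@le_trans _ _ (\sum_(k < K) (2 * sqnorm (chain Wt 0 k *m Y) +
    2 * alpha ^+ 2 * (k%:R ^+ 2 * b k)))).
  apply: ler_sum => k _; rewrite mulmxBr (le_trans (sqnormD_le _ _))// lerD2l.
  by rewrite sqnormN -scalemxAr sqnormZ exprMn /b !mulrA.
rewrite big_split /= -!mulr_sumr lerD2l.
rewrite [leRHS](_ : _ = 2 * alpha ^+ 2 * (6 * rho ^+ 2 * \sum_(k < K) b k)); last by rewrite /b; ring.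
by rewrite ler_wpM2l// mulr_ge0 ?sqr_ge0.
Qed.

(** The quadratic form of [R0] is [delta] times the sum of the series of the squared
norms of [Psi(r,0) X]. As [R0] is defined by entrywise limits, convergence of
each entry is needed to identify the form with a limit of partial sums. *)
Lemma R0_ge K d (X : 'M[R]_(N, d)) :
  delta tau lambda * \sum_(r < K) sqnorm (chain Wt 0 r *m X) <=
  wsqnorm (R0 d W tau lambda) (colstack X).
Proof.
set q := colstack X.
pose u p p' r : R := ((Psi0 d W r)^T *m Psi0 d W r) p p'.
have bound (v : 'cV[R]_(N * d)) r : sqnorm (Psi0 d W r *m v) <= decay lambda tau r * sqnorm v.
  have [Y ->] := colstack_ex v; rewrite Psi0_colstack !sqnorm_colstack.
  have := enorm_chain hN hW 0 r Y.
  rewrite enorm_le ?decay_ge0// => /le_trans; apply.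
  by rewrite ler_wpM2r ?sqnorm_ge0// expr2 ler_piMl ?decay_ge0// decay_le1.
have sq r (v : 'cV[R]_(N * d)) : sqnorm (Psi0 d W r *m v) =
    \sum_p \sum_p' v p 0 * u p p' r * v p' 0.
  have -> : sqnorm (Psi0 d W r *m v) = ((Psi0 d W r *m v)^T *m (Psi0 d W r *m v)) 0 0.
    by rewrite mxE; apply: eq_bigr => i _; rewrite big_ord1 [in RHS]mxE expr2.
  have -> : (Psi0 d W r *m v)^T *m (Psi0 d W r *m v) =
      v^T *m ((Psi0 d W r)^T *m Psi0 d W r) *m v by rewrite trmx_mul !mulmxA.
  rewrite mxE exchange_big /=.
  apply: eq_bigr => p' _; rewrite mxE mulr_suml.
  by apply: eq_bigr => p _; rewrite [v^T _ _]mxE.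
have uE p p' r : u p p' r =
    mxdot (Psi0 d W r *m delta_mx p 0) (Psi0 d W r *m (delta_mx p' 0 : 'cV_(N * d))).
  rewrite /u mxE; apply: eq_bigr => i _.
  by rewrite big_ord1 -!colE !mxE.
have sqd p : sqnorm (delta_mx p 0 : 'cV[R]_(N * d)) = 1.
  rewrite /sqnorm (bigD1 p)//= big_ord1 mxE !eqxx expr1n big1 ?addr0// => i ip.
  by rewrite big_ord1 mxE (negbTE ip) expr0n.
have ub p p' r : `|u p p' r| <= decay lambda tau r.
  rewrite uE -ler_sqr ?nnegrE ?decay_ge0// real_normK ?num_real//.
  apply: le_trans (mxdot_cs _ _) _; rewrite expr2.
  apply: ler_pM; rewrite ?sqnorm_ge0//;
    by rewrite (le_trans (bound _ _))// sqd mulr1.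
have cu p p' : cvgn (series (u p p')).
  apply: normed_cvg; apply: (@series_le_cvg _ _ (decay lambda tau)).
  - by move=> n; exact: normr_ge0.
  - by move=> n; exact: decay_ge0.
  - by move=> n; exact: ub.
  - apply: nondecreasing_is_cvgn.
      by apply/nondecreasing_series => n _ _; exact: decay_ge0.
    exists rho => _ [n _ <-]; rewrite /series /= big_mkord.
    apply: decay_sum0 => //; first by move=> r; exact: decay_ge0.
      by move=> r; rewrite decayD.
    by move=> r _; exact: decay_le1.
rewrite /wsqnorm.
have -> : (q^T *m R0 d W tau lambda *m q) 0 0 =
   delta tau lambda * \sum_p \sum_p' q p 0 * limn (series (u p p')) * q p' 0.
  rewrite /R0 -scalemxAr -scalemxAl mxE; congr (_ * _); rewrite mxE exchange_big /=.
  apply: eq_bigr => p' _; rewrite mxE mulr_suml.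
  by apply: eq_bigr => p _; rewrite !mxE.
have d0 : 0 <= delta tau lambda.
  rewrite divr_ge0// subr_ge0; case/andP: lam01 => ? ?; rewrite expr_le1// ltW//.
apply: ler_wpM2l => //.
pose v n := \sum_p \sum_p' q p 0 * series (u p p') n * q p' 0.
have vE n : v n = \sum_(r < n) sqnorm (chain Wt 0 r *m X).
  rewrite /v; under [RHS]eq_bigr => r _ do
    rewrite -sqnorm_colstack -Psi0_colstack -/q sq.
  rewrite [RHS]exchange_big; apply: eq_bigr => p _.
  rewrite [RHS]exchange_big; apply: eq_bigr => p' _.
  by rewrite /series /= big_mkord mulr_sumr mulr_suml.
have cv : v @ \oo --> \sum_p \sum_p' q p 0 * limn (series (u p p')) * q p' 0.
  apply: cvg_big => [|p _]; first exact: add_continuous.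
  apply: cvg_big => [|p' _]; first exact: add_continuous.
  by apply: cvgMr_tmp; apply: cvgMl_tmp; exact: cu.
rewrite -vE -(cvg_lim _ cv)//; apply: nondecreasing_cvgn_le.
  apply/nondecreasing_seqP => n; rewrite !vE big_ord_recr /= lerDl; exact: sqnorm_ge0.
by apply/cvg_ex; eexists; exact: cv.
Qed.

End consensus_bounds.

(** * Smooth convex functions *)

Section smooth.
Context (R : realType) (d : nat).
Implicit Types (x y v : 'rV[R]_d).

Lemma derive_grad (f : 'rV[R]_d -> R) x v :
  differentiable f x -> 'D_v f x = mxdot (grad f x) v.
Proof.
move=> df; rewrite deriveE// /mxdot big_ord1.
rewrite [v in LHS]row_sum_delta linear_sum; apply: eq_bigr => j _.
by rewrite linearZ /= mxE deriveE// mulrC.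
Qed.

Lemma is_derive_line (f : 'rV[R]_d -> R) x v (t : R) :
  (forall z, differentiable f z) ->
  is_derive t 1 (fun t : R => f (x + t *: v)) (mxdot (grad f (x + t *: v)) v).
Proof.
move=> df.
have E : (fun h : R => h^-1 *: (((fun t => f (x + t *: v)) \o shift t) (h *: 1) -
   f (x + t *: v))) =
   (fun h => h^-1 *: ((f \o shift (x + t *: v)) (h *: v) - f (x + t *: v))).
  apply/funext => h /=; congr (_ *: (f _ - _)).
  by rewrite scaler1 scalerDl addrCA.
split.
  by rewrite /derivable E; exact: (diff_derivable (df _)).
by rewrite /derive E -derive_grad.
Qed.

Context (f : 'rV[R]_d -> R) (L : R).
Context (df : forall z, differentiable f z) (L0 : 0 < L).
Context (cf : @convex_function R 'rV[R]_d setT f).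
Context (Lf : forall x y, enorm (grad f x - grad f y) <= L * enorm (x - y)).

Lemma grad_lip_dot x v t : 0 <= t ->
  `|mxdot (grad f (x + t *: v) - grad f x) v| <= L * t * sqnorm v.
Proof.
move=> t0; have h : mxdot (grad f (x + t *: v) - grad f x) v ^+ 2 <= (L * t * sqnorm v) ^+ 2.
  apply: le_trans (mxdot_cs _ _) _.
  rewrite [leRHS]exprMn [X in _ <= _ * X]expr2 mulrA ler_wpM2r ?sqnorm_ge0//.
  have := Lf (x + t *: v) x; rewrite (enorm_le _ _ (ltW L0)) => /le_trans; apply.
  by rewrite addrAC subrr add0r sqnormZ exprMn mulrA.
rewrite -ler_sqr ?nnegrE ?real_normK ?num_real//.
by rewrite !mulr_ge0 ?sqnorm_ge0// ltW.
Qed.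

Lemma line_mvt x v t : 0 < t -> exists2 c, 0 < c < t &
  f (x + t *: v) - f x = t * mxdot (grad f (x + c *: v)) v.
Proof.
move=> t0.
have cont : {within `[0, t], continuous (fun t : R => f (x + t *: v))}.
  apply: continuous_subspaceT => c; apply: differentiable_continuous.
  by have [/derivable1_diffP] := is_derive_line x v c df.
have [c] := MVT t0 (fun c _ => is_derive_line x v c df) cont.
rewrite in_itv /= => ct; rewrite scale0r addr0 subr0 mulrC => E.
by exists c.
Qed.

(** A single use of the mean value theorem gives the constant [L]; the sharp
[L / 2] would only improve numerical constants. *)
Lemma descent_lemma x y :
  f y <= f x + mxdot (grad f x) (y - x) + L * sqnorm (y - x).
Proof.
set v := y - x.
have [c /andP[c0 c1]] := line_mvt x v ltr01.
have xv : x + v = y by rewrite /v addrC subrK.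
rewrite scale1r xv mul1r => E.
have := grad_lip_dot x v (ltW c0); rewrite mxdotBl ler_norml => /andP[_ H].
have : L * c * sqnorm v <= L * sqnorm v.
  by rewrite ler_wpM2r ?sqnorm_ge0// ler_piMr ?ltW.
lra.
Qed.

(** Convexity bounds the slope on [[0, t]] by the slope on [[0, 1]]; the Lipschitz
bound on the gradient replaces the derivative at [0] by that slope up to
[O(t)], and [t] is arbitrarily small. *)
Lemma convex_gradient x y : f x + mxdot (grad f x) (y - x) <= f y.
Proof.
set v := y - x.
have key t : 0 < t -> t < 1 -> f x + mxdot (grad f x) v - L * t * sqnorm v <= f y.
  move=> t0 t1.
  have [c /andP[c0 ct]] := line_mvt x v t0 => E.
  have := grad_lip_dot x v (ltW c0); rewrite mxdotBl ler_norml => /andP[H _].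
  have Lct : L * c * sqnorm v <= L * t * sqnorm v.
    by rewrite ler_wpM2r ?sqnorm_ge0// ler_wpM2l ?ltW.
  have H1 : f (x + t *: v) <= t * f y + (1 - t) * f x.
    have := cf (Itv01 (ltW t0) (ltW t1)) (in_setT y) (in_setT x).
    rewrite /conv /=.
    have -> : x + t *: v = t *: y + (1 - t) *: x; last by [].
    by rewrite /v scalerBr scalerBl scale1r addrCA.
  have H2 : t * (mxdot (grad f x) v - L * t * sqnorm v) <= t * (f y - f x).
    apply: (@le_trans _ _ (t * mxdot (grad f (x + c *: v)) v)).
      by rewrite ler_wpM2l ?(ltW t0)//; lra.
    by rewrite -E; lra.
  by rewrite ler_pM2l// in H2; lra.
apply/ler_addgt0Pr => e e0.
pose t := Num.min (1 / 2) (e / (L * sqnorm v + 1)).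
have s0 : 0 < L * sqnorm v + 1 by rewrite ltr_wpDl// mulr_ge0 ?sqnorm_ge0// ltW.
have t0 : 0 < t by rewrite /t lt_min divr_gt0//= divr_gt0.
have t1 : t < 1 by rewrite /t gt_min; apply/orP; left; lra.
have := key t t0 t1.
have : t * (L * sqnorm v + 1) <= e by rewrite -ler_pdivlMr// ge_min lexx orbT.
lra.
Qed.

(** A gradient step from [y] on [f - <grad f x, .>], which is minimal at [x],
decreases it by a multiple of the squared norm of its gradient. *)
Lemma bregman_grad x y :
  sqnorm (grad f y - grad f x) <= 4 * L * (f y - f x - mxdot (grad f x) (y - x)).
Proof.
set D := grad f y - grad f x.
set s := (2 * L)^-1.
have h1 := descent_lemma y (y - s *: D).
have h2 := convex_gradient x (y - s *: D).
have e1 : y - s *: D - y = - s *: D by rewrite addrAC subrr add0r scaleNr.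
have e2 : y - s *: D - x = (y - x) - s *: D by rewrite addrAC.
rewrite e1 sqnormZ mxdotZr in h1.
rewrite e2 mxdotBr mxdotZr in h2.
have e3 : sqnorm D = mxdot (grad f y) D - mxdot (grad f x) D by rewrite sqnormE -mxdotBl.
have Ls : L * s = 1 / 2 by rewrite /s; field; rewrite ?lt0r_neq0.
have s0 : 0 < s by rewrite /s invr_gt0 mulr_gt0.
have : s * sqnorm D <= 2 * (f y - f x - mxdot (grad f x) (y - x)).
  have e4 : L * ((- s) ^+ 2 * sqnorm D) = 1 / 2 * (s * sqnorm D).
    by rewrite -Ls; ring.
  have e5 : s * sqnorm D = s * mxdot (grad f y) D - s * mxdot (grad f x) D.
    by rewrite e3 mulrBr.
  rewrite e4 mulNr in h1; lra.
rewrite -(ler_pM2l (_ : 0 < 2 * L)) ?mulr_gt0// => h.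
have : 2 * L * (s * sqnorm D) = sqnorm D.
  by rewrite mulrA /s mulfV ?mul1r// mulf_neq0// lt0r_neq0.
lra.
Qed.
End smooth.

(** * Finite sums of smooth convex functions *)

Section family.
Context (R : realType) (N d : nat) (hN : (1 <= N)%N).
Context (f : 'I_N -> 'rV[R]_d -> R) (L : R) (xstar : 'rV[R]_d) (hL : 0 < L).
Context (hf : function_assumption f L xstar).

Let n0 : (0 : R) < N%:R. Proof. by rewrite ltr0n. Qed.
Let ni0 : (0 : R) < N%:R^-1. Proof. by rewrite invr_gt0. Qed.

Definition gap x := avg_fun f x - avg_fun f xstar.

Lemma gap_ge0 x : 0 <= gap x.
Proof. by rewrite subr_ge0; case: hf. Qed.

Lemma sqnorm_avg (g : 'I_N -> 'rV[R]_d) :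
  sqnorm (avg g) <= N%:R^-1 * \sum_i sqnorm (g i).
Proof.
rewrite /avg sqnormZ expr2 -mulrA ler_wpM2l ?(ltW ni0)//.
rewrite ler_pdivrMl//.
rewrite /sqnorm big_ord1.
under [X in _ <= _ * X]eq_bigr do rewrite big_ord1.
rewrite exchange_big /= mulr_sumr; apply: ler_sum => j _.
have := cauchy_schwarz (fun=> 1) (fun i => g i 0 j).
under [X in X ^+ 2 <= _ -> _]eq_bigr do rewrite mul1r.
under [X in _ <= X * _ -> _]eq_bigr do rewrite expr1n.
by rewrite sumr_const card_ord summxE.
Qed.

Lemma mxdot_avg (g : 'I_N -> 'rV[R]_d) v :
  mxdot (avg g) v = N%:R^-1 * \sum_i mxdot (g i) v.
Proof. by rewrite /avg mxdotZl mxdot_suml. Qed.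

Lemma gap_le_quad x : gap x <=
  L * sqnorm (x - xstar) + mxdot (avg (fun i => grad (f i) xstar)) (x - xstar).
Proof.
case: hf => df cf lf _.
rewrite /gap /avg_fun -mulrBr mxdot_avg.
have -> : L * sqnorm (x - xstar) = N%:R^-1 * \sum_(i < N) L * sqnorm (x - xstar).
  by rewrite sumr_const card_ord -[X in _ = _ * X]mulr_natl mulrA mulVf ?mul1r// lt0r_neq0.
rewrite -mulrDr ler_wpM2l ?(ltW ni0)// -sumrB -big_split/=.
apply: ler_sum => i _.
have := descent_lemma (df i) hL (lf i) xstar x; lra.
Qed.

(** Otherwise a short step along the mean gradient would decrease the objective. *)
Lemma avg_grad_xstar : avg (fun i => grad (f i) xstar) = 0.
Proof.
set g := avg _; apply: sqnorm_eq0.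
have s0 : 0 < (2 * L)^-1 by rewrite invr_gt0 mulr_gt0.
have := le_trans (gap_ge0 _) (gap_le_quad (xstar - (2 * L)^-1 *: g)).
rewrite -/g addrAC subrr add0r sqnormN sqnormZ mxdotC mxdotNl mxdotZl -sqnormE.
have -> : L * ((2 * L)^-1 ^+ 2 * sqnorm g) = (2 * L)^-1 * (2^-1 * sqnorm g).
  by field; rewrite lt0r_neq0.
rewrite -mulrBr pmulr_rge0// => H; have := sqnorm_ge0 g; lra.
Qed.

Lemma gap_le x : gap x <= L * sqnorm (x - xstar).
Proof.
have := gap_le_quad x; rewrite avg_grad_xstar.
by rewrite mxdot0l addr0.
Qed.

(** The linear terms of the Bregman distances cancel, as the gradients at the
minimizer sum to zero. *)
Lemma sum_grad_gap x :
  \sum_i sqnorm (grad (f i) x - grad (f i) xstar) <= 4 * L * N%:R * gap x.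
Proof.
case: (hf) => df cf lf _.
apply: (@le_trans _ _ (\sum_i 4 * L * (f i x - f i xstar - mxdot (grad (f i) xstar) (x - xstar)))).
  by apply: ler_sum => i _; exact: bregman_grad.
rewrite -mulr_sumr -[leRHS]mulrA ler_wpM2l ?mulr_ge0 ?(ltW hL)//.
rewrite sumrB -mxdot_suml.
have -> : \sum_i grad (f i) xstar = N%:R *: avg (fun i => grad (f i) xstar).
  by rewrite scalerA mulfV ?scale1r// lt0r_neq0.
rewrite avg_grad_xstar scaler0 mxdot0l subr0 sumrB.
by rewrite /gap /avg_fun -mulrBr mulrA mulfV ?mul1r// lt0r_neq0.
Qed.

Lemma sum_grad_lip (x : 'I_N -> 'rV[R]_d) z :
  \sum_i sqnorm (grad (f i) (x i) - grad (f i) z) <=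
    L ^+ 2 * \sum_i sqnorm (x i - z).
Proof.
case: hf => _ _ lf _; rewrite mulr_sumr; apply: ler_sum => i _.
by have := lf i (x i) z; rewrite (enorm_le _ _ (ltW hL)).
Qed.

(** [sqnorm (xhat x)] divided by [N], without the stacking ([spreadE]). *)
Definition spread (x : 'I_N -> 'rV[R]_d) : R :=
  N%:R^-1 * \sum_i sqnorm (x i - avg x).

(** One step of gradient descent on the mean, with gradients taken at the
individual points. Convexity at the points and smoothness between the points
and their mean bound the inner product from below by the gap minus the spread. *)
Lemma descent_step (x : 'I_N -> 'rV[R]_d) (alpha : R) :
  0 < alpha -> alpha * L <= 1 / 8 ->
  sqnorm (avg x - xstar - alpha *: avg (fun i => grad (f i) (x i))) <=
  sqnorm (avg x - xstar) - alpha * gap (avg x) + 3 * alpha * L * spread x.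
Proof.
move=> a0 aL; set V := spread x; case: (hf) => df cf lf _.
set z := avg x; set g := avg _; set F := gap z.
have V0 : 0 <= V by rewrite mulr_ge0 ?(ltW ni0)// sumr_ge0// => i _; exact: sqnorm_ge0.
have F0 : 0 <= F by exact: gap_ge0.
rewrite (sqnormB (z - xstar)) mxdotZr sqnormZ.
have dotg : F - L * V <= mxdot (z - xstar) g.
  rewrite mxdotC mxdot_avg /F /gap /avg_fun -mulrBr -sumrB /V /spread mulrCA -mulrBr.
  rewrite ler_wpM2l ?(ltW ni0)// mulr_sumr -sumrB; apply: ler_sum => i _.
  have h1 := convex_gradient (df i) hL (cf i) (lf i) (x i) xstar.
  have h2 := descent_lemma (df i) hL (lf i) (x i) z.
  have -> : z - xstar = (z - x i) - (xstar - x i) by rewrite opprB addrA subrK.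
  by rewrite mxdotBr -[x i - z]opprB sqnormN; lra.
have gle : sqnorm g <= 2 * L ^+ 2 * V + 8 * L * F.
  have -> : g = avg (fun i => grad (f i) (x i) - grad (f i) z)
     + avg (fun i => grad (f i) z - grad (f i) xstar).
    rewrite -[LHS]subr0 -avg_grad_xstar /g /avg -scalerBr -scalerDr -sumrB -big_split /=.
    by congr (_ *: _); apply: eq_bigr => i _; rewrite addrA subrK.
  rewrite (le_trans (sqnormD_le _ _))//.
  apply: lerD.
    rewrite -mulrA ler_wpM2l// (le_trans (sqnorm_avg _))// /V /spread mulrCA.
    by rewrite ler_wpM2l ?(ltW ni0)// sum_grad_lip.
  rewrite [leRHS](_ : _ = 2 * (4 * L * F)); last by ring.
  rewrite ler_wpM2l// (le_trans (sqnorm_avg _))// ler_pdivrMl//.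
  by rewrite mulrC -[leRHS]mulrAC sum_grad_gap.
have a2g : alpha ^+ 2 * sqnorm g <= alpha * (1 / 4 * L * V) + alpha * F.
  apply: (@le_trans _ _ (alpha ^+ 2 * (2 * L ^+ 2 * V + 8 * L * F))).
    by rewrite ler_wpM2l ?sqr_ge0.
  rewrite expr2 -mulrA -mulrDr ler_wpM2l ?(ltW a0)//.
  have e1 : alpha * L * (2 * L * V) <= 1 / 8 * (2 * L * V).
    rewrite ler_wpM2r//; apply: mulr_ge0 => //.
    by apply: mulr_ge0 => //; exact: ltW.
  have e2 : alpha * L * (8 * F) <= 1 / 8 * (8 * F).
    by rewrite ler_wpM2r// mulr_ge0.
  have -> : alpha * (2 * L ^+ 2 * V + 8 * L * F) = alpha * L * (2 * L * V) + alpha * L * (8 * F) by ring.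
  lra.
have : alpha * (F - L * V) <= alpha * mxdot (z - xstar) g by rewrite ler_wpM2l ?(ltW a0).
have : 0 <= alpha * (L * V) by apply: mulr_ge0; [exact: ltW|apply: mulr_ge0 => //; exact: ltW].
lra.
Qed.

End family.

(** * Measurability and integrals by discretization *)

Section countable_partition.
Context d (T : measurableType d) (R : realType).

Let fiberE (I : countType) (q : T -> I) n :
  [set w | pickle (q w) = n] =
  if unpickle n is Some i then
    if pickle (i : I) == n then q @^-1` [set i] else set0 else set0.
Proof.
apply/seteqP; split => w /=.
  by move=> <-; rewrite pickleK eqxx.
case E : (unpickle n) => [i|//].
by case: eqP => // <- /= ->.
Qed.

Let fiber_bigcup (I : countType) (q : T -> I) :
  \bigcup_n [set w | pickle (q w) = n] = setT.
Proof. by apply/seteqP; split => // w _; exists (pickle (q w)). Qed.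

(** Being countable, the family of the fibers can be numbered by [pickle], which
reduces the statement to sequences of sets. *)
Lemma measurable_fun_fibers d' (T' : measurableType d') (I : countType)
    (q : T -> I) (f : T -> T') :
  (forall i, measurable (q @^-1` [set i])) ->
  (forall i, measurable_fun (q @^-1` [set i]) f) -> measurable_fun setT f.
Proof.
move=> mq mf; rewrite -(fiber_bigcup q); apply/measurable_fun_bigcup => n;
  rewrite fiberE.
  by case: (unpickle n) => [i|//]; case: ifP.
by case: (unpickle n) => [i|]; [case: ifP => _ // |]; exact: measurable_fun_set0.
Qed.

Lemma integral_fibers_eq0 (P : {measure set T -> \bar R}) (I : countType)
    (q : T -> I) (f : T -> \bar R) :
  (forall i, measurable (q @^-1` [set i])) -> P.-integrable setT f ->
  (forall i, (\int[P]_(x in q @^-1` [set i]) f x = 0)%E) ->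
  (\int[P]_x f x = 0)%E.
Proof.
move=> mq intf f0; rewrite -(fiber_bigcup q) integral_bigcup.
- apply: eseries0 => n _ _; rewrite fiberE.
  by case: (unpickle n) => [i|]; [case: ifP => _ //|]; rewrite integral_set0.
- by move=> m n _ _ [w [/= <- <-]].
- move=> n; rewrite fiberE.
  by case: (unpickle n) => [i|//]; case: ifP.
- by rewrite fiber_bigcup.
Qed.

Lemma measurable_floor_fiber (Z : T -> R) (m : int) :
  measurable_fun setT Z -> measurable ((fun w => Num.floor (Z w)) @^-1` [set m]).
Proof.
move=> mZ.
have -> : (fun w => Num.floor (Z w)) @^-1` [set m] =
    Z @^-1` [set` `[(m%:~R : R), (m + 1)%:~R[].
  apply/seteqP; split => w /=.
    by move=> <-; rewrite in_itv/= floor_le floorD1_gt.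
  by rewrite in_itv /= => H; exact: floor_def.
by rewrite -[X in measurable X]setTI; exact: mZ.
Qed.
End countable_partition.

(** [x] is approximated by functions with countably many values, obtained by taking
integer parts; on each fiber of such a function the composition is some [G v],
and continuity lets one pass to the limit. *)
Lemma caratheodory_measurable d (T : measurableType d) (R : realType) (n : nat)
    (x : T -> 'rV[R]_n) (G : 'rV[R]_n -> T -> R) :
  (forall j, measurable_fun setT (fun w => x w 0 j)) ->
  (forall v, measurable_fun setT (G v)) ->
  (forall w, continuous (G ^~ w)) ->
  measurable_fun setT (fun w => G (x w) w).
Proof.
move=> mx mG cG.
(* Rounding of [x w] to the grid of mesh [1 / (k + 1)]. *)
pose q (k : nat) w : 'rV[int]_n := \row_j Num.floor (k.+1%:R * x w 0 j).
pose xk (k : nat) w : 'rV[R]_n := \row_j ((q k w 0 j)%:~R / k.+1%:R).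
have mq k v : measurable (q k @^-1` [set v]).
  have -> : q k @^-1` [set v] = \bigcap_(j in [set: 'I_n])
      ((fun w => Num.floor (k.+1%:R * x w 0 j)) @^-1` [set v 0 j]).
    apply/seteqP; split => w /=.
      by move=> <- j _ /=; rewrite mxE.
    by move=> H; apply/rowP => j; rewrite mxE; exact: H.
  apply: fin_bigcap_measurable => // j _.
  apply: measurable_floor_fiber; exact: measurable_funM.
apply: (@measurable_fun_cvg _ _ _ _ (fun k w => G (xk k w) w)).
  move=> k; apply: (measurable_fun_fibers (mq k)) => v.
  apply: (@eq_measurable_fun _ _ _ _ _ (G (\row_j ((v 0 j)%:~R / k.+1%:R)))).
    by move=> w; rewrite inE /= => <-.
  exact: measurable_funS (mG _).
move=> w _.
apply: (cvg_comp (xk ^~ w) (G ^~ w) _ (cG w (x w))).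
apply/cvgrPdist_le => e e0.
near=> k; rewrite /Num.norm /= mx_normrE; apply: bigmax_le; first exact: ltW.
move=> [i j] _ /=; rewrite !ord1 !mxE.
have k0 : (0 : R) < k.+1%:R by [].
have -> : x w 0 j - (Num.floor (k.+1%:R * x w 0 j))%:~R / k.+1%:R =
  (k.+1%:R * x w 0 j - (Num.floor (k.+1%:R * x w 0 j))%:~R) / k.+1%:R.
  by rewrite mulrBl mulrAC divff ?mul1r// lt0r_neq0.
set t := k.+1%:R * x w 0 j.
have t1 := floor_le t; have t2 := floorD1_gt t.
rewrite intrD in t2.
rewrite ger0_norm; last by rewrite divr_ge0// ?subr_ge0// ltW.
apply: (@le_trans _ _ (k.+1%:R^-1)).
  by rewrite -[leRHS]mul1r ler_pM2r ?invr_gt0//; lra.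
apply: ltW; near: k; exact: (near_infty_natSinv_lt (PosNum e0)).
Unshelve. all: by end_near.
Qed.

(** The sets over which the integral vanishes form a Dynkin system. *)
Lemma integral_eq0_dynkin d (T : measurableType d) (R : realType)
    (P : {measure set T -> \bar R}) (I : set (set T)) (f : T -> \bar R) :
  setI_closed I -> I `<=` measurable -> I setT ->
  P.-integrable setT f ->
  (forall U, I U -> (\int[P]_(x in U) f x = 0)%E) ->
  forall U, <<s I >> U -> (\int[P]_(x in U) f x = 0)%E.
Proof.
move=> II Im IT intf f0 U.
rewrite -setI_closed_g_dynkin_g_sigma_algebra//.
suff /(_ U) H : <<d I >> `<=`
    [set V | measurable V /\ (\int[P]_(x in V) f x = 0)%E] by move=> /H[].
apply: smallest_sub; last by move=> V IV; split; [exact: Im|exact: f0].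
split.
- by split=> //; exact: f0.
- move=> V [mV V0]; split; first exact: measurableC.
  have := f0 _ IT; rewrite -(setUv V) integral_setU//.
  + by rewrite V0 add0e.
  + exact: measurableC.
  + by apply/measurable_funTS; exact: (measurable_int P).
  + exact/disj_setPCl.
- move=> F tF HF; split; first by apply: bigcup_measurable => k _; case: (HF k).
  rewrite integral_bigcup//.
  + by apply: eseries0 => k _ _; case: (HF k).
  + by move=> k; case: (HF k).
  + apply: (integrableS _ _ _ intf) => //.
    by apply: bigcup_measurable => k _; case: (HF k).
Qed.

Lemma measurable_wrt_preimage (T : Type) (F : set (set T)) d
   (X : measurableType d) (Y : T -> X) : 
  measurable_wrt F Y -> forall B, measurable B -> F (Y @^-1` B).
Proof. by move=> H B mB; apply: H; exists B => //; rewrite setTI. Qed.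

(** Rounding [Z] to multiples of [c] makes it constant on countably many sets of
[F], over each of which the integral of [X] vanishes; the rounding error costs
at most [c] times the integral of [|X|]. *)
Lemma integral_mul_eq0 d (T : measurableType d) (R : realType)
    (P : probability T R) (F : set (set T)) (X Z : T -> R) :
  F `<=` measurable -> P.-integrable setT (EFin \o X) ->
  (forall A, F A -> (\int[P]_(w in A) (X w)%:E = 0)%E) ->
  measurable_wrt F Z ->
  P.-integrable setT (EFin \o (fun w => Z w * X w)) ->
  \int[P]_w (Z w * X w) = 0.
Proof.
move=> Fm iX X0 FZ iZX.
have mZ : measurable_fun setT Z.
  by move=> _ B mB; apply: Fm; apply: FZ; exists B.
have mX : measurable_fun setT X by apply/measurable_EFinP; exact: (measurable_int P iX).
apply/eqP; rewrite -normr_le0; apply/ler_addgt0Pr => e e0; rewrite add0r.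
set M := \int[P]_w `|X w|.
have M0 : 0 <= M by apply: Rintegral_ge0.
have M1 : 0 < M + 1 by rewrite ltr_wpDl.
pose c := e / (M + 1).
have c0 : 0 < c by rewrite divr_gt0.
pose q w := Num.floor (Z w / c).
have mq m : measurable (q @^-1` [set m]).
  apply: measurable_floor_fiber; exact: measurable_funM.
have Fq m : F (q @^-1` [set m]).
  have -> : q @^-1` [set m] = Z @^-1` [set` `[(m%:~R * c : R), (m + 1)%:~R * c[].
    apply/seteqP; split => w /=; rewrite /q in_itv/= -ler_pdivlMr// -ltr_pdivrMr//.
      by move=> <-; rewrite floor_le floorD1_gt.
    by move=> H; exact: floor_def.
  exact: measurable_wrt_preimage.
pose Zc w := (q w)%:~R * c.
have mZc : measurable_fun setT Zc.
  apply: (measurable_fun_fibers mq) => m.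
  apply: (@eq_measurable_fun _ _ _ _ _ (cst (m%:~R * c))) => //.
  by move=> w; rewrite inE /= /Zc => ->.
have Zle w : `|Z w - Zc w| <= c.
  have t1 := floor_le (Z w / c); have t2 := floorD1_gt (Z w / c).
  rewrite intrD ler_pdivlMr// in t1 t2 *.
  rewrite ltr_pdivrMr// in t2.
  rewrite ler_norml; apply/andP; split; rewrite /Zc /q.
    by apply: (@le_trans _ _ 0); [rewrite oppr_le0 ltW|rewrite subr_ge0].
  by rewrite lerBlDr; apply: ltW; rewrite mulrDl mul1r addrC in t2.
have iD : P.-integrable setT (EFin \o (fun w => (Z w - Zc w) * X w)).
  apply: (@le_integrable _ _ _ P _ measurableT _ (EFin \o (fun w => c * X w))).
  - apply/measurable_EFinP; apply: measurable_funM => //.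
    exact: measurable_funB.
  - move=> w _ /=; rewrite lee_fin !normrM ler_wpM2r// (le_trans (Zle w))//.
    by rewrite -normrM ler_norm.
  - have := integrableZl measurableT c iX; exact: eq_integrable.
have iZcX : P.-integrable setT (EFin \o (fun w => Zc w * X w)).
  have := integrableB measurableT iZX iD; apply: eq_integrable => // w _ /=.
  by congr EFin; ring.
have ZcX0 : \int[P]_w (Zc w * X w) = 0.
  rewrite /Rintegral (integral_fibers_eq0 mq iZcX)// => m.
  rewrite (eq_integral (fun w => ((m%:~R * c)%:E * (X w)%:E)%E)).
    rewrite integralZl//; last exact: integrableS iX.
    by rewrite X0// mule0.
  by move=> w; rewrite inE /= /Zc => ->; rewrite EFinM.
have -> : \int[P]_w (Z w * X w) = \int[P]_w ((Z w - Zc w) * X w).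
  rewrite -[RHS]addr0 -[in RHS]ZcX0 -RintegralD//.
  by apply: eq_Rintegral => w _; ring.
apply: (le_trans (le_normr_Rintegral _ _)) => //.
apply: (@le_trans _ _ (\int[P]_w (c * `|X w|))).
  apply: le_Rintegral => //.
  - exact: (integrable_norm iD).
  - have := integrableZl measurableT c (integrable_norm iX).
    exact: eq_integrable.
  - by move=> w _; rewrite normrM ler_wpM2r.
rewrite RintegralZl//; last exact: (integrable_norm iX).
rewrite -/M /c mulrAC ler_pdivrMr//; nra.
Qed.

(** * Conditional expectation *)

Lemma sigma_algebra_setT (T : Type) (F : set (set T)) :
  sigma_algebra setT F -> F setT.
Proof. by move=> [F0 FC _]; rewrite -[setT]setD0; exact: FC. Qed.

(** Makes the closure properties of measurable functions available for a sub-sigma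
algebra that is given as a set of sets. *)
Lemma measurable_wrtP d (T : measurableType d) d' (X : measurableType d')
    (F : set (set T)) (Y : T -> X) : sigma_algebra setT F ->
  measurable_wrt F Y <->
  @measurable_fun _ _ (g_sigma_algebraType F) X setT Y.
Proof.
move=> sF; split.
  move=> FY _ B mB; rewrite /measurable/= sigma_algebra_id//.
  by apply: FY; exists B.
move=> mY _ [B mB <-].
have := mY measurableT B mB; by rewrite /measurable/= sigma_algebra_id.
Qed.

(** The set where [Y < 0] belongs to [F] and carries a nonnegative integral. *)
Lemma ae_ge0_integral d (T : measurableType d) (R : realType)
    (P : {measure set T -> \bar R}) (F : set (set T)) (Y : T -> R) :
  F `<=` measurable -> measurable_wrt F Y -> P.-integrable setT (EFin \o Y) ->
  (forall A, F A -> (0 <= \int[P]_(w in A) (Y w)%:E)%E) ->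
  {ae P, forall w, 0 <= Y w}.
Proof.
move=> Fm FY iY Y0.
pose N := Y @^-1` [set` `]-oo, (0:R)[].
have FN : F N by apply: measurable_wrt_preimage.
have mN := Fm _ FN.
have iN : P.-integrable N (EFin \o Y) by exact: integrableS iY.
have /ae_eq_integral_abs : (\int[P]_(w in N) `|(Y w)%:E| = 0)%E.
  apply/eqP; rewrite eq_le integral_ge0// andbT.
  rewrite (eq_integral (fun w => (-1)%:E * (Y w)%:E)%E).
    by rewrite integralZl// mulN1e oppe_le0 Y0.
  move=> w; rewrite inE /N /= in_itv /= => Yw.
  by rewrite ltr0_norm// EFinN mulN1e.
move=> /(_ mN (measurable_int P iN)).
apply: filterS => w /= H; rewrite leNgt; apply/negP => Yw.
by have := H _; rewrite /N /= in_itv/= => /(_ Yw) [] /eqP; rewrite lt_eqF.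
Qed.

Section cond_exp.
Context d (T : measurableType d) (R : realType) (P : probability T R).
Context (F : set (set T)).
Context (sF : sigma_algebra setT F) (Fm : F `<=` measurable).

Lemma cond_exp_ae_ge0 (X Y : T -> R) : (forall w, 0 <= X w) ->
  is_cond_exp P F X Y -> {ae P, forall w, 0 <= Y w}.
Proof.
move=> X0 [iX iY FY XY]; apply: (ae_ge0_integral Fm FY iY) => A FA.
by rewrite XY//; apply: integral_ge0 => w _; rewrite lee_fin.
Qed.

Lemma cond_expB (X X' Y Y' : T -> R) :
  is_cond_exp P F X Y -> is_cond_exp P F X' Y' ->
  is_cond_exp P F (X \- X') (Y \- Y').
Proof.
move=> [iX iY FY XY] [iX' iY' FY' XY']; split.
- exact: (integrableB measurableT iX iX').
- exact: (integrableB measurableT iY iY').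
- apply/measurable_wrtP => //; apply: measurable_funB; exact/measurable_wrtP.
- move=> A FA; have mA := Fm FA.
  rewrite /= !integralB_EFin ?XY ?XY'//; by [exact: integrableS iX|
    exact: integrableS iX'|exact: integrableS iY|exact: integrableS iY'].
Qed.

Lemma cond_exp_ae_le (X X' Y Y' : T -> R) : (forall w, X w <= X' w) ->
  is_cond_exp P F X Y -> is_cond_exp P F X' Y' ->
  {ae P, forall w, Y w <= Y' w}.
Proof.
move=> XX' XY XY'; have H := cond_expB XY' XY.
have X0 w : 0 <= (X' \- X) w by rewrite subr_ge0.
by have := cond_exp_ae_ge0 X0 H; apply: filterS => w /=; rewrite subr_ge0.
Qed.

Lemma cond_exp_cst c : is_cond_exp P F (cst c) (cst c).
Proof.
have ic : P.-integrable setT (EFin \o cst c) by exact: finite_measure_integrable_cst.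
split=> //; apply/measurable_wrtP => //; exact: measurable_cst.
Qed.

Lemma cond_exp_mul (X Y Z : T -> R) : is_cond_exp P F X Y ->
  measurable_wrt F Z ->
  P.-integrable setT (EFin \o (fun w => Z w * X w)) ->
  P.-integrable setT (EFin \o (fun w => Z w * Y w)) ->
  \int[P]_w (Z w * X w) = \int[P]_w (Z w * Y w).
Proof.
move=> XY FZ iZX iZY; apply/eqP; rewrite -subr_eq0 -RintegralB//.
rewrite (@eq_Rintegral _ _ _ _ _ (fun w => Z w * (X w - Y w))); last first.
  by move=> w _; rewrite mulrBr.
case: XY => iX iY FY XY.
rewrite (integral_mul_eq0 (F := F))//.
- exact: (integrableB measurableT iX iY).
- move=> A FA; have mA := Fm FA.
  rewrite integralB_EFin ?XY ?subee//; try by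
    [exact: integrableS iX|exact: integrableS iY].
  by apply: integrable_fin_num => //; exact: integrableS iX.
- have := integrableB measurableT iZX iZY; apply: eq_integrable => // w _ /=.
  by rewrite mulrBr.
Qed.

End cond_exp.

(** * Conditional independence *)

Lemma bounded_integrable d (T : measurableType d) (R : realType)
    (P : probability T R) (X : T -> R) (M : R) : measurable_fun setT X ->
  (forall w, `|X w| <= M) -> P.-integrable setT (EFin \o X).
Proof.
move=> mX XM.
apply: (@le_integrable _ _ _ P _ measurableT _ (EFin \o cst M)).
- exact/measurable_EFinP.
- by move=> w _ /=; rewrite lee_fin (le_trans (XM w))// ler_norm.
- exact: finite_measure_integrable_cst.
Qed.

Lemma Rintegral_indic d (T : measurableType d) (R : realType)
    (P : {measure set T -> \bar R}) (U : set T) (f : T -> R) :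
  \int[P]_(w in U) f w = \int[P]_w (\1_U w * f w).
Proof.
rewrite Rintegral_mkcond; apply: eq_Rintegral => w _.
by rewrite patchE indicE; case: ifP; rewrite ?mul1r ?mul0r.
Qed.

Lemma ae_eq_Rintegral d (T : measurableType d) (R : realType)
    (P : {measure set T -> \bar R}) (f g : T -> R) :
  measurable_fun setT f -> measurable_fun setT g ->
  {ae P, forall w, f w = g w} -> \int[P]_w f w = \int[P]_w g w.
Proof.
move=> mf mg fg; congr fine; apply: ae_eq_integral => //.
- exact/measurable_EFinP.
- exact/measurable_EFinP.
- by apply: filterS fg => w /= ->.
Qed.

Lemma integrable_mul_bounded d (T : measurableType d) (R : realType)
    (P : {measure set T -> \bar R}) (Z X : T -> R) :
  measurable_fun setT Z -> (forall w, `|Z w| <= 1) ->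
  P.-integrable setT (EFin \o X) ->
  P.-integrable setT (EFin \o (fun w => Z w * X w)).
Proof.
move=> mZ Z1 iX; apply: (le_integrable measurableT _ _ iX).
  apply/measurable_EFinP/measurable_funM => //.
  by apply/measurable_EFinP; exact: (measurable_int P).
by move=> w _ /=; rewrite lee_fin normrM ler_piMl.
Qed.

Section cond_indep.
Context d (T : measurableType d) (R : realType) (P : probability T R).
Context (F : set (set T)).
Context (sF : sigma_algebra setT F) (Fm : F `<=` measurable).

(** Clamping a version to [[0, 1]] changes it on a null set only. An everywhere
bounded version keeps all products integrable below. *)
Lemma cond_exp_indic_bounded (A : set T) (p : T -> R) :
  is_cond_exp P F \1_A p ->
  exists2 q, is_cond_exp P F \1_A q & forall w, 0 <= q w <= 1.
Proof.
move=> H; pose q w := Num.max 0 (Num.min (p w) 1).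
have q01 w : 0 <= q w <= 1.
  by rewrite /q le_max lexx /= ge_max ler01 /= ge_min lexx orbT.
have p0 : {ae P, forall w, 0 <= p w} by apply: cond_exp_ae_ge0 H.
have p1 : {ae P, forall w, p w <= 1}.
  apply: (cond_exp_ae_le sF Fm _ H (cond_exp_cst P sF 1)) => w /=.
  by rewrite indicE; case: (_ \in _).
have pq : {ae P, forall w, p w = q w}.
  apply: filterS2 p0 p1 => w; rewrite /q => a b.
  by rewrite min_l// max_r.
exists q => //; case: H => iX ip Fp Xp.
have Fq : measurable_wrt F q.
  apply/measurable_wrtP => //; apply: measurable_maxr => //.
  by apply: measurable_minr => //; exact/measurable_wrtP.
have mq : measurable_fun setT q.
  by move=> _ B mB; apply: Fm; apply: Fq; exists B.
split=> //.
  apply: (@bounded_integrable _ _ _ P q 1) => // w.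
  by case/andP: (q01 w) => *; rewrite ger0_norm.
move=> A' FA'; have mA' := Fm FA'; rewrite -Xp//; apply: ae_eq_integral => //.
- by apply/measurable_funTS/measurable_EFinP.
- by apply: measurable_funTS; exact: (measurable_int P).
- by apply: filterS pq => w /= ->.
Qed.

Context (N : nat) (dX : measure_display) (Xi : 'I_N -> measurableType dX).
Context (xi : forall i, T -> Xi i).
Context (mxi : forall i, measurable_fun setT (xi i)).
Context (indep : cond_mutual_indep P F xi).

(** A generating family, stable under intersection, of the sigma algebra generated
by [F] and [xi i]. *)
Definition join_sets i : set (set T) :=
  [set U | exists A B, [/\ F A, measurable B & U = A `&` xi i @^-1` B]].

Let mpre i B : measurable B -> measurable (xi i @^-1` B).
Proof. by move=> mB; rewrite -[X in measurable X]setTI; exact: mxi. Qed.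

Lemma join_sets_measurable i : join_sets i `<=` measurable.
Proof.
by move=> _ [A [B [/Fm mA mB ->]]]; apply: measurableI => //; exact: mpre.
Qed.

Let FT : F setT. Proof. exact: sigma_algebra_setT. Qed.

Let FI A B : F A -> F B -> F (A `&` B).
Proof.
rewrite -(@sigma_algebra_id _ setT F) => // FA FB.
exact: (@measurableI _ (g_sigma_algebraType F)).
Qed.

Lemma join_setsI i : setI_closed (join_sets i).
Proof.
move=> _ _ [A [B [FA mB ->]]] [A' [B' [FA' mB' ->]]].
exists (A `&` A'), (B `&` B'); split; [exact: FI|exact: measurableI|].
by rewrite preimage_setI setIACA.
Qed.

Lemma join_setsT i : join_sets i setT.
Proof. by exists setT, setT; split => //; rewrite setTI preimage_setT. Qed.

(** The versions for the other agents, whose event is the whole space, are almost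
surely equal to [1]. *)
Lemma cond_indep2 i j B B' : i != j -> measurable B -> measurable B' ->
  exists p q, [/\ is_cond_exp P F \1_(xi i @^-1` B) p,
   is_cond_exp P F \1_(xi j @^-1` B') q &
   is_cond_exp P F \1_(xi i @^-1` B `&` xi j @^-1` B') (fun w => p w * q w)].
Proof.
move=> ij mB mB'.
pose BB := dfwith (dfwith (fun m => [set: Xi m]) i B) j B'.
have BBj : BB j = B' by rewrite /BB dfwithin.
have BBi : BB i = B by rewrite /BB dfwithout 1?eq_sym// dfwithin.
have BBm m : m != i -> m != j -> BB m = setT.
  by move=> mi mj; rewrite /BB dfwithout 1?eq_sym// dfwithout 1?eq_sym.
have mBB m : measurable (BB m).
  have [->|mi] := eqVneq m i; first by rewrite BBi.
  have [->|mj] := eqVneq m j; first by rewrite BBj.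
  by rewrite BBm.
have [p [Hp Hprod]] := indep mBB.
exists (p i), (p j).
have Hpi := Hp i; have Hpj := Hp j; rewrite BBi in Hpi; rewrite BBj in Hpj.
split=> //.
have capE : \bigcap_(m in [set: 'I_N]) (xi m @^-1` BB m) =
    xi i @^-1` B `&` xi j @^-1` B'.
  apply/seteqP; split => w /=.
    by move=> H; split; [have := H i I; rewrite BBi|have := H j I; rewrite BBj].
  move=> [Hi Hj] m _ /=.
  have [->|mi] := eqVneq m i; first by rewrite BBi.
  have [->|mj] := eqVneq m j; first by rewrite BBj.
  by rewrite BBm.
rewrite capE in Hprod.
case: Hprod => iX iprod Fprod Xprod.
have p1 : {ae P, forall w m, m != i -> m != j -> p m w = 1}.
  suff H m : {ae P, forall w, m != i -> m != j -> p m w = 1}.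
    by apply: filter_forall.
  have [mi|mi] := boolP (m != i); last by apply: aeW.
  have [mj|mj] := boolP (m != j); last by apply: aeW.
  have := Hp m; rewrite BBm// preimage_setT => Hm.
  have H1 : {ae P, forall w, p m w <= 1}.
    by apply: (cond_exp_ae_le sF Fm _ Hm (cond_exp_cst P sF 1)) => w /=; rewrite indicT.
  have H2 : {ae P, forall w, 1 <= p m w}.
    by apply: (cond_exp_ae_le sF Fm _ (cond_exp_cst P sF 1) Hm) => w /=; rewrite indicT.
  by apply: filterS2 H1 H2 => w a b _ _; apply/eqP; rewrite eq_le a b.
have prodE : {ae P, forall w, \prod_m p m w = p i w * p j w}.
  apply: filterS p1 => w H.
  rewrite (bigD1 i)//= (bigD1 j) 1?eq_sym//= big1 ?mulr1//.
  by move=> m /andP[mi mj]; exact: H.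
have [_ _ Fpi _] := Hpi; have [_ _ Fpj _] := Hpj.
have Fpp : measurable_wrt F (fun w => p i w * p j w).
  by apply/measurable_wrtP => //; apply: measurable_funM; exact/measurable_wrtP.
have mpp : measurable_fun setT (fun w => p i w * p j w).
  by move=> _ C mC; apply: Fm; apply: Fpp; exists C.
split=> //.
- apply/integrableP; split; first exact/measurable_EFinP.
  case/integrableP: iprod => mprod; apply: le_lt_trans.
  rewrite le_eqVlt; apply/orP; left; apply/eqP; apply: ae_eq_integral => //.
  + by apply: measurableT_comp => //; exact/measurable_EFinP.
  + by apply: measurableT_comp.
  + by apply: filterS prodE => w /= ->.
- move=> A FA; have mA := Fm FA; rewrite -Xprod//; apply: ae_eq_integral => //.
  + by apply/measurable_funTS/measurable_EFinP.
  + by apply: measurable_funTS; exact: (measurable_int P).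
  + by apply: filterS prodE => w /= ->.
Qed.

Lemma measurable_wrt_indic C : F C -> measurable_wrt F (\1_C : T -> R).
Proof.
move=> FC; apply/measurable_wrtP => //.
by apply: measurable_indic; rewrite /measurable/= sigma_algebra_id.
Qed.

(** Conditionally on [F], the event of agent [i] may be replaced by its conditional
probability [q] even after integration over sets that depend on [xi j]. On the
generators of the latter sets this is conditional independence. *)
Lemma cond_indep_indic0 i j A B q (U : set T) : i != j ->
  F A -> measurable B -> is_cond_exp P F \1_(xi i @^-1` B) q ->
  (forall w, 0 <= q w <= 1) -> 
  <<s join_sets j >> U ->
  (\int[P]_(w in U) (\1_A w * (\1_(xi i @^-1` B) w - q w))%:E = 0)%E.
Proof.
move=> ij FA mB Hq q01.
have mA := Fm FA.
have [_ iq Fq _] := Hq.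
have mq : measurable_fun setT q by apply/measurable_EFinP; exact: (measurable_int P iq).
have mD : measurable_fun setT (fun w => \1_A w * (\1_(xi i @^-1` B) w - q w) : R).
  apply: measurable_funM; first exact: measurable_indic.
  apply: measurable_funB => //; apply: measurable_indic; exact: mpre.
have iD : P.-integrable setT (EFin \o (fun w => \1_A w * (\1_(xi i @^-1` B) w - q w))).
  apply: (@bounded_integrable _ _ _ _ _ 1) => // w.
  have := q01 w; rewrite !indicE; case: (w \in A); case: (w \in _) => /=;
    rewrite ?mul1r ?mul0r ?normr0// => /andP[a b];
    by rewrite ler_norml; apply/andP; split; lra.
apply: (@integral_eq0_dynkin _ _ _ P (join_sets j)
  (EFin \o (fun w => \1_A w * (\1_(xi i @^-1` B) w - q w)))) => //.
- exact: join_setsI.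
- exact: join_sets_measurable.
- exact: join_setsT.
move=> _ [A' [B' [FA' mB' ->]]].
have mA' := Fm FA'.
set V := A' `&` _.
have mV : measurable V by apply: measurableI => //; exact: mpre.
suff H : \int[P]_(w in V) (\1_A w * (\1_(xi i @^-1` B) w - q w)) = 0.
  rewrite -[LHS]fineK ?integrable_fin_num//; last exact: integrableS iD.
  by congr EFin; exact: H.
have [p [r [Hp Hr Hpr]]] := cond_indep2 ij mB mB'.
have [_ ip Fp _] := Hp; have [_ ir Fr _] := Hr; have [i1 ipr Fpr _] := Hpr.
have mp : measurable_fun setT p by apply/measurable_EFinP; exact: (measurable_int P ip).
have mr : measurable_fun setT r by apply/measurable_EFinP; exact: (measurable_int P ir).
pose Z w : R := \1_A w * \1_A' w.
have mZ : measurable_fun setT Z by apply: measurable_funM; exact: measurable_indic.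
have Z1 w : `|Z w| <= 1.
  by rewrite /Z !indicE; do 2! case: (_ \in _); rewrite ?mulr1 ?mulr0 ?normr0 ?normr1 ?mul1r.
have FZ : measurable_wrt F Z.
  by apply/measurable_wrtP => //; apply: measurable_funM;
    apply/measurable_wrtP => //; exact: measurable_wrt_indic.
have FZq : measurable_wrt F (fun w => Z w * q w).
  by apply/measurable_wrtP => //; apply: measurable_funM; exact/measurable_wrtP.
have qn w : `|q w| <= 1 by have /andP[a b] := q01 w; rewrite ger0_norm.
have Zqn w : `|Z w * q w| <= 1 by rewrite normrM mulr_ile1.
have mZq : measurable_fun setT (fun w => Z w * q w) by exact: measurable_funM.
have E1 := cond_exp_mul Fm Hpr FZ (integrable_mul_bounded mZ Z1 i1)
  (integrable_mul_bounded mZ Z1 ipr).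
have i2 : P.-integrable setT (EFin \o (\1_(xi j @^-1` B') : T -> R)).
  by apply: integrable_indic => //; exact: mpre.
have E2 := cond_exp_mul Fm Hr FZq (integrable_mul_bounded mZq Zqn i2)
  (integrable_mul_bounded mZq Zqn ir).
have pq : {ae P, forall w, p w = q w}.
  have a : {ae P, forall w, p w <= q w} by apply: (cond_exp_ae_le sF Fm _ Hp Hq).
  have b : {ae P, forall w, q w <= p w} by apply: (cond_exp_ae_le sF Fm _ Hq Hp).
  by apply: filterS2 a b => w a b; apply/eqP; rewrite eq_le a b.
have E3 : \int[P]_w (Z w * (p w * r w)) = \int[P]_w (Z w * q w * r w).
  apply: ae_eq_Rintegral.
  - by apply: measurable_funM => //; exact: measurable_funM.
  - by apply: measurable_funM => //; exact: measurable_funM.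
  - by apply: filterS pq => w ->; rewrite mulrA.
rewrite Rintegral_indic.
transitivity (\int[P]_w (Z w * \1_(xi i @^-1` B `&` xi j @^-1` B') w) -
    \int[P]_w (Z w * q w * \1_(xi j @^-1` B') w)); last first.
  by rewrite E1 E2 E3 subrr.
rewrite -RintegralB//; last 2 first.
  exact: integrable_mul_bounded.
  exact: integrable_mul_bounded.
apply: eq_Rintegral => w _; rewrite /V /Z !indicI /=; ring.
Qed.

(** First [Sj] has integral zero over every set depending on [F] and [xi i]: the
event of agent [i] is traded for its conditional probability, which depends on
[F] only, and [Sj] has zero conditional mean. Then [Si] is pulled out. *)
Lemma cond_indep_orthogonal i j (Si Sj : T -> R) : i != j ->
  measurable_wrt <<s join_sets i >> Si ->
  measurable_wrt <<s join_sets j >> Sj ->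
  is_cond_exp P F Sj (cst 0) ->
  P.-integrable setT (EFin \o (fun w => Si w * Sj w)) ->
  \int[P]_w (Si w * Sj w) = 0.
Proof.
move=> ij mSi mSj HS iSS.
have [iSj _ _ _] := HS.
have mSjT : measurable_fun setT Sj by apply/measurable_EFinP; exact: (measurable_int P iSj).
have Jm k : <<s join_sets k >> `<=` measurable.
  apply: smallest_sub; first exact: sigma_algebra_measurable.
  exact: join_sets_measurable.
apply: (integral_mul_eq0 (Jm i) iSj) => //.
apply: integral_eq0_dynkin => //.
- exact: join_setsI.
- exact: join_sets_measurable.
- exact: join_setsT.
move=> _ [A [B [FA mB ->]]]; have mA := Fm FA.
set V := A `&` _.
have mV : measurable V by apply: measurableI => //; exact: mpre.
suff H : \int[P]_(w in V) Sj w = 0.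
  rewrite -[LHS]fineK ?integrable_fin_num//; last exact: integrableS iSj.
  by congr EFin; exact: H.
have F1 : P.-integrable setT (EFin \o (\1_(xi i @^-1` B) : T -> R)).
  by apply: integrable_indic => //; exact: mpre.
have [p [r [Hp0 _ _]]] := cond_indep2 ij mB (measurableT : measurable [set: Xi j]).
have [q Hq q01] := cond_exp_indic_bounded Hp0.
have [_ iq Fq _] := Hq.
have mq : measurable_fun setT q by apply/measurable_EFinP; exact: (measurable_int P iq).
pose D w : R := \1_A w * (\1_(xi i @^-1` B) w - q w).
have mD : measurable_fun setT D.
  apply: measurable_funM; first exact: measurable_indic.
  apply: measurable_funB => //; apply: measurable_indic; exact: mpre.
have D1 w : `|D w| <= 1.
  have := q01 w; rewrite /D !indicE; case: (w \in A); case: (w \in _) => /=;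
    rewrite ?mul1r ?mul0r ?normr0// => /andP[a b];
    by rewrite ler_norml; apply/andP; split; lra.
have iSD : P.-integrable setT (EFin \o (fun w => Sj w * D w)).
  have := integrable_mul_bounded mD D1 iSj; apply: eq_integrable => // w _ /=.
  by rewrite mulrC.
have mAq : measurable_fun setT (fun w => \1_A w * q w).
  by apply: measurable_funM => //; exact: measurable_indic.
have Aq1 w : `|\1_A w * q w| <= 1.
  have /andP[a b] := q01 w; rewrite normrM mulr_ile1//.
    by rewrite indicE; case: (_ \in _); rewrite ?normr0 ?normr1.
  by rewrite ger0_norm.
have FAq : measurable_wrt F (fun w => \1_A w * q w).
  apply/measurable_wrtP => //; apply: measurable_funM; last exact/measurable_wrtP.
  apply/measurable_wrtP => //; exact: measurable_wrt_indic.
have iAqS := integrable_mul_bounded mAq Aq1 iSj.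
have E1 : \int[P]_w (Sj w * D w) = 0.
  apply: (integral_mul_eq0 (Jm j)) => //.
    exact: (@bounded_integrable _ _ _ _ _ 1).
  by move=> U HU; exact: (cond_indep_indic0 ij FA mB Hq q01 HU).
have E2 : \int[P]_w (\1_A w * q w * Sj w) = 0.
  rewrite (cond_exp_mul Fm HS FAq iAqS).
    by under eq_Rintegral do rewrite /= mulr0; rewrite /Rintegral integral0.
  apply: (@bounded_integrable _ _ _ _ _ 0).
    by apply: measurable_funM => //; exact: measurable_cst.
  by move=> w; rewrite /= mulr0 normr0.
rewrite Rintegral_indic.
rewrite -[LHS]subr0 -[X in _ - X]E1 -[X in _ - X](addr0) -[X in _ - (_ + X)]E2.
rewrite -RintegralD// -RintegralB//.
- under eq_Rintegral.
    move=> w _; rewrite /D /V indicI /=.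
    have -> : \1_A w * \1_(xi i @^-1` B) w * Sj w - (Sj w * (\1_A w * (\1_(xi i @^-1` B) w - q w))
      + \1_A w * q w * Sj w) = 0 by ring.
    over.
  by rewrite /Rintegral integral0.
- apply: integrable_mul_bounded => //.
  by move=> w; rewrite indicE; case: (_ \in _); rewrite ?normr0 ?normr1.
- by have := integrableD measurableT iSD iAqS; exact: eq_integrable.
Qed.
End cond_indep.

(** * Square integrable random matrices *)

Section square_integrable.
Context d (T : measurableType d) (R : realType) (P : probability T R).
Implicit Types X Y : T -> R.

Definition L1rv X := P.-integrable setT (EFin \o X).
Definition L2rv X := measurable_fun setT X /\ L1rv (fun w => X w ^+ 2).
(** Real-valued, hence meaningful for integrable functions only. *)
Definition mean X := \int[P]_w X w.

Lemma L1rvD X Y : L1rv X -> L1rv Y -> L1rv (fun w => X w + Y w).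
Proof. by move=> iX iY; exact: (integrableD measurableT iX iY). Qed.
Lemma L1rvB X Y : L1rv X -> L1rv Y -> L1rv (fun w => X w - Y w).
Proof. by move=> iX iY; exact: (integrableB measurableT iX iY). Qed.
Lemma L1rvZ c X : L1rv X -> L1rv (fun w => c * X w).
Proof. by move=> iX; exact: (integrableZl measurableT c iX). Qed.
Lemma L1rv_cst c : L1rv (fun=> c).
Proof. exact: finite_measure_integrable_cst. Qed.
Lemma L1rv_sum (I : Type) (r : seq I) (Q : pred I) (X : I -> T -> R) :
  (forall i, Q i -> L1rv (X i)) -> L1rv (fun w => \sum_(i <- r | Q i) X i w).
Proof.
move=> iX; have := integrable_sum measurableT r iX.
by apply: eq_integrable => // w _ /=; rewrite sumEFin.
Qed.
Lemma L1rv_measurable X : L1rv X -> measurable_fun setT X.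
Proof. by move=> iX; apply/measurable_EFinP; exact: (measurable_int P iX). Qed.
Lemma L1rv_le X Y : measurable_fun setT X -> (forall w, `|X w| <= Y w) ->
  L1rv Y -> L1rv X.
Proof.
move=> mX XY; apply: le_integrable => //; first exact/measurable_EFinP.
by move=> w _; rewrite /= lee_fin (le_trans (XY w))// ler_norm.
Qed.

Lemma meanD X Y : L1rv X -> L1rv Y -> mean (fun w => X w + Y w) = mean X + mean Y.
Proof. exact: RintegralD. Qed.
Lemma meanB X Y : L1rv X -> L1rv Y -> mean (fun w => X w - Y w) = mean X - mean Y.
Proof. exact: RintegralB. Qed.
Lemma meanZ c X : L1rv X -> mean (fun w => c * X w) = c * mean X.
Proof. exact: RintegralZl. Qed.
Lemma mean_cst c : mean (fun=> c) = c.
Proof. by have := expectation_cst P c; rewrite unlock /mean /Rintegral => ->. Qed.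
Lemma mean_le X Y : L1rv X -> L1rv Y -> (forall w, X w <= Y w) -> mean X <= mean Y.
Proof. by move=> iX iY XY; apply: le_Rintegral. Qed.
Lemma mean_ge0 X : (forall w, 0 <= X w) -> 0 <= mean X.
Proof. by move=> X0; apply: Rintegral_ge0. Qed.
Lemma mean_ext X Y : (forall w, X w = Y w) -> mean X = mean Y.
Proof. by move=> XY; apply: eq_Rintegral => w _. Qed.
Lemma L1rv_ext X Y : (forall w, X w = Y w) -> L1rv X -> L1rv Y.
Proof. by move=> XY; apply: eq_integrable => // w _ /=; rewrite XY. Qed.
Lemma mean_sum (I : Type) (r : seq I) (X : I -> T -> R) :
  (forall i, L1rv (X i)) -> mean (fun w => \sum_(i <- r) X i w) = \sum_(i <- r) mean (X i).
Proof.
move=> iX; elim: r => [|i r IH].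
  by rewrite big_nil -[RHS]mean_cst; apply: mean_ext => w; rewrite big_nil.
rewrite big_cons -IH -meanD//; last by apply: L1rv_sum.
by apply: mean_ext => w; rewrite big_cons.
Qed.
Lemma expectationE X : L1rv X -> ('E_P[X] = (mean X)%:E)%E.
Proof.
by move=> iX; rewrite unlock /mean /Rintegral fineK// integrable_fin_num.
Qed.

Lemma L2rv_cst c : L2rv (fun=> c).
Proof. by split => //; exact: L1rv_cst. Qed.
Lemma L2rv_mul X Y : L2rv X -> L2rv Y -> L1rv (fun w => X w * Y w).
Proof.
move=> [mX iX] [mY iY]; apply: (L1rv_le _ _ (L1rvD iX iY)).
  exact: measurable_funM.
move=> w; rewrite normrM -(real_normK (num_real (X w))) -(real_normK (num_real (Y w))).
have := sqr_ge0 (`|X w| - `|Y w|); have := normr_ge0 (X w); have := normr_ge0 (Y w).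
nra.
Qed.
Lemma L2rvD X Y : L2rv X -> L2rv Y -> L2rv (fun w => X w + Y w).
Proof.
move=> sX sY; split; first by case: sX sY => ? _ [? _]; exact: measurable_funD.
have := L1rvD (L1rvD sX.2 (L1rvZ 2 (L2rv_mul sX sY))) sY.2.
by apply: L1rv_ext => w; ring.
Qed.
Lemma L2rvZ c X : L2rv X -> L2rv (fun w => c * X w).
Proof.
move=> sX; split; first by case: sX => ? _; exact: measurable_funM.
by have := L1rvZ (c ^+ 2) sX.2; apply: L1rv_ext => w; rewrite exprMn.
Qed.
Lemma L2rv_ext X Y : (forall w, X w = Y w) -> L2rv X -> L2rv Y.
Proof. by move=> /funext ->. Qed.
Lemma L2rvB X Y : L2rv X -> L2rv Y -> L2rv (fun w => X w - Y w).
Proof.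
move=> sX sY; apply: (L2rv_ext _ (L2rvD sX (L2rvZ (-1) sY))) => w.
by rewrite mulN1r.
Qed.
Lemma L2rv_sum (I : Type) (r : seq I) (X : I -> T -> R) :
  (forall i, L2rv (X i)) -> L2rv (fun w => \sum_(i <- r) X i w).
Proof.
move=> sX; elim: r => [|i r IH].
  by apply: (L2rv_ext _ (L2rv_cst 0)) => w; rewrite big_nil.
by apply: (L2rv_ext _ (L2rvD (sX i) IH)) => w; rewrite big_cons.
Qed.
Lemma L2rv_le X Y : measurable_fun setT X -> (forall w, X w ^+ 2 <= Y w) ->
  L1rv Y -> L2rv X.
Proof.
move=> mX XY iY; split=> //; apply: (L1rv_le _ _ iY).
  exact: measurable_funX.
by move=> w; rewrite ger0_norm ?sqr_ge0.
Qed.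

Definition L2rv_mx m n (A : T -> 'M[R]_(m, n)) :=
  forall i j, L2rv (fun w => A w i j).

Lemma L2rv_mxdot m n (A B : T -> 'M[R]_(m, n)) : L2rv_mx A -> L2rv_mx B ->
  L1rv (fun w => mxdot (A w) (B w)).
Proof.
by move=> sA sB; apply: L1rv_sum => i _; apply: L1rv_sum => j _; exact: L2rv_mul.
Qed.
Lemma L2rv_sqnorm m n (A : T -> 'M[R]_(m, n)) : L2rv_mx A ->
  L1rv (fun w => sqnorm (A w)).
Proof.
by move=> sA; apply: (L1rv_ext _ (L2rv_mxdot sA sA)) => w; rewrite sqnormE.
Qed.
Lemma L2rv_mxD m n (A B : T -> 'M[R]_(m, n)) : L2rv_mx A -> L2rv_mx B ->
  L2rv_mx (fun w => A w + B w).
Proof.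
by move=> sA sB i j; apply: (L2rv_ext _ (L2rvD (sA i j) (sB i j))) => w; rewrite mxE.
Qed.
Lemma L2rv_mxZ m n c (A : T -> 'M[R]_(m, n)) : L2rv_mx A ->
  L2rv_mx (fun w => c *: A w).
Proof.
by move=> sA i j; apply: (L2rv_ext _ (L2rvZ c (sA i j))) => w; rewrite mxE.
Qed.
Lemma L2rv_mxB m n (A B : T -> 'M[R]_(m, n)) : L2rv_mx A -> L2rv_mx B ->
  L2rv_mx (fun w => A w - B w).
Proof.
by move=> sA sB i j; apply: (L2rv_ext _ (L2rvB (sA i j) (sB i j))) => w; rewrite !mxE.
Qed.
Lemma L2rv_mxM m n p (M : 'M[R]_(m, n)) (A : T -> 'M[R]_(n, p)) : L2rv_mx A ->
  L2rv_mx (fun w => M *m A w).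
Proof.
move=> sA i j; apply: (L2rv_ext _ (L2rv_sum (index_enum _) (fun k => L2rvZ (M i k) (sA k j)))).
by move=> w; rewrite mxE.
Qed.
Lemma L2rv_mx_cst m n (A : 'M[R]_(m, n)) : L2rv_mx (fun=> A).
Proof. by move=> i j; exact: L2rv_cst. Qed.
Lemma L2rv_mx_sum (I : Type) (r : seq I) m n (A : I -> T -> 'M[R]_(m, n)) :
  (forall i, L2rv_mx (A i)) -> L2rv_mx (fun w => \sum_(i <- r) A i w).
Proof.
move=> sA i j; apply: (L2rv_ext _ (L2rv_sum r (fun k => sA k i j))) => w.
by rewrite summxE.
Qed.

Lemma mean_mxdot m n (A B : T -> 'M[R]_(m, n)) : L2rv_mx A -> L2rv_mx B ->
  mean (fun w => mxdot (A w) (B w)) = \sum_i \sum_j mean (fun w => A w i j * B w i j).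
Proof.
move=> sA sB; rewrite mean_sum; last first.
  by move=> i; apply: L1rv_sum => j _; exact: L2rv_mul.
by apply: eq_bigr => i _; rewrite mean_sum// => j; exact: L2rv_mul.
Qed.

Lemma mean_sqnorm_sum (I : eqType) (r : seq I) m n (A : I -> T -> 'M[R]_(m, n)) :
  uniq r -> (forall l, L2rv_mx (A l)) ->
  (forall l l', l != l' -> mean (fun w => mxdot (A l w) (A l' w)) = 0) ->
  mean (fun w => sqnorm (\sum_(l <- r) A l w)) = \sum_(l <- r) mean (fun w => sqnorm (A l w)).
Proof.
move=> ur sA A0; elim: r ur => [_|k r IH /= /andP[kr ur]].
  by rewrite big_nil -[RHS]mean_cst; apply: mean_ext => w; rewrite big_nil sqnorm0.
have sS : L2rv_mx (fun w => \sum_(l <- r) A l w) by exact: L2rv_mx_sum.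
rewrite big_cons -IH// -[in RHS](addr0 (mean _)).
have <- : 2 * mean (fun w => mxdot (\sum_(l <- r) A l w) (A k w)) = 0.
  rewrite (_ : mean _ = 0) ?mulr0//.
  transitivity (\sum_(l <- r) mean (fun w => mxdot (A l w) (A k w))).
    rewrite -mean_sum; last by move=> l; exact: L2rv_mxdot.
    by apply: mean_ext => w; rewrite mxdot_suml.
  rewrite big_seq big1// => l lr; apply: A0.
  by apply: contraNneq kr => <-.
have iS := L2rv_sqnorm sS; have iK := L2rv_sqnorm (sA k).
have iD := L1rvZ 2 (L2rv_mxdot sS (sA k)).
rewrite -meanZ; last exact: L2rv_mxdot.
rewrite -meanD// -meanD//; last exact: L1rvD.
by apply: mean_ext => w; rewrite big_cons sqnormD mxdotC addrAC.
Qed.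

Lemma cond_mean0_orthogonal (F : set (set T)) (X Z : T -> R) :
  F `<=` measurable -> is_cond_exp P F X (cst 0) -> measurable_wrt F Z ->
  L1rv (fun w => Z w * X w) -> mean (fun w => Z w * X w) = 0.
Proof.
move=> Fm [iX _ _ X0] FZ iZX; apply: (integral_mul_eq0 Fm iX) => // A FA.
by rewrite -X0//= integral0.
Qed.
End square_integrable.

Lemma cvg_addl (R : realType) n (c v : 'rV[R]_n) :
  (fun u : 'rV[R]_n => c + u) u @[u --> v] --> c + v.
Proof. exact: (cvgD (cvg_cst _) cvg_id). Qed.

(** The partial derivatives are limits of difference quotients along [1 / (m + 1)],
which are Caratheodory functions even if the gradient is not continuous. *)
Lemma measurable_grad d (T : measurableType d) (R : realType) (n : nat)
    (x : T -> 'rV[R]_n) (G : 'rV[R]_n -> T -> R) (j : 'I_n) :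
  (forall j, measurable_fun setT (fun w => x w 0 j)) ->
  (forall v, measurable_fun setT (G v)) ->
  (forall w v, differentiable (G ^~ w) v) ->
  measurable_fun setT (fun w => grad (G ^~ w) (x w) 0 j).
Proof.
move=> mx mG dG; pose e : 'rV[R]_n := delta_mx 0 j.
apply: (@measurable_fun_cvg _ _ _ _ (fun m w =>
   (m.+1%:R^-1)^-1 * (G (m.+1%:R^-1 *: e + x w) w - G (x w) w))).
  move=> m; apply: measurable_funM => //; apply: measurable_funB.
    apply: (caratheodory_measurable (G := fun v w => G (m.+1%:R^-1 *: e + v) w)) => // w v.
    apply: (@cvg_comp _ _ _ (fun u : 'rV[R]_n => m.+1%:R^-1 *: e + u) (G ^~ w)).
      exact: cvg_addl.
    exact: differentiable_continuous (dG w _).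
  apply: caratheodory_measurable => // w v.
  exact: differentiable_continuous (dG _ _).
move=> w _; rewrite mxE.
have /diff_derivable H := dG w (x w).
have c0 : (fun m : nat => m.+1%:R^-1 : R) @ \oo --> 0^'.
  move=> A /= [r r0 HA]; have := @cvg_harmonic R => /cvgrPdist_lt /(_ _ r0).
  apply: filterS => m; rewrite /harmonic /= => hm; apply: HA => //=.
exact: (cvg_comp (fun m : nat => m.+1%:R^-1 : R)
  (fun h => h^-1 *: (((G ^~ w) \o shift (x w)) (h *: e) - G (x w) w)) c0 (H e)).
Qed.

(** * Moments of stochastic gradient tracking *)

Section process.
Context (R : realType) (N d : nat) (hN : (1 <= N)%N).
Context (dX : measure_display) (Xi : 'I_N -> measurableType dX).
Context (D : forall i, probability (Xi i) R).
Context (F : forall i, 'rV[R]_d -> Xi i -> R) (f : 'I_N -> 'rV[R]_d -> R).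
Context (hF : stochastic_objective D F f).
Context (L : R) (hL : 0 < L) (xstar : 'rV[R]_d).
Context (hf : function_assumption f L xstar).
Context (W : nat -> 'M[R]_N) (tau : nat) (lambda : R).
Context (hW : network_assumption W tau lambda).
Context (x0 : 'I_N -> 'rV[R]_d).
Context (dT : measure_display) (T : measurableType dT) (P : probability T R).
Context (xi : nat -> forall i, {RV P >-> Xi i}).
Context (sigma alpha : R) (Fk : nat -> set (set T)).
Context (hnoise : gradient_noise_assumption P F f sigma xi W x0 alpha Fk).

Let x := sgt_x F xi W x0 alpha.
Let g := sgt_g F xi W x0 alpha.
Definition sample k i w := grad (fun y => @F i y (xi k i w)) (x k w i).
Definition noise k i w := sample k i w - grad (f i) (x k w i).

Lemma sgt_xS k w i :
  x k.+1 w i = \sum_j W k i j *: (x k w j - alpha *: g k w j).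
Proof. by rewrite /x /g /sgt_x /sgt_g /=; case: gt_state. Qed.

Lemma sgt_gS k w i : g k.+1 w i =
  \sum_j W k i j *: g k w j + sample k.+1 i w - sample k i w.
Proof.
rewrite /sample sgt_xS.
by rewrite /x /g /sgt_x /sgt_g /=; case: gt_state.
Qed.

Let info : information xi x g Fk. Proof. by case: hnoise. Qed.
Let sFk k : sigma_algebra setT (Fk k). Proof. by case: (info k). Qed.
Let Fkm k : Fk k `<=` measurable. Proof. by case: (info k). Qed.

Lemma diff_f i v : differentiable (f i) v. Proof. by case: hf. Qed.

(** Stated for an arbitrary sigma algebra [H] because it is used for two of them:
the information available at a later time, and the one generated by the present
information together with the sample of a single agent. *)
Lemma noise_measurable (H : set (set T)) k i j : sigma_algebra setT H ->
  (forall j, measurable_wrt H (fun w => x k w i 0 j)) ->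
  measurable_wrt H (xi k i : T -> Xi i) ->
  measurable_wrt H (fun w => noise k i w 0 j).
Proof.
move=> sH Hx Hxi; apply/measurable_wrtP => //.
have Hx' j' : @measurable_fun _ _ (g_sigma_algebraType H) R setT (fun w => x k w i 0 j').
  by apply/measurable_wrtP.
apply: (@eq_measurable_fun _ _ _ _ _ (fun w : g_sigma_algebraType H =>
   grad ((fun y w => @F i y (xi k i w)) ^~ w) (x k w i) 0 j - grad (f i) (x k w i) 0 j)).
  by move=> w _; rewrite /noise /sample !mxE.
apply: measurable_funB.
  apply: (@measurable_grad _ (g_sigma_algebraType H) R d (fun w => x k w i)
    (fun y w => @F i y (xi k i w))) => //.
    move=> v; have [_ iF _] := hF i.
    have mF : measurable_fun setT (@F i v) by apply/measurable_EFinP; exact: (measurable_int _ (iF v)).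
    by apply: (measurableT_comp mF); apply/measurable_wrtP.
  by move=> w v; have [dF _ _] := hF i; exact: dF.
apply: (@measurable_grad _ (g_sigma_algebraType H) R d (fun w => x k w i)
    (fun y w => f i y)) => //.
by move=> w v; exact: diff_f.
Qed.

Lemma noise_past k m i j : (k < m)%N -> measurable_wrt (Fk m) (fun w => noise k i w 0 j).
Proof.
move=> km; have [_ _ h1 _ h3] := info m; apply: noise_measurable => //.
  by move=> j'; exact: h1 (ltnW km).
exact: h3.
Qed.

Lemma x_present k i j : measurable_wrt (Fk k) (fun w => x k w i 0 j).
Proof. by have [_ _ h1 _ _] := info k; exact: h1. Qed.

Lemma noise_mean0 k i j : is_cond_exp P (Fk k) (fun w => noise k i w 0 j) (cst 0).
Proof. by case: hnoise => _ /(_ k) [_ + _]; exact. Qed.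

Lemma L2rv_noise k i : L2rv_mx P (noise k i).
Proof.
move=> i0 j; rewrite ord1.
case: hnoise => _ /(_ k) [_ _ /(_ i) [V [[iS _ _ _] _]]].
apply: (L2rv_le _ _ iS).
  by apply: L1rv_measurable; case: (noise_mean0 k i j) => iX _ _ _; exact: iX.
move=> w; rewrite /sqnorm big_ord1 (bigD1 j)//= lerDl.
by apply: sumr_ge0 => j' _; exact: sqr_ge0.
Qed.

(** The bound [V <= sigma ^ 2] holds almost surely only, hence the positive part
of [V]. *)
Lemma noise_variance k i : mean P (fun w => sqnorm (noise k i w)) <= sigma ^+ 2.
Proof.
case: hnoise => _ /(_ k) [_ _ /(_ i) [V [[iS iV _ EV] VS]]].
have FT := sigma_algebra_setT (sFk k).
rewrite /mean /Rintegral -(EV _ FT) -lee_fin fineK; last first.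
  by apply: integrable_fin_num => //; exact: iV.
have -> : (sigma ^+ 2)%:E = (\int[P]_w (sigma ^+ 2)%:E)%E.
  by have := expectation_cst P (sigma ^+ 2); rewrite unlock.
have mV : measurable_fun setT V by exact: (L1rv_measurable iV).
pose Vp w := Num.max (V w) 0.
have mVp : measurable_fun setT Vp by apply: measurable_maxr => //; exact: measurable_cst.
have iVp : L1rv P Vp.
  apply: (le_integrable _ _ _ iV) => //; first exact/measurable_EFinP.
  move=> w _ /=; rewrite lee_fin /Vp; case: (leP (V w) 0) => h; last by [].
  by rewrite normr0.
apply: (@le_trans _ _ (\int[P]_w (Vp w)%:E)%E).
  by apply: le_integral => // w _; rewrite lee_fin /Vp le_max lexx.
apply: ae_ge0_le_integral => //.
- by move=> w _; rewrite lee_fin /Vp le_max lexx orbT.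
- exact/measurable_EFinP.
- by move=> w _; rewrite lee_fin sqr_ge0.
- by apply: filterS VS => w Vw _; rewrite lee_fin /Vp ge_max Vw sqr_ge0.
Qed.

(** Each noise is a function of the past and of the sample of its own agent. *)
Lemma noise_orth_space k i i' : i != i' ->
  mean P (fun w => mxdot (noise k i w) (noise k i' w)) = 0.
Proof.
move=> ii'; rewrite mean_mxdot ?big_ord1; try exact: L2rv_noise.
apply: big1 => j _.
have indep : cond_mutual_indep P (Fk k) (fun i => xi k i : T -> Xi i).
  by case: hnoise => _ /(_ k) [].
have mxi m : measurable_fun setT (xi k m : T -> Xi m) by [].
have joined m : measurable_wrt <<s join_sets (Fk k) (fun i => xi k i : T -> Xi i) m >>
    (fun w => noise k m w 0 j).
  apply: noise_measurable; first exact: smallest_sigma_algebra.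
    move=> j' A FA; apply: sub_sigma_algebra; exists A, setT; split => //.
      exact: x_present FA.
    by rewrite preimage_setT setIT.
  move=> _ [B mB <-]; apply: sub_sigma_algebra; exists setT, B; split => //.
  exact: sigma_algebra_setT.
apply: (cond_indep_orthogonal (sFk k) (Fkm (k := k)) mxi indep ii' (joined i) (joined i')).
  exact: noise_mean0.
by apply: L2rv_mul; exact: L2rv_noise.
Qed.

Lemma rows_mxE (y : 'I_N -> 'rV[R]_d) i : row i (rows_mx y) = y i.
Proof. by apply/rowP => j; rewrite !mxE. Qed.

Lemma sqnorm_rows (y : 'I_N -> 'rV[R]_d) : sqnorm (rows_mx y) = \sum_i sqnorm (y i).
Proof. by rewrite sqnorm_row; apply: eq_bigr => i _; rewrite rows_mxE. Qed.

Lemma avgE (y : 'I_N -> 'rV[R]_d) i : avg y = row i (Pi_mx R N *m rows_mx y).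
Proof.
apply/rowP => j; rewrite [RHS]mxE Pi_mulE mxE summxE; congr (_ * _).
by apply: eq_bigr => k _; rewrite mxE.
Qed.

Lemma spreadE (y : 'I_N -> 'rV[R]_d) :
  sqnorm ((1%:M - Pi_mx R N) *m rows_mx y) = N%:R * spread y.
Proof.
rewrite /spread mulrA mulfV ?mul1r ?pnatr_eq0 -?lt0n// sqnorm_row.
apply: eq_bigr => i _; congr sqnorm.
by rewrite (avgE _ i) mulmxBl mul1mx linearB /= rows_mxE.
Qed.

Lemma mulmx_rows (M : 'M[R]_N) (y : 'I_N -> 'rV[R]_d) :
  M *m rows_mx y = rows_mx (fun i => \sum_j M i j *: y j).
Proof.
apply/matrixP => i j; rewrite !mxE summxE; apply: eq_bigr => k _.
by rewrite !mxE.
Qed.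

Let X k w := rows_mx (x k w).
Let G k w := rows_mx (g k w).
Let H k w := rows_mx (fun i => sample k i w).
Let S k w := rows_mx (fun i => noise k i w).
Let C := rows_mx (fun i => grad (f i) xstar).

Let XS k w : X k.+1 w = W k *m (X k w - alpha *: G k w).
Proof.
have -> : X k w - alpha *: G k w = rows_mx (fun j => x k w j - alpha *: g k w j).
  by apply/matrixP => i j; rewrite !mxE.
rewrite mulmx_rows; apply/matrixP => i j; rewrite [LHS]mxE [RHS]mxE.
by rewrite sgt_xS.
Qed.

Let GS k w : G k.+1 w = W k *m G k w + H k.+1 w - H k w.
Proof.
rewrite mulmx_rows; apply/matrixP => i j; rewrite [LHS]mxE sgt_gS.
by rewrite !mxE.
Qed.

Let G0 w : G 0 w = H 0 w. Proof. by []. Qed.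

Lemma gradf_measurable (dT' : measure_display) (T' : measurableType dT') (y : T' -> 'rV[R]_d) i j :
  (forall j, measurable_fun setT (fun w => y w 0 j)) ->
  measurable_fun setT (fun w => grad (f i) (y w) 0 j).
Proof.
move=> my; apply: (measurable_grad (G := fun v w => f i v)) => //.
by move=> w v; exact: diff_f.
Qed.

Lemma f_measurable (dT' : measure_display) (T' : measurableType dT') (y : T' -> 'rV[R]_d) i :
  (forall j, measurable_fun setT (fun w => y w 0 j)) ->
  measurable_fun setT (fun w => f i (y w)).
Proof.
move=> my; apply: (caratheodory_measurable (G := fun v w => f i v)) => // w v.
by apply: differentiable_continuous; exact: diff_f.
Qed.

Lemma L2rv_rows (y : 'I_N -> T -> 'rV[R]_d) : (forall i, L2rv_mx P (y i)) ->
  L2rv_mx P (fun w => rows_mx (fun i => y i w)).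
Proof. by move=> sy i j; apply: (L2rv_ext _ (sy i 0 j)) => w; rewrite mxE. Qed.

(** A Lipschitz gradient grows at most linearly. *)
Lemma L2rv_gradf (y : T -> 'rV[R]_d) i : L2rv_mx P y ->
  L2rv_mx P (fun w => grad (f i) (y w)).
Proof.
move=> sy i0 j; rewrite ord1.
apply: (@L2rv_le _ _ _ _ _ (fun w => 2 * (L ^+ 2 * sqnorm (y w - xstar)) + 2 * sqnorm (grad (f i) xstar))).
- by apply: gradf_measurable => j'; case: (sy 0 j').
- move=> w.
  apply: (@le_trans _ _ (sqnorm (grad (f i) (y w)))).
    rewrite /sqnorm big_ord1 (bigD1 j)//= lerDl.
    by apply: sumr_ge0 => j' _; exact: sqr_ge0.
  have -> : grad (f i) (y w) = (grad (f i) (y w) - grad (f i) xstar) + grad (f i) xstar by rewrite subrK.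
  rewrite (le_trans (sqnormD_le _ _))// lerD2r ler_wpM2l//.
  case: hf => _ _ lf _; have := lf i (y w) xstar.
  by rewrite (enorm_le _ _ (ltW hL)).
- apply: L1rvD; last exact: L1rv_cst.
  do 2 apply: L1rvZ; apply: L2rv_sqnorm; apply: L2rv_mxB => //; exact: L2rv_mx_cst.
Qed.

Lemma L2rv_x_row k i : L2rv_mx P (X k) -> L2rv_mx P (fun w => x k w i).
Proof.
by move=> sX i0 j; apply: (L2rv_ext _ (sX i j)) => w; rewrite ord1 mxE.
Qed.

Lemma L2rv_H k : L2rv_mx P (X k) -> L2rv_mx P (H k).
Proof.
move=> sX; apply: L2rv_rows => i.
have e w : noise k i w + grad (f i) (x k w i) = sample k i w by rewrite subrK.
move=> i0 j; apply: (L2rv_ext _ (L2rv_mxD (@L2rv_noise k i) (L2rv_gradf i (L2rv_x_row i sX)) i0 j)) => w.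
by rewrite e.
Qed.

Lemma L2rv_XG k : L2rv_mx P (X k) /\ L2rv_mx P (G k).
Proof.
elim: k => [|k [sX sG]].
  have sX : L2rv_mx P (X 0) by exact: (@L2rv_mx_cst _ _ _ P _ _ (rows_mx x0)).
  by split=> //; exact: (L2rv_H sX).
have sX1 : L2rv_mx P (X k.+1).
  move=> i j; apply: (L2rv_ext _ (L2rv_mxM (W k) (L2rv_mxB sX (L2rv_mxZ alpha sG)) i j)) => w.
  by rewrite XS.
split=> //.
move=> i j; apply: (L2rv_ext _ (L2rv_mxB
  (L2rv_mxD (L2rv_mxM (W k) sG) (L2rv_H sX1)) (L2rv_H sX) i j)) => w.
by rewrite GS.
Qed.

Let sqX k : L2rv_mx P (X k). Proof. by case: (L2rv_XG k). Qed.
Let sqxi k i : L2rv_mx P (fun w => x k w i). Proof. exact: L2rv_x_row. Qed.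
Let sqS k : L2rv_mx P (S k). Proof. by apply: L2rv_rows => i; exact: L2rv_noise. Qed.
Let sqx k : L2rv_mx P (fun w => avg (x k w)).
Proof.
by apply: L2rv_mxZ; apply: L2rv_mx_sum => i.
Qed.

Lemma L1rv_spread k : L1rv P (fun w => spread (x k w)).
Proof.
apply: L1rvZ; apply: L1rv_sum => i _; apply: L2rv_sqnorm.
exact: L2rv_mxB.
Qed.

Lemma L1rv_gap k : L1rv P (fun w => gap f xstar (avg (x k w))).
Proof.
apply: (@L1rv_le _ _ _ _ _ (fun w => L * sqnorm (avg (x k w) - xstar))).
- apply: measurable_funB => //; apply: measurable_funM => //.
  apply: measurable_sum => i; apply: f_measurable => j.
  by case: (@sqx k 0 j).
- by move=> w; rewrite ger0_norm ?(gap_ge0 hf)// (gap_le hN hL hf).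
- apply: L1rvZ; apply: L2rv_sqnorm; apply: L2rv_mxB => //; exact: L2rv_mx_cst.
Qed.

Let rho := tau%:R / (1 - lambda).
Let sp k := mean P (fun w => spread (x k w)).
Let gp k := mean P (fun w => gap f xstar (avg (x k w))).

Let B k w := H k w - S k w - C.
Let BE k w : B k w = rows_mx (fun i => grad (f i) (x k w i) - grad (f i) xstar).
Proof. by apply/matrixP => i j; rewrite !mxE; ring. Qed.

(** The gradients at the iterates are compared with those at the minimizer through
the gradients at the mean. *)
Lemma drift_le k w : sqnorm (B k w) <=
  N%:R * (2 * L ^+ 2 * spread (x k w) + 8 * L * gap f xstar (avg (x k w))).
Proof.
rewrite BE sqnorm_rows; set z := avg (x k w).
apply: (@le_trans _ _ (\sum_i (2 * sqnorm (grad (f i) (x k w i) - grad (f i) z) +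
   2 * sqnorm (grad (f i) z - grad (f i) xstar)))).
  apply: ler_sum => i _.
  have -> : grad (f i) (x k w i) - grad (f i) xstar =
     (grad (f i) (x k w i) - grad (f i) z) + (grad (f i) z - grad (f i) xstar) by rewrite addrA subrK.
  exact: sqnormD_le.
rewrite big_split /= -!mulr_sumr.
have h1 := sum_grad_lip hL hf (x k w) z.
have h2 := sum_grad_gap hN hL hf z.
have e : N%:R * spread (x k w) = \sum_i sqnorm (x k w i - z).
  by rewrite /spread mulrA mulfV ?mul1r ?pnatr_eq0 -?lt0n.
rewrite -e in h1; move: h1 h2; move: (\sum_i _) (\sum_i _) (spread _) (gap _ _ _).
by move=> s1 s2 V F0 h1 h2; lra.
Qed.

Let sqB k : L2rv_mx P (B k).
Proof.
apply: L2rv_mxB; last exact: L2rv_mx_cst.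
by apply: L2rv_mxB => //; exact: L2rv_H.
Qed.

Let init K := \sum_(k < K) sqnorm (chain (Wtilde W) 0 k *m
  ((1%:M - Pi_mx R N) *m rows_mx x0 - (alpha * k%:R) *: C)).

Lemma spread_path K w : N%:R * \sum_(k < K) spread (x k w) <=
  2 * init K + 4 * alpha ^+ 2 * (25 * rho ^+ 4 * \sum_(k < K) sqnorm (B k w) +
     \sum_(k < K) sqnorm (\sum_(l < k) track_impulse W k l *m S l w)).
Proof.
have h := sum_track_impulse_le hN hW K (fun l => B l w).
apply: (@le_trans _ _ (2 * init K + 4 * alpha ^+ 2 * (
    \sum_(k < K) sqnorm (\sum_(l < k) track_impulse W k l *m B l w) +
     \sum_(k < K) sqnorm (\sum_(l < k) track_impulse W k l *m S l w)))); last first.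
  by rewrite lerD2l ler_wpM2l ?lerD2r// mulr_ge0 ?sqr_ge0.
rewrite mulrDr !mulr_sumr -!big_split /=; apply: ler_sum => k _.
rewrite -spreadE -/(X k w).
rewrite (@consensus_shifted _ _ hN _ _ _ hW d (X ^~ w) (G ^~ w) (H ^~ w) alpha
  (G0 w) (XS ^~ w) (GS ^~ w) k C).
have -> : \sum_(l < k) track_impulse W k l *m (H l w - C) =
    \sum_(l < k) track_impulse W k l *m B l w + \sum_(l < k) track_impulse W k l *m S l w.
  rewrite -big_split /=; apply: eq_bigr => l _; rewrite -mulmxDr; congr (_ *m _).
  by rewrite /B addrAC addrNK.
rewrite (le_trans (sqnormD_le _ _))// lerD2l.
rewrite sqnormN sqnormZ.
set b := \sum_(l < k) _ *m B _ _; set s := \sum_(l < k) _ *m S _ _.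
have := sqnormD_le b s; have := sqr_ge0 alpha; nra.
Qed.

Lemma mulmx_rows_entry (M : 'M[R]_N) (y : 'I_N -> 'rV[R]_d) i j :
  (M *m rows_mx y) i j = \sum_p M i p * y p 0 j.
Proof. by rewrite mxE; apply: eq_bigr => p _; rewrite mxE. Qed.

Lemma mulr_sum_weights (a : R) (c b : 'I_N -> R) :
  \sum_p c p * (a * b p) = a * \sum_p c p * b p.
Proof. by rewrite mulr_sumr; apply: eq_bigr => p _; rewrite mulrCA. Qed.

Let entry_measurable (M : 'M[R]_N) l m i j : (l < m)%N ->
  measurable_wrt (Fk m) (fun w => (M *m S l w) i j).
Proof.
move=> lm; apply/measurable_wrtP => //.
apply: (@eq_measurable_fun _ _ _ _ _ (fun w : g_sigma_algebraType (Fk m) =>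
   \sum_p M i p * noise l p w 0 j)).
  by move=> w _; exact/esym/mulmx_rows_entry.
apply: measurable_sum => p; apply: measurable_funM => //.
by apply/measurable_wrtP => //; exact: noise_past.
Qed.

(** The earlier noise is known before the later samples are drawn. *)
Lemma weighted_noise_orth (M M' : 'M[R]_N) l m : (l < m)%N ->
  mean P (fun w => mxdot (M *m S l w) (M' *m S m w)) = 0.
Proof.
move=> lm; have s1 := L2rv_mxM M (@sqS l); have s2 := L2rv_mxM M' (@sqS m).
rewrite mean_mxdot//; apply: big1 => i _; apply: big1 => j _.
have sn p : L2rv P (fun w => noise m p w 0 j) by exact: L2rv_noise.
transitivity (\sum_p M' i p * mean P (fun w => (M *m S l w) i j * noise m p w 0 j)).
  have im p : L1rv P (fun w => (M *m S l w) i j * noise m p w 0 j).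
    by apply: L2rv_mul => //; exact: (s1 i j).
  rewrite (eq_bigr (fun p => mean P (fun w =>
    M' i p * ((M *m S l w) i j * noise m p w 0 j)))); last first.
    by move=> p _; rewrite meanZ.
  rewrite -mean_sum; last by move=> p; exact: L1rvZ.
  have E w : (M' *m S m w) i j = \sum_p M' i p * noise m p w 0 j :=
    mulmx_rows_entry M' (noise m ^~ w) i j.
  apply: mean_ext => w; transitivity ((M *m S l w) i j * \sum_p M' i p * noise m p w 0 j).
    exact: (congr1 (fun t => (M *m S l w) i j * t) (E w)).
  exact: (esym (mulr_sum_weights ((M *m S l w) i j) (M' i) (fun p => noise m p w 0 j))).
apply: big1 => p _; rewrite (cond_mean0_orthogonal (Fkm (k := m)) (noise_mean0 m p j)) ?mulr0//.
  exact: entry_measurable.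
by apply: L2rv_mul => //; exact: (s1 i j).
Qed.

Lemma mean_noise_mx k : mean P (fun w => sqnorm (S k w)) <= N%:R * sigma ^+ 2.
Proof.
have -> : mean P (fun w => sqnorm (S k w)) = \sum_i mean P (fun w => sqnorm (noise k i w)).
  rewrite -mean_sum; last by move=> i; apply: L2rv_sqnorm; exact: L2rv_noise.
  by apply: mean_ext => w; exact: (sqnorm_rows (noise k ^~ w)).
apply: (@le_trans _ _ (\sum_(i < N) sigma ^+ 2)).
  by apply: ler_sum => i _; exact: noise_variance.
by rewrite sumr_const card_ord -[leLHS]mulr_natl.
Qed.

(** Orthogonality across time gives the sum of squares, hence [rho ^ 3]. *)
Lemma consensus_noise k :
  mean P (fun w => sqnorm (\sum_(l < k) track_impulse W k l *m S l w)) <=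
  33 * rho ^+ 3 * (N%:R * sigma ^+ 2).
Proof.
rewrite (@mean_sqnorm_sum _ _ _ P 'I_k (index_enum _) _ _
  (fun l w => track_impulse W k l *m S l w)) ?index_enum_uniq//; first last.
- move=> l l'; rewrite neq_ltn => /orP[ll'|ll']; first exact: weighted_noise_orth.
  rewrite -[RHS](weighted_noise_orth (track_impulse W k l') (track_impulse W k l) ll').
  by apply: mean_ext => w; exact: mxdotC.
- by move=> l; apply: L2rv_mxM.
have c0 : 0 <= N%:R * sigma ^+ 2 by rewrite mulr_ge0 ?sqr_ge0.
apply: le_trans (sum_track_impulse_sqr_le hW k
  (z := fun l => mean P (fun w => sqnorm (S l w))) mean_noise_mx c0).
apply: ler_sum => l _; rewrite -meanZ; last exact: L2rv_sqnorm.
apply: mean_le.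
- by apply: L2rv_sqnorm; exact: L2rv_mxM.
- by apply: L1rvZ; exact: L2rv_sqnorm.
- move=> w; have := enorm_track_impulse hN hW (S l w) (ltn_ord l).
  rewrite enorm_le// mulr_ge0 ?addr_ge0 ?mulr_ge0// decay_ge0//.
  by case: hW => _ _ _ [].
Qed.

(** The accumulated spread also occurs on the right hand side, with a factor of
order [alpha ^ 2 * rho ^ 4 * L ^ 2]. *)
Lemma consensus_bound K : N%:R * \sum_(k < K) sp k <=
  2 * init K + 4 * alpha ^+ 2 * (25 * rho ^+ 4 *
     (N%:R * (2 * L ^+ 2 * (\sum_(k < K) sp k) + 8 * L * (\sum_(k < K) gp k)))
     + K%:R * (33 * rho ^+ 3 * (N%:R * sigma ^+ 2))).
Proof.
have iB l : L1rv P (fun w => sqnorm (B l w)) by exact: L2rv_sqnorm.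
have iS (k : 'I_K) : L1rv P (fun w => sqnorm (\sum_(l < k) track_impulse W k l *m S l w)).
  by apply: L2rv_sqnorm; apply: L2rv_mx_sum => l; exact: L2rv_mxM.
have iBs : L1rv P (fun w => \sum_(k < K) sqnorm (B k w)) by exact: L1rv_sum.
have iSs : L1rv P (fun w =>
    \sum_(k < K) sqnorm (\sum_(l < k) track_impulse W k l *m S l w)) by exact: L1rv_sum.
have isp : L1rv P (fun w => \sum_(k < K) spread (x k w)).
  by apply: L1rv_sum => k _; exact: L1rv_spread.
have i2 := L1rvD (L1rvZ (25 * rho ^+ 4) iBs) iSs.
have -> : N%:R * \sum_(k < K) sp k = mean P (fun w => N%:R * \sum_(k < K) spread (x k w)).
  by rewrite meanZ// mean_sum// => k; exact: L1rv_spread.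
have eB : mean P (fun w => \sum_(k < K) sqnorm (B k w)) =
    \sum_(k < K) mean P (fun w => sqnorm (B k w)).
  by apply: mean_sum => k; exact: iB.
have eS : mean P (fun w => \sum_(k < K) sqnorm (\sum_(l < k) track_impulse W k l *m S l w)) =
    \sum_(k < K) mean P (fun w => sqnorm (\sum_(l < k) track_impulse W k l *m S l w)).
  by apply: mean_sum => k; exact: iS.
have E : mean P (fun w => 2 * init K + 4 * alpha ^+ 2 * (25 * rho ^+ 4 * \sum_(k < K) sqnorm (B k w) +
     \sum_(k < K) sqnorm (\sum_(l < k) track_impulse W k l *m S l w))) =
   2 * init K + 4 * alpha ^+ 2 * (25 * rho ^+ 4 * \sum_(k < K) mean P (fun w => sqnorm (B k w)) +
     \sum_(k < K) mean P (fun w => sqnorm (\sum_(l < k) track_impulse W k l *m S l w))).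
  rewrite -eB -eS -(meanZ (25 * rho ^+ 4) iBs)
    -(meanD (L1rvZ _ iBs) iSs) -(meanZ (4 * alpha ^+ 2) i2).
  by rewrite -[in RHS](mean_cst P (2 * init K)) -(meanD (L1rv_cst P _) (L1rvZ _ i2)).
have h : mean P (fun w => N%:R * \sum_(k < K) spread (x k w)) <=
    mean P (fun w => 2 * init K + 4 * alpha ^+ 2 * (25 * rho ^+ 4 * \sum_(k < K) sqnorm (B k w) +
     \sum_(k < K) sqnorm (\sum_(l < k) track_impulse W k l *m S l w))).
  apply: mean_le; [exact: L1rvZ| |exact: spread_path].
  exact: (L1rvD (L1rv_cst P (2 * init K)) (L1rvZ (4 * alpha ^+ 2) i2)).
rewrite E in h; apply: (le_trans h).
have a40 : 0 <= 4 * alpha ^+ 2 by rewrite mulr_ge0 ?sqr_ge0.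
rewrite lerD2l ler_wpM2l//; apply: lerD.
  have r0 : 0 <= rho by rewrite (le_trans ler01)// rho_ge1//; case: hW => _ _ _ [].
  have c0 : 0 <= 25 * rho ^+ 4 by apply: mulr_ge0 => //; exact: exprn_ge0.
  rewrite ler_wpM2l//.
  have -> : N%:R * (2 * L ^+ 2 * (\sum_(k < K) sp k) + 8 * L * (\sum_(k < K) gp k)) =
      \sum_(k < K) N%:R * (2 * L ^+ 2 * sp k + 8 * L * gp k).
    by rewrite [X in _ * (X + _)]mulr_sumr [X in _ * (_ + X)]mulr_sumr -big_split /= mulr_sumr.
  apply: ler_sum => k _.
  apply: le_trans (mean_le (iB k) _ (drift_le k)) _.
    by apply: L1rvZ; apply: L1rvD; apply: L1rvZ; [exact: L1rv_spread|exact: L1rv_gap].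
  rewrite meanZ; last by apply: L1rvD; apply: L1rvZ; [exact: L1rv_spread|exact: L1rv_gap].
  rewrite meanD; [|by apply: L1rvZ; exact: L1rv_spread|by apply: L1rvZ; exact: L1rv_gap].
  by rewrite (meanZ _ (L1rv_spread k)) (meanZ _ (L1rv_gap k)).
apply: (@le_trans _ _ (\sum_(k < K) 33 * rho ^+ 3 * (N%:R * sigma ^+ 2))).
  by apply: ler_sum => k _; exact: consensus_noise.
by rewrite sumr_const card_ord -[leLHS]mulr_natl.
Qed.
Lemma avg_iterate k w : avg (x k.+1 w) =
  avg (x k w) - alpha *: (avg (fun i => grad (f i) (x k w i)) + avg (fun i => noise k i w)).
Proof.
have i0 := Ordinal hN.
have -> : avg (fun i => grad (f i) (x k w i)) + avg (fun i => noise k i w) =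
    avg (fun i => sample k i w).
  rewrite /avg -scalerDr -big_split /=; congr (_ *: _); apply: eq_bigr => i _.
  by rewrite addrC subrK.
rewrite (avgE (x k.+1 w) i0) (avgE (x k w) i0) (avgE (fun i => sample k i w) i0).
have := @Pi_iterate _ _ _ _ _ hW d (X ^~ w) (G ^~ w) (H ^~ w) alpha
  (G0 w) (XS ^~ w) (GS ^~ w) k.
by rewrite -/(X k.+1 w) => ->; rewrite linearB linearZ.
Qed.

(** The factor [1 / N] is the linear speedup; it comes from the orthogonality of
the noises of different agents. *)
Lemma avg_noise_variance k :
  mean P (fun w => sqnorm (avg (fun i => noise k i w))) <= sigma ^+ 2 / N%:R.
Proof.
have n0 : (0 : R) < N%:R by rewrite ltr0n.
have sn i : L2rv_mx P (noise k i) by exact: L2rv_noise.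
have E : mean P (fun w => sqnorm (\sum_i noise k i w)) = \sum_i mean P (fun w => sqnorm (noise k i w)).
  apply: mean_sqnorm_sum => //; first exact: index_enum_uniq.
  by move=> i i'; exact: noise_orth_space.
have -> : mean P (fun w => sqnorm (avg (fun i => noise k i w))) =
    N%:R^-1 ^+ 2 * mean P (fun w => sqnorm (\sum_i noise k i w)).
  rewrite -meanZ; last by apply: L2rv_sqnorm; exact: L2rv_mx_sum.
  by apply: mean_ext => w; exact: sqnormZ.
rewrite E; apply: (@le_trans _ _ (N%:R^-1 ^+ 2 * \sum_(i < N) sigma ^+ 2)).
  by rewrite ler_wpM2l ?sqr_ge0//; apply: ler_sum => i _; exact: noise_variance.
have e (b : R) : N%:R^-1 ^+ 2 * (b *+ N) = b / N%:R.
  rewrite -[b *+ N]mulr_natl expr2 -mulrA [X in _ * X]mulrA mulVf ?lt0r_neq0//.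
  by rewrite mul1r mulrC.
by rewrite sumr_const card_ord e.
Qed.

Let grads k w := avg (fun i => grad (f i) (x k w i)).
Let snoise k w := avg (fun i => noise k i w).
Let shifted k w := avg (x k w) - xstar - alpha *: grads k w.

Lemma avg_entry (y : 'I_N -> 'rV[R]_d) j : avg y 0 j = N%:R^-1 * \sum_i y i 0 j.
Proof. by rewrite mxE summxE. Qed.

Let shifted_present k j : measurable_wrt (Fk k) (fun w => shifted k w 0 j).
Proof.
apply/measurable_wrtP => //.
have mx i j' : @measurable_fun _ _ (g_sigma_algebraType (Fk k)) R setT (fun w => x k w i 0 j').
  by apply/measurable_wrtP => //; exact: x_present.
apply: (@eq_measurable_fun _ _ _ _ _ (fun w : g_sigma_algebraType (Fk k) =>
   N%:R^-1 * (\sum_i x k w i 0 j) - xstar 0 j -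
   alpha * (N%:R^-1 * \sum_i grad (f i) (x k w i) 0 j))).
  move=> w _; rewrite -(avg_entry (x k w)) -(avg_entry (fun i => grad (f i) (x k w i))).
  by rewrite /shifted /grads; move: (avg _) (avg _) => a b; rewrite !mxE.
apply: measurable_funB.
  apply: measurable_funB => //; apply: measurable_funM => //.
  by apply: measurable_sum => i.
do 2 apply: measurable_funM => //.
apply: measurable_sum => i.
exact: (@gradf_measurable _ (g_sigma_algebraType (Fk k)) (fun w => x k w i)).
Qed.

Let sqgrads k : L2rv_mx P (grads k).
Proof. by apply: L2rv_mxZ; apply: L2rv_mx_sum => i; exact: L2rv_gradf. Qed.
Let sqsnoise k : L2rv_mx P (snoise k).
Proof. by apply: L2rv_mxZ; apply: L2rv_mx_sum => i; exact: L2rv_noise. Qed.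
Let sqdev k : L2rv_mx P (fun w => avg (x k w) - xstar).
Proof. by apply: L2rv_mxB => //; exact: L2rv_mx_cst. Qed.
Let sqshifted k : L2rv_mx P (shifted k).
Proof. by apply: L2rv_mxB => //; exact: L2rv_mxZ. Qed.

(** The mean of the iterates and the exact gradients are known before the samples
of time [k] are drawn. *)
Lemma shifted_noise_orth k : mean P (fun w => mxdot (shifted k w) (snoise k w)) = 0.
Proof.
have sn i j : L2rv P (fun w => noise k i w 0 j) by exact: L2rv_noise.
have iu i j : L1rv P (fun w => shifted k w 0 j * noise k i w 0 j).
  by apply: L2rv_mul => //; exact: sqshifted.
rewrite mean_mxdot// big_ord1; apply: big1 => j _.
have -> : mean P (fun w => shifted k w 0 j * snoise k w 0 j) =
   mean P (fun w => \sum_i N%:R^-1 * (shifted k w 0 j * noise k i w 0 j)).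
  apply: mean_ext => w; rewrite [snoise k w 0 j]avg_entry mulrCA mulr_sumr mulr_sumr.
  by [].
rewrite mean_sum; last by move=> i; exact: L1rvZ.
apply: big1 => i _; rewrite meanZ// (cond_mean0_orthogonal (Fkm (k := k)) (noise_mean0 k i j)) ?mulr0//.
Qed.

Let dist k := mean P (fun w => sqnorm (avg (x k w) - xstar)).

Lemma descent_bound k : 0 < alpha -> alpha * L <= 1 / 8 ->
  dist k.+1 <= dist k - alpha * gp k + 3 * alpha * L * sp k + alpha ^+ 2 * (sigma ^+ 2 / N%:R).
Proof.
move=> a0 aL.
have i1 : L1rv P (fun w => sqnorm (shifted k w)) by exact: L2rv_sqnorm.
have i2 : L1rv P (fun w => mxdot (shifted k w) (snoise k w)) by exact: L2rv_mxdot.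
have i3 : L1rv P (fun w => sqnorm (snoise k w)) by exact: L2rv_sqnorm.
have i4 : L1rv P (fun w => sqnorm (avg (x k w) - xstar)) by exact: L2rv_sqnorm.
have E1 : dist k.+1 = mean P (fun w => sqnorm (shifted k w)) -
    2 * alpha * mean P (fun w => mxdot (shifted k w) (snoise k w)) +
    alpha ^+ 2 * mean P (fun w => sqnorm (snoise k w)).
  rewrite -(meanZ (2 * alpha) i2) -(meanZ (alpha ^+ 2) i3) -(meanB i1 (L1rvZ _ i2)).
  rewrite -(meanD (L1rvB i1 (L1rvZ _ i2)) (L1rvZ _ i3)).
  apply: mean_ext => w; rewrite avg_iterate -/(grads k w) -/(snoise k w).
  rewrite scalerDr opprD addrA [_ + _ - xstar]addrAC [_ - _ - xstar]addrAC -/(shifted k w).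
  by rewrite (sqnormB (shifted k w)) mxdotZr sqnormZ mulrA.
rewrite E1 shifted_noise_orth mulr0 subr0.
have h2 : alpha ^+ 2 * mean P (fun w => sqnorm (snoise k w)) <= alpha ^+ 2 * (sigma ^+ 2 / N%:R).
  by rewrite ler_wpM2l ?sqr_ge0// avg_noise_variance.
suff h1 : mean P (fun w => sqnorm (shifted k w)) <= dist k - alpha * gp k + 3 * alpha * L * sp k.
  exact: lerD h1 h2.
rewrite -(meanZ alpha (L1rv_gap k)) -(meanZ (3 * alpha * L) (L1rv_spread k)).
rewrite -(meanB i4 (L1rvZ alpha (L1rv_gap k))).
rewrite -(meanD (L1rvB i4 (L1rvZ alpha (L1rv_gap k))) (L1rvZ (3 * alpha * L) (L1rv_spread k))).
apply: mean_le => //.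
  exact: (L1rvD (L1rvB i4 (L1rvZ alpha (L1rv_gap k))) (L1rvZ (3 * alpha * L) (L1rv_spread k))).
by move=> w; exact: (descent_step hN hL hf).
Qed.

Lemma descent_sum K : 0 < alpha -> alpha * L <= 1 / 8 ->
  alpha * (\sum_(k < K) gp k) <= sqnorm (avg x0 - xstar) +
    3 * alpha * L * (\sum_(k < K) sp k) + K%:R * (alpha ^+ 2 * (sigma ^+ 2 / N%:R)).
Proof.
move=> a0 aL.
suff : dist K + alpha * (\sum_(k < K) gp k) <= sqnorm (avg x0 - xstar) +
    3 * alpha * L * (\sum_(k < K) sp k) + K%:R * (alpha ^+ 2 * (sigma ^+ 2 / N%:R)).
  apply: le_trans; rewrite lerDr; apply: mean_ge0 => w; exact: sqnorm_ge0.
elim: K => [|K IH].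
  rewrite !big_ord0 !mulr0 mul0r !addr0 /dist.
  by rewrite (_ : mean P _ = sqnorm (avg x0 - xstar))// -[RHS](mean_cst P).
rewrite !big_ord_recr /= -natr1; have := descent_bound K a0 aL; move: IH.
move: (\sum_(i < K) _) (\sum_(i < K) _) (dist _) (dist _) (gp K) (sp K)
  (alpha ^+ 2 * _) => s1 s2 d1 d2 gg ss v.
lra.
Qed.
End process.

(** * Choice of the step size *)

Ltac nonneg := repeat first
  [ done | by apply: ltW | apply: sqr_ge0 | apply: exprn_ge0 | apply: mulr_ge0
  | rewrite invr_ge0 | lra ].

Section stepsize.
Context (R : realType).
Implicit Types (L rho sigma alpha : R).

(** With [160 * L * rho ^ 2 * alpha <= 1], [Sx] and [Sf] occur on the right of the
disagreement inequality, multiplied by [L], with coefficients below [1 / 30]; this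
is small enough to solve the two inequalities for [Sf] and [Sx]. *)
Lemma combine_bounds (n k L rho sigma alpha Sf Sx E X0 init : R) :
  0 < n -> 0 <= k -> 0 < L -> 1 <= rho -> 0 < alpha -> 160 * L * rho ^+ 2 * alpha <= 1 ->
  0 <= Sf -> 0 <= Sx -> 0 <= E -> 0 <= X0 ->
  init <= 2 * (n * (rho * E)) ->
  n * Sx <= 2 * init + 4 * alpha ^+ 2 * (25 * rho ^+ 4 *
     (n * (2 * L ^+ 2 * Sx + 8 * L * Sf)) + k * (33 * rho ^+ 3 * (n * sigma ^+ 2))) ->
  alpha * Sf <= X0 + 3 * alpha * L * Sx + k * (alpha ^+ 2 * (sigma ^+ 2 / n)) ->
  Sf + L * Sx <= 1000 * (X0 / alpha + k * alpha * (sigma ^+ 2 / n) + L * (rho * E) +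
     k * L * (alpha ^+ 2 * rho ^+ 3 * sigma ^+ 2)).
Proof.
move=> n0 k0 L0 r1 a0 ha Sf0 Sx0 E0 X00 hi hx hf.
set t := L * rho ^+ 2 * alpha.
have t0 : 0 <= t by rewrite /t; nonneg.
have t1 : t <= 1 / 160 by rewrite /t; lra.
have t2 z : 0 <= z -> t ^+ 2 * z <= 1 / 160 * (1 / 160 * z).
  by move=> z0; rewrite expr2 -mulrA ler_pM ?ler_wpM2r//; nonneg.
have hx1 : L * Sx <= 4 * (L * (rho * E)) + 200 * (t ^+ 2 * (L * Sx)) +
    800 * (t ^+ 2 * Sf) + 132 * (k * L * (alpha ^+ 2 * rho ^+ 3 * sigma ^+ 2)).
  rewrite -(ler_pM2l n0).
  have -> : n * (L * Sx) = L * (n * Sx) by ring.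
  apply: (@le_trans _ _ (L * (2 * (2 * (n * (rho * E))) + 4 * alpha ^+ 2 * (25 * rho ^+ 4 *
     (n * (2 * L ^+ 2 * Sx + 8 * L * Sf)) + k * (33 * rho ^+ 3 * (n * sigma ^+ 2)))))).
    by rewrite (ler_pM2l L0); lra.
  by rewrite /t le_eqVlt; apply/orP; left; apply/eqP; ring.
have hx2 := t2 _ (mulr_ge0 (ltW L0) Sx0).
have hx3 := t2 _ Sf0.
have hf1 : Sf <= X0 / alpha + 3 * (L * Sx) + k * alpha * (sigma ^+ 2 / n).
  rewrite -(ler_pM2l a0).
  apply: le_trans hf _; rewrite le_eqVlt; apply/orP; left; apply/eqP.
  by field; rewrite !lt0r_neq0.
have p1 : 0 <= X0 / alpha by nonneg.
have p2 : 0 <= k * alpha * (sigma ^+ 2 / n) by nonneg.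
have p3 : 0 <= L * (rho * E) by nonneg.
have p4 : 0 <= k * L * (alpha ^+ 2 * rho ^+ 3 * sigma ^+ 2).
  by nonneg.
lra.
Qed.

(** The norm weighted by [R0] is [dl] times a series, where [dl] stands for [delta];
the series itself is recovered at the cost of [1 / dl <= rho]. *)
Lemma initial_bound (rho dl NE sY sC a c : R) : 0 < rho -> 0 < dl -> 1 <= dl * rho ->
  0 <= sY -> 0 <= sC -> 0 <= a <= c ->
  dl * sY + 8 * c ^+ 2 * rho ^+ 2 * (dl * sC) <= NE ->
  2 * sY + 12 * a ^+ 2 * rho ^+ 2 * sC <= 2 * (rho * NE).
Proof.
move=> r0 d0 dr sY0 sC0 /andP[a0 ac] h.
have a2 : a ^+ 2 <= c ^+ 2 by rewrite ler_pXn2r ?nnegrE//; lra.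
have h1 : rho * (dl * sY + 8 * c ^+ 2 * rho ^+ 2 * (dl * sC)) <= rho * NE by rewrite ler_pM2l.
have h2 : 1 * (sY + 8 * c ^+ 2 * rho ^+ 2 * sC) <= (dl * rho) * (sY + 8 * c ^+ 2 * rho ^+ 2 * sC).
  by rewrite ler_wpM2r//; apply: addr_ge0 => //; nonneg.
have h3 : a ^+ 2 * (rho ^+ 2 * sC) <= c ^+ 2 * (rho ^+ 2 * sC) by rewrite ler_wpM2r//; nonneg.
have h4 : 0 <= c ^+ 2 * (rho ^+ 2 * sC) by nonneg.
lra.
Qed.

(** [1 / alpha] is the sum of its smallest admissible value and of the two values
that balance it against the noise terms. Each noise term is then bounded by the
corresponding summand, and [sigma = 0] is not a special case. *)
Lemma stepsize_bounds (n k L rho sigma u alpha E X0 : R) :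
  0 < n -> 0 < k -> 0 < L -> 1 <= rho -> 0 <= sigma -> 0 <= E -> 0 <= X0 ->
  0 <= u -> u ^+ 3 = (sigma / k) ^+ 2 ->
  alpha = (160 * L * rho ^+ 2 + sigma * Num.sqrt k / Num.sqrt n + rho * (k * u))^-1 ->
  k^-1 * (X0 / alpha + k * alpha * (sigma ^+ 2 / n) + L * (rho * E) +
     k * L * (alpha ^+ 2 * rho ^+ 3 * sigma ^+ 2)) <=
  (160 * L + X0 + 1 + L) * (sigma / Num.sqrt (n * k) + rho * u + rho ^+ 2 * X0 / k
    + rho * E / k).
Proof.
move=> n0 k0 L0 r1 s0 E0 X00 u0 u3.
set sn := Num.sqrt n; set sk := Num.sqrt k.
have sn0 : 0 < sn by rewrite sqrtr_gt0.
have sk0 : 0 < sk by rewrite sqrtr_gt0.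
have nE : n = sn ^+ 2 by rewrite sqr_sqrtr// ltW.
have kE : k = sk ^+ 2 by rewrite sqr_sqrtr// ltW.
have snkE : Num.sqrt (n * k) = sn * sk by rewrite sqrtrM// ltW.
set q1 := sigma * sk / sn; set q2 := rho * (k * u); set q0 := 160 * L * rho ^+ 2.
have r0 : 0 < rho by lra.
have q00 : 0 < q0 by rewrite /q0 !mulr_gt0// exprn_gt0.
have q10 : 0 <= q1 by rewrite /q1; nonneg.
have q20 : 0 <= q2 by rewrite /q2; nonneg.
move=> aE.
have q0' : 0 < q0 + q1 + q2 by lra.
have a0 : 0 < alpha by rewrite aE invr_gt0.
have ia : alpha * (q0 + q1 + q2) = 1 by rewrite aE mulVf// lt0r_neq0.
have aq1 : alpha * q1 <= 1.
  have : 0 <= alpha * q0 by nonneg.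
  have : 0 <= alpha * q2 by nonneg.
  by rewrite !mulrDr in ia; lra.
have aq2 : alpha * q2 <= 1.
  have : 0 <= alpha * q0 by nonneg.
  have : 0 <= alpha * q1 by nonneg.
  by rewrite !mulrDr in ia; lra.
set A := sigma / (sn * sk).
have A0 : 0 <= A by rewrite /A; nonneg.
have e1 : k^-1 * (X0 / alpha) = 160 * L * (rho ^+ 2 * X0 / k) + X0 * A + X0 * (rho * u).
  rewrite aE invrK /A /q0 /q1 /q2 kE; field.
  by rewrite !lt0r_neq0.
have e2 : k^-1 * (k * alpha * (sigma ^+ 2 / n)) <= A.
  have -> : k^-1 * (k * alpha * (sigma ^+ 2 / n)) = (alpha * q1) * A.
    by rewrite /q1 /A nE; field; rewrite !lt0r_neq0.
  by rewrite ler_piMl.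
have e3 : k^-1 * (k * L * (alpha ^+ 2 * rho ^+ 3 * sigma ^+ 2)) <= L * (rho * u).
  have s2 : sigma ^+ 2 = k ^+ 2 * u ^+ 3 by rewrite u3; field; rewrite lt0r_neq0.
  have -> : k^-1 * (k * L * (alpha ^+ 2 * rho ^+ 3 * sigma ^+ 2)) = (alpha * q2) ^+ 2 * (L * (rho * u)).
    by rewrite s2 /q2; field; rewrite lt0r_neq0.
  have aq20 : 0 <= alpha * q2 by nonneg.
  rewrite ler_piMl ?expr_le1//; nonneg.
have -> : k^-1 * (X0 / alpha + k * alpha * (sigma ^+ 2 / n) + L * (rho * E) +
     k * L * (alpha ^+ 2 * rho ^+ 3 * sigma ^+ 2)) =
   k^-1 * (X0 / alpha) + k^-1 * (k * alpha * (sigma ^+ 2 / n)) + L * (rho * E / k) +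
   k^-1 * (k * L * (alpha ^+ 2 * rho ^+ 3 * sigma ^+ 2)) by ring.
rewrite e1 snkE -/A.
have g1 : 0 <= rho ^+ 2 * X0 / k by nonneg.
have g2 : 0 <= rho * u by nonneg.
have g3 : 0 <= rho * E / k by nonneg.
have m1 : 0 <= X0 * (rho ^+ 2 * X0 / k) by nonneg.
have m2 : 0 <= X0 * (rho * E / k) by nonneg.
have m3 : 0 <= L * (rho ^+ 2 * X0 / k) by nonneg.
have m4 : 0 <= L * (rho * E / k) by nonneg.
have m5 : 0 <= L * A by nonneg.
have m6 : 0 <= L * (rho * u) by nonneg.
rewrite mulrDr mulrDr mulrDr; lra.
Qed.

(** [160] is a numerical margin: with [rho >= 1] one has [sqrt Q <= 6 * rho],
[sqrt 480 <= 22] and [22 * 6 <= 160]. *)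
Lemma alpha_cvx_ge L (tau : nat) (lambda : R) : 0 < L -> 0 <= lambda < 1 -> (1 <= tau)%N ->
  (160 * L * (tau%:R / (1 - lambda)) ^+ 2)^-1 <= alpha_cvx L tau lambda.
Proof.
move=> L0 l01 t1; have r1 := rho_ge1 l01 t1; case/andP: (l01) => l0 l1.
set rho := tau%:R / (1 - lambda).
have t0 : (0 : R) < tau%:R by rewrite ltr0n.
have d0 : 0 < 1 - lambda by rewrite subr_gt0.
have r0 : 0 < rho by rewrite divr_gt0.
have QE : Qcst tau lambda = 1 + 32 * rho ^+ 2.
  by rewrite /Qcst /Defs.eta /Delta /rho; field; rewrite !lt0r_neq0.
have Q0 : 0 < Qcst tau lambda by rewrite QE ltr_wpDr//; nonneg.
have dE : delta tau lambda = (1 + lambda) / rho.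
  by rewrite /delta /rho; field; rewrite !lt0r_neq0.
have sQ : Num.sqrt (Qcst tau lambda) <= 6 * rho.
  rewrite -[leRHS]ger0_norm; last by nonneg.
  rewrite -sqrtr_sqr ler_wsqrtr// QE [leRHS]exprMn.
  have : 1 <= rho ^+ 2 by rewrite expr_ge1// ltW. 
  lra.
have s480 : Num.sqrt 480 <= 22 :> R.
  by rewrite -[leRHS]ger0_norm// -sqrtr_sqr ler_wsqrtr//; lra.
have s480p : 0 < Num.sqrt 480 :> R by rewrite sqrtr_gt0 ltr0n.
have sQp : 0 < Num.sqrt (Qcst tau lambda) by rewrite sqrtr_gt0.
rewrite /alpha_cvx dE ler_pdivlMr ?mulr_gt0//.
rewrite ler_pdivrMl ?mulr_gt0 ?exprn_gt0 ?invr_gt0//.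
have h : Num.sqrt 480 * L * Num.sqrt (Qcst tau lambda) <= 22 * L * (6 * rho).
  by rewrite ler_pM ?mulr_ge0 ?(ltW L0) ?(ltW s480p) ?(ltW sQp)// ler_pM2r.
apply: (le_trans h).
have -> : 160 * L * rho ^+ 2 * ((1 + lambda) / rho) = 160 * L * rho * (1 + lambda).
  by field; rewrite lt0r_neq0.
have Lr : 0 <= L * rho by nonneg.
have : 0 <= L * rho * lambda by nonneg.
lra.
Qed.

Lemma powR23_cube (y : R) : 0 <= y -> (y `^ (2 / 3)) ^+ 3 = y ^+ 2.
Proof.
move=> y0; rewrite -powR_mulrn ?powR_ge0// -powRrM.
by rewrite divfK ?pnatr_eq0// powR_mulrn.
Qed.
End stepsize.

Theorem corollary3 (R : realType) :
  exists C : R -> R -> R,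
  forall (N d : nat) (hN : (1 <= N)%N) (hd : (1 <= d)%N)
    (dX : measure_display) (Xi : 'I_N -> measurableType dX)
    (D : forall i, probability (Xi i) R)
    (F : forall i, 'rV[R]_d -> Xi i -> R) (f : 'I_N -> 'rV[R]_d -> R)
    (hF : stochastic_objective D F f)
    (L : R) (hL : 0 < L) (xstar : 'rV[R]_d)
    (hf : function_assumption f L xstar)
    (W : nat -> 'M[R]_N) (tau : nat) (lambda : R)
    (hW : network_assumption W tau lambda)
    (x0 : 'I_N -> 'rV[R]_d)
    (dT : measure_display) (T : measurableType dT) (P : probability T R)
    (xi : nat -> forall i, {RV P >-> Xi i})
    (Fk : R -> nat -> set (set T)) (sigma : R) (hsigma : 0 <= sigma)
    (hnoise : forall alpha : R, 0 < alpha <= alpha_cvx L tau lambda ->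
       gradient_noise_assumption P F f sigma xi W x0 alpha (Fk alpha)),
  let X0 := sqnorm (avg x0 - xstar) in
  forall K : nat, (1 <= K)%N ->
  exists2 alpha : R, 0 < alpha <= alpha_cvx L tau lambda &
  let x := sgt_x F xi W x0 alpha in
  ((K%:R^-1)%:E * \sum_(0 <= k < K)
      ('E_P[fun w => (avg_fun f (avg (x k w)) - avg_fun f xstar)%R]
       + (L / N%:R)%:E * 'E_P[fun w => sqnorm (xhat (x k w))])
   <= (C L X0 *
       (sigma / Num.sqrt (N%:R * K%:R)
        + tau%:R / (1 - lambda) * (sigma / K%:R) `^ (2 / 3)
        + tau%:R ^+ 2 * X0 / ((1 - lambda) ^+ 2 * K%:R)
        + tau%:R * Ebar0 f L xstar W tau lambda x0
          / ((1 - lambda) * K%:R)))%:E)%E.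
Proof.
(* [X0] enters the constant because [X0 / alpha] contains the two noise terms
   of [1 / alpha] multiplied by [X0]. *)
exists (fun L X0 => 1000 * (160 * L + X0 + 1 + L)).
move=> N d hN hd dX Xi D F f hF L hL xstar hf W tau lambda hW x0 dT T P xi Fk sigma
  hsigma hnoise X0 K hK.
have lam01 : 0 <= lambda < 1 by case: hW => _ _ _ [].
have tau1 : (1 <= tau)%N by case: hW => _ _ _ [].
set rho := tau%:R / (1 - lambda).
have r1 : 1 <= rho by exact: rho_ge1.
have r0 : 0 < rho by exact: lt_le_trans ltr01 r1.
have n0 : (0 : R) < N%:R by rewrite ltr0n.
have k0 : (0 : R) < K%:R by rewrite ltr0n.
set E := Ebar0 f L xstar W tau lambda x0.
set u := (sigma / K%:R) `^ (2 / 3).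
have u0 : 0 <= u by exact: powR_ge0.
have u3 : u ^+ 3 = (sigma / K%:R) ^+ 2 by apply: powR23_cube; nonneg.
set q0 := 160 * L * rho ^+ 2.
have q00 : 0 < q0 by apply: mulr_gt0; [exact: mulr_gt0|exact: exprn_gt0].
(* [rho * (K * u)] is the cube root of [rho ^ 3 * sigma ^ 2 * K]. *)
have [alpha aE] : exists a,
    a = (q0 + sigma * Num.sqrt K%:R / Num.sqrt N%:R + rho * (K%:R * u))^-1 by eexists.
have q1 : 0 <= sigma * Num.sqrt K%:R / Num.sqrt N%:R.
  by rewrite !mulr_ge0 ?invr_ge0 ?sqrtr_ge0.
have q2 : 0 <= rho * (K%:R * u) by nonneg.
have a0 : 0 < alpha by rewrite aE invr_gt0; lra.
have aq0 : alpha <= q0^-1 by rewrite aE lef_pV2 ?posrE; lra.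
have aq : q0 * alpha <= 1 by rewrite -ler_pdivlMl// mulr1.
have acvx : alpha <= alpha_cvx L tau lambda.
  exact: le_trans aq0 (alpha_cvx_ge hL lam01 tau1).
have X00 : 0 <= X0 by exact: sqnorm_ge0.
have noise_a := hnoise alpha (introT andP (conj a0 acvx)).
exists alpha; first by rewrite a0 acvx.
move=> x.
set Y := (1%:M - Pi_mx R N) *m rows_mx x0.
set C := rows_mx (fun i => grad (f i) xstar).
set init := \sum_(k < K) sqnorm (chain (Wtilde W) 0 k *m (Y - (alpha * k%:R) *: C)).
have d0 : 0 < 1 - lambda by case/andP: lam01 => *; rewrite subr_gt0.
have t0 : (0 : R) < tau%:R by rewrite ltr0n.
have dr : 1 <= delta tau lambda * rho.
  have -> : delta tau lambda * rho = 1 + lambda.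
    by rewrite /delta /rho; field; rewrite !lt0r_neq0.
  by case/andP: lam01 => *; rewrite lerDl.
have dl0 : 0 < delta tau lambda by rewrite -(pmulr_lgt0 _ r0); lra.
have NE n : delta tau lambda * (\sum_(k < n) sqnorm (chain (Wtilde W) 0 k *m Y)) +
    8 * alpha_cvx L tau lambda ^+ 2 * rho ^+ 2 *
      (delta tau lambda * (\sum_(k < n) sqnorm (chain (Wtilde W) 0 k *m C))) <= N%:R * E.
  rewrite /E /Ebar0 [leRHS]mulrA mulfV ?lt0r_neq0// mul1r xhatE stackE.
  apply: lerD; first exact: R0_ge.
  have -> : 2 * alpha_cvx L tau lambda ^+ 2 / Defs.eta tau lambda ^+ 2 =
      8 * alpha_cvx L tau lambda ^+ 2 * rho ^+ 2.
    by rewrite /rho /Defs.eta /Delta; field; rewrite !lt0r_neq0.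
  by apply: ler_wpM2l; [nonneg|exact: R0_ge].
have E0 : 0 <= E.
  by have := NE 0%N; rewrite !big_ord0 !mulr0 addr0 pmulr_rge0.
have S0 n (Z : 'M[R]_(N, d)) : 0 <= \sum_(k < n) sqnorm (chain (Wtilde W) 0 k *m Z).
  by apply: sumr_ge0 => k _; exact: sqnorm_ge0.
have hinit : init <= 2 * (N%:R * (rho * E)).
  apply: le_trans (sum_initial_le hN hW K Y C alpha) _.
  rewrite (mulrCA N%:R rho); apply: (initial_bound r0 dl0 dr (S0 K Y) (S0 K C) _ (NE K)).
  by rewrite ltW.
have aL : alpha * L <= 1 / 8.
  have L1 : L <= L * rho ^+ 2 by rewrite ler_peMr ?exprn_ege1// ltW.
  have : alpha * L <= alpha * (L * rho ^+ 2) by rewrite ler_pM2l.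
  by rewrite /q0 in aq; lra.
pose sp k := mean P (fun w => spread (x k w)).
pose gp k := mean P (fun w => gap f xstar (avg (x k w))).
have hcons := consensus_bound hN hF hL hf hW noise_a K.
have hdesc := descent_sum hN hF hL hf hW noise_a K a0 aL.
have Sf0 : 0 <= \sum_(k < K) gp k.
  by apply: sumr_ge0 => k _; apply: mean_ge0 => w; exact: (gap_ge0 hf).
have Sx0 : 0 <= \sum_(k < K) sp k.
  apply: sumr_ge0 => k _; apply: mean_ge0 => w; apply: mulr_ge0; first by rewrite invr_ge0 ltW.
  by apply: sumr_ge0 => i _; exact: sqnorm_ge0.
have hcomb := combine_bounds n0 (ltW k0) hL r1 a0 aq Sf0 Sx0 E0 X00 hinit hcons hdesc.
have hstep := stepsize_bounds n0 k0 hL r1 hsigma E0 X00 u0 u3 aE.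
have isp k := L1rv_spread hL hf noise_a k.
have igp k := L1rv_gap hN hL hf noise_a k.
have -> : (\sum_(0 <= k < K) ('E_P[fun w => (avg_fun f (avg (x k w)) - avg_fun f xstar)%R]
       + (L / N%:R)%:E * 'E_P[fun w => sqnorm (xhat (x k w))]))%E =
   (\sum_(k < K) gp k + L * \sum_(k < K) sp k)%:E.
  rewrite mulr_sumr -big_split /= -sumEFin big_mkord; apply: eq_bigr => k _.
  rewrite (expectationE (igp k)).
  have -> : (fun w => sqnorm (xhat (x k w))) = (fun w => N%:R * spread (x k w)).
    by apply/funext => w; rewrite xhatE sqnorm_colstack spreadE.
  rewrite (expectationE (L1rvZ N%:R (isp k))) (meanZ _ (isp k)) -EFinM -EFinD.
  by congr EFin; rewrite /gp /sp; field; rewrite lt0r_neq0.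
rewrite -EFinM lee_fin.
apply: (@le_trans _ _ (K%:R^-1 * (1000 * (X0 / alpha + K%:R * alpha * (sigma ^+ 2 / N%:R) + L * (rho * E) +
     K%:R * L * (alpha ^+ 2 * rho ^+ 3 * sigma ^+ 2))))).
  by rewrite ler_pM2l ?invr_gt0.
have c0 : (0 : R) <= 1000 by exact: ler0n.
rewrite [leLHS]mulrCA; apply: le_trans (ler_wpM2l c0 hstep) _.
rewrite mulrA; apply: ler_wpM2l.
  apply: mulr_ge0 => //; apply: addr_ge0; last exact: ltW.
  apply: addr_ge0; last exact: ler01.
  by apply: addr_ge0 => //; apply: mulr_ge0; [exact: ler0n|exact: ltW].
rewrite le_eqVlt; apply/orP; left; apply/eqP; rewrite /rho.
by field; rewrite !lt0r_neq0 ?sqrtr_gt0 ?mulr_gt0.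
Qed.
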